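(* The braided Hopf algebra structure of $\underline{U_h}=(U_h,\mu,\eta,\underline\Delta,\epsilon,\underline S)$ (the transmutation of $U_h=U_h(sl_2)$) induces a braided Hopf algebra structure with invertible antipode for $\tilde{\mathcal U}_q^{\mathrm{ev}}$. In other words, for each $$f\in\{\psi,\psi^{-1},\mu,\eta,\underline\Delta,\epsilon,\underline S,\underline S^{-1}\},\qquad f:U_h^{\hat\otimes i}\to U_h^{\hat\otimes j}\quad(i,j\ge0),$$ we have $f\bigl((\tilde{\mathcal U}_q^{\mathrm{ev}})^{\tilde\otimes i}\bigr)\subset(\tilde{\mathcal U}_q^{\mathrm{ev}})^{\tilde\otimes j}$, and the induced map $f:(\tilde{\mathcal U}_q^{\mathrm{ev}})^{\tilde\otimes i}\to(\tilde{\mathcal U}_q^{\mathrm{ev}})^{\tilde\otimes j}$ is continuous.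
   Context: Quantum group: let $h$ be an indeterminate, $v=\exp(h/2)$, $q=v^2=\exp h$ in $\mathbb Q[[h]]$; $[i]=(v^i-v^{-i})/(v-v^{-1})$, $[n]!=[n]\cdots[1]$, $[i]_q=(q^i-1)/(q-1)$, $[n]_q!=[n]_q\cdots[1]_q$. $U_h=U_h(sl_2)$ is the $h$-adically complete $\mathbb Q[[h]]$-algebra topologically generated by $H,E,F$ with $HE-EH=2E$, $HF-FH=-2F$, $EF-FE=(K-K^{-1})/(v-v^{-1})$, $K=v^H=\exp(hH/2)$, and Hopf structure $\Delta(H)=H\otimes1+1\otimes H$, $\Delta(E)=E\otimes1+K\otimes E$, $\Delta(F)=F\otimes K^{-1}+1\otimes F$, $S(H)=-H$, $S(E)=-K^{-1}E$, $S(F)=-FK$, $\epsilon(H)=\epsilon(E)=\epsilon(F)=0$; $\Delta(x)=\sum x_{(1)}\otimes x_{(2)}$. Universal $R$-matrix $R=\sum\alpha\otimes\beta=\exp(\frac h4H\otimes H)\sum_{n\ge0}v^{n(n-1)/2}\frac{(v-v^{-1})^n}{[n]!}F^n\otimes E^n$. $\hat\otimes$ is the $h$-adically completed tensor product. Left adjoint action: $x\triangleright y=\sum x_{(1)}yS(x_{(2)})$. Braided Hopf algebra $\underline{U_h}$ (in the braided category of $h$-adically complete left $U_h$-modules, $U_h$ with adjoint action): $\mu:U_h^{\hat\otimes2}\to U_h$, $\eta:\mathbb Q[[h]]\to U_h$, $\epsilon:U_h\to\mathbb Q[[h]]$ are the multiplication, unit and counit of $U_h$; $\psi(x\otimes y)=\sum(\beta\triangleright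 y)\otimes(\alpha\triangleright x)$, $\psi^{-1}(x\otimes y)=\sum(S(\alpha)\triangleright y)\otimes(\beta\triangleright x)$; $\underline\Delta(x)=\sum x_{(1)}S(\beta)\otimes(\alpha\triangleright x_{(2)})$; $\underline S(x)=\sum\beta\,S(\alpha\triangleright x)$, $\underline S^{-1}(x)=\sum S^{-1}(\alpha\triangleright x)\,\beta$. Subalgebras and completions: $e=(v-v^{-1})E$, $\tilde F^{(n)}=F^nK^n/[n]_q!$. $\mathcal U_q^{\mathrm{ev}}\subset U_h$ is the $\mathbb Z[q,q^{-1}]$-subalgebra generated by $K^{2},K^{-2},e$ and $\tilde F^{(n)}$, $n\ge1$. $\mathcal F_p(\mathcal U_q^{\mathrm{ev}})=\mathcal U_q^{\mathrm{ev}}e^p\,\mathcal U_q^{\mathrm{ev}}$ (two-sided ideal). For $n\ge1$, $\mathcal F_p((\mathcal U_q^{\mathrm{ev}})^{\otimes n})=\sum_{i=1}^n(\mathcal U_q^{\mathrm{ev}})^{\otimes(i-1)}\otimes\mathcal F_p(\mathcal U_q^{\mathrm{ev}})\otimes(\mathcal U_q^{\mathrm{ev}})^{\otimes(n-i)}$ (over $\mathbb Z[q,q^{-1}]$), and $(\tilde{\mathcal U}_q^{\mathrm{ev}})^{\tilde\otimes n}$ is the image of the natural map $\varprojlim_p(\mathcal U_q^{\mathrm{ev}})^{\otimes n}/\mathcal F_p((\mathcal U_q^{\mathrm{ev}})^{\otimes n})\to U_h^{\hat\otimes n}$; $\tilde{\mathcal U}_q^{\mathrm{ev}}$ is the case $n=1$.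 For $n=0$, $(\tilde{\mathcal U}_q^{\mathrm{ev}})^{\tilde\otimes0}=\mathbb Z[q,q^{-1}]$ with $\mathcal F_0=\mathbb Z[q,q^{-1}]$ and $\mathcal F_p=0$ for $p\ge1$. The topology on $(\tilde{\mathcal U}_q^{\mathrm{ev}})^{\tilde\otimes n}$ is the one for which a basis of neighborhoods of $0$ is given by the images of the kernels of the projections $\varprojlim_p(\cdot)\to(\mathcal U_q^{\mathrm{ev}})^{\otimes n}/\mathcal F_p$, $p\ge0$. *)

(* Defs.v *)
From HB Require Import structures.
From mathcomp Require Import all_boot all_order all_algebra.
From mathcomp Require Import boolp classical_sets.
From mathcomp Require finmap.
From mathcomp Require Import monalg.

Set Implicit Arguments.
Unset Strict Implicit.
Unset Printing Implicit Defensive.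

Import GRing.Theory.
Local Open Scope ring_scope.
Local Open Scope quotient_scope.
Local Open Scope classical_set_scope.

Record fps (A : Type) := Fps { fcoef : nat -> A }.

Lemma fpsP A (f g : fps A) : fcoef f =1 fcoef g -> f = g.
Proof. by case: f g => [f] [g] /= /funext ->. Qed.

HB.instance Definition _ A := gen_eqMixin (fps A).
HB.instance Definition _ A := gen_choiceMixin (fps A).

Section FpsRing.
Variable A : nzRingType.
Implicit Types f g : fps A.

Definition fpsC (a : A) := Fps (fun n => if n == 0%N then a else 0).
Definition fps_add f g := Fps (fun n => fcoef f n + fcoef g n).
Definition fps_opp f := Fps (fun n => - fcoef f n).
(* locked: unification would otherwise unfold products of series *)
Fact fps_mul_key : unit. Proof. by []. Qed.
Definition fps_mul := locked_with fps_mul_key (fun f g =>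
  Fps (fun n => \sum_(i < n.+1) fcoef f i * fcoef g (n - i))).
Lemma fps_mulE f g n :
  fcoef (fps_mul f g) n = \sum_(i < n.+1) fcoef f i * fcoef g (n - i).
Proof. by rewrite /fps_mul unlock. Qed.

Fact fps_addA : associative fps_add.
Proof. by move=> f g k; apply: fpsP => n /=; rewrite addrA. Qed.
Fact fps_addC : commutative fps_add.
Proof. by move=> f g; apply: fpsP => n /=; rewrite addrC. Qed.
Fact fps_add0 : left_id (fpsC 0) fps_add.
Proof. by move=> f; apply: fpsP => n /=; rewrite if_same add0r. Qed.
Fact fps_addN : left_inverse (fpsC 0) fps_opp fps_add.
Proof. by move=> f; apply: fpsP => n /=; rewrite if_same addNr. Qed.
HB.instance Definition _ :=
  GRing.isZmodule.Build (fps A) fps_addA fps_addC fps_add0 fps_addN.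

Let tr n f : {poly A} := \poly_(i < n.+1) fcoef f i.
Let coef_tr n f i : (i <= n)%N -> (tr n f)`_i = fcoef f i.
Proof. by move=> le_in; rewrite coef_poly ltnS le_in. Qed.
Let coef_trM n f g i : (i <= n)%N -> (tr n f * tr n g)`_i = fcoef (fps_mul f g) i.
Proof.
move=> le_in; rewrite coefM fps_mulE; apply: eq_bigr => j _; rewrite !coef_tr //.
  exact: leq_trans (leq_subr _ _) le_in.
by apply: leq_trans le_in; rewrite -ltnS.
Qed.

Fact fps_mulA : associative fps_mul.
Proof.
move=> f g k; apply: fpsP => n.
rewrite -(coef_trM _ _ (leqnn n)) -(coef_trM _ _ (leqnn n)).
transitivity ((tr n f * (tr n g * tr n k))`_n).
  rewrite !coefM; apply: eq_bigr => j _; congr (_ * _).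
  by rewrite coef_tr ?leq_subr// coef_trM ?leq_subr.
rewrite mulrA !coefM; apply: eq_bigr => j _; congr (_ * _).
have jn : (j <= n)%N by rewrite -ltnS.
by rewrite coef_trM // coef_tr.
Qed.
Fact fps_mul1 : left_id (fpsC 1) fps_mul.
Proof.
move=> f; apply: fpsP => n; rewrite fps_mulE /= big_ord_recl /= mul1r subn0 big1 ?addr0//.
by move=> i _; rewrite mul0r.
Qed.
Fact fps_mulr1 : right_id (fpsC 1) fps_mul.
Proof.
move=> f; apply: fpsP => n; rewrite fps_mulE /= big_ord_recr /= subnn mulr1 big1 ?add0r//.
by move=> i _; rewrite subn_eq0 leqNgt ltn_ord mulr0.
Qed.
Fact fps_mulDl : left_distributive fps_mul fps_add.
Proof.
move=> f g k; apply: fpsP => n; rewrite /= !fps_mulE -big_split.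
by apply: eq_bigr => i _; rewrite mulrDl.
Qed.
Fact fps_mulDr : right_distributive fps_mul fps_add.
Proof.
move=> f g k; apply: fpsP => n; rewrite /= !fps_mulE -big_split.
by apply: eq_bigr => i _; rewrite mulrDr.
Qed.
Fact fps_1_neq0 : fpsC 1 != fpsC 0.
Proof. by apply/eqP => /(congr1 (fun f : fps A => fcoef f 0%N)) /eqP; rewrite oner_eq0. Qed.
HB.instance Definition _ := GRing.Zmodule_isNzRing.Build (fps A)
  fps_mulA fps_mul1 fps_mulr1 fps_mulDl fps_mulDr fps_1_neq0.

End FpsRing.

Section FpsComRing.
Variable R : comNzRingType.
Implicit Types f g : fps R.

Fact fps_mulC : @commutative (fps R) _ *%R.
Proof.
move=> f g; apply: fpsP => n; rewrite !fps_mulE.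
rewrite (reindex_inj rev_ord_inj) /=; apply: eq_bigr => i _.
by rewrite subSS subKn ?leq_ord // mulrC.
Qed.
HB.instance Definition _ := GRing.PzRing_hasCommutativeMul.Build (fps R) fps_mulC.

Definition fps_unit : {pred fps R} := [pred f | `[< exists g, g * f = 1 >]].
Definition fps_inv f : fps R :=
  if f \in fps_unit then xget 0 [set g | g * f = 1] else f.
Fact fps_mulVx : {in fps_unit, left_inverse 1 fps_inv *%R}.
Proof.
move=> f uf; rewrite /fps_inv uf.
have ex_inv : exists g, g * f = 1 by apply/asboolP; exact: uf.
exact: (xgetPex 0 (P := [set g | g * f = 1]) ex_inv).
Qed.
Fact fps_unitPl f g : g * f = 1 -> fps_unit f.
Proof. by move=> gf; apply/asboolP; exists g. Qed.
Fact fps_inv_out : {in [predC fps_unit], fps_inv =1 id}.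
Proof. by move=> f; rewrite /fps_inv inE /= => /negbTE ->. Qed.
HB.instance Definition _ :=
  GRing.ComNzRing_hasMulInverse.Build (fps R) fps_mulVx fps_unitPl fps_inv_out.
End FpsComRing.

Section FpsModule.
Variables (R : comNzRingType) (A : algType R).

Definition fps_in_alg (c : fps R) : fps A := Fps (fun n => (fcoef c n)%:A).
Definition fps_scale (c : fps R) (f : fps A) : fps A := fps_in_alg c * f.

Fact fps_scaleA c d f : fps_scale c (fps_scale d f) = fps_scale (c * d) f.
Proof.
rewrite /fps_scale mulrA; congr (_ * _); apply: fpsP => n.
rewrite /= !fps_mulE scaler_suml; apply: eq_bigr => i _.
by rewrite mulr_algl scalerA.
Qed.
Fact fps_scale1 : left_id 1 fps_scale.
Proof.
move=> f; rewrite /fps_scale -[RHS]mul1r; congr (_ * _); apply: fpsP => n /=.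
by case: ifP; rewrite ?scale1r ?scale0r.
Qed.
Fact fps_scaleDr : right_distributive fps_scale +%R.
Proof. by move=> c f g; rewrite /fps_scale mulrDr. Qed.
Fact fps_scaleDl f : {morph fps_scale^~ f : c d / c + d}.
Proof.
move=> c d; rewrite /fps_scale -mulrDl; congr (_ * _); apply: fpsP => n /=.
by rewrite scalerDl.
Qed.
HB.instance Definition _ := GRing.Zmodule_isLmodule.Build (fps R) (fps A)
  fps_scaleA fps_scale1 fps_scaleDr fps_scaleDl.

Fact fps_scaleAl (c : fps R) (f g : fps A) : c *: (f * g) = (c *: f) * g.
Proof. exact: mulrA. Qed.
HB.instance Definition _ :=
  GRing.Lmodule_isLalgebra.Build (fps R) (fps A) fps_scaleAl.

Lemma fps_scaleAr (c : fps R) (f g : fps A) : c *: (f * g) = f * (c *: g).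
Proof.
suff comm (k : fps A) : fps_in_alg c * k = k * fps_in_alg c.
  by rewrite -[LHS]/(fps_in_alg c * (f * g)) mulrA comm -mulrA.
apply: fpsP => n; rewrite !fps_mulE (reindex_inj rev_ord_inj) /=.
apply: eq_bigr => i _; rewrite subSS subKn ?leq_ord //.
by rewrite mulr_algl mulr_algr.
Qed.
HB.instance Definition _ :=
  GRing.Lalgebra_isAlgebra.Build (fps R) (fps A) fps_scaleAr.
End FpsModule.

Notation Qh := (fps rat).  (* Q[[h]] *)

Definition h : Qh := Fps (fun n => (n == 1%N)%:R).

(** exact quotient in the integral domain Q[[h]]; needed since v - v^-1 is
    not invertible there *)
Definition exquo (a b : Qh) : Qh := xget 0 [set c | c * b = a].

Definition v : Qh := Fps (fun n => (2%:R ^- n) / n`!%:R).  (* exp(h/2) *)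
Definition q : Qh := v ^+ 2.

Definition qint (i : nat) : Qh := exquo (v ^+ i - v ^- i) (v - v^-1).
Definition qfact (n : nat) : Qh := \prod_(1 <= i < n.+1) qint i.
Definition qintq (i : nat) : Qh := exquo (q ^+ i - 1) (q - 1).
Definition qfactq (n : nat) : Qh := \prod_(1 <= i < n.+1) qintq i.

Section Span.
Variables (R : pzRingType) (M : lmodType R) (S : set M).

Inductive mspan : M -> Prop :=
| mspan0 : mspan 0
| mspan_in x : S x -> mspan x
| mspan_lin a x y : mspan x -> mspan y -> mspan (a *: x + y).

Lemma mspanD x y : mspan x -> mspan y -> mspan (x + y).
Proof. by move=> sx sy; rewrite -[x]scale1r; apply: mspan_lin. Qed.
Lemma mspanZ a x : mspan x -> mspan (a *: x).
Proof. by move=> sx; rewrite -[_ *: _]addr0; apply: mspan_lin => //; apply: mspan0. Qed.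
Lemma mspanN x : mspan x -> mspan (- x).
Proof. by rewrite -scaleN1r; apply: mspanZ. Qed.

Definition eqspan (x y : M) : bool := `[< mspan (x - y) >].
Fact eqspan_refl : reflexive eqspan.
Proof. by move=> x; apply/asboolP; rewrite subrr; apply: mspan0. Qed.
Fact eqspan_sym : symmetric eqspan.
Proof.
by move=> x y; apply/asboolP/asboolP => /mspanN; rewrite opprB.
Qed.
Fact eqspan_trans : transitive eqspan.
Proof.
move=> y x z /asboolP xy /asboolP yz; apply/asboolP.
by rewrite -(subrKA y); apply: mspanD.
Qed.
Canonical eqspan_equiv := EquivRel eqspan eqspan_refl eqspan_sym eqspan_trans.

Definition quot := {eq_quot eqspan_equiv}.
HB.instance Definition _ : EqQuotient M eqspan_equiv quot := EqQuotient.on quot.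
HB.instance Definition _ := Choice.on quot.

Definition proj (x : M) : quot := \pi_quot x.

Lemma projP x y : proj x = proj y <-> mspan (x - y).
Proof.
by split => [/eqP|] H; [move: H; rewrite piE => /asboolP|apply/eqP; rewrite piE; apply/asboolP].
Qed.
Lemma projK (u : quot) : proj (repr u) = u.
Proof. exact: reprK. Qed.
Lemma reprPspan x : mspan (repr (proj x) - x).
Proof. by apply/projP; rewrite projK. Qed.

Definition quot_add (u w : quot) : quot := proj (repr u + repr w).
Definition quot_opp (u : quot) : quot := proj (- repr u).
Definition quot_scale a (u : quot) : quot := proj (a *: repr u).

Lemma quot_addE x y : quot_add (proj x) (proj y) = proj (x + y).
Proof. by apply/projP; rewrite opprD addrACA; apply: mspanD; apply: reprPspan. Qed.
Lemma quot_oppE x : quot_opp (proj x) = proj (- x).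
Proof. by apply/projP; rewrite -opprD; apply/mspanN/reprPspan. Qed.
Lemma quot_scaleE a x : quot_scale a (proj x) = proj (a *: x).
Proof. by apply/projP; rewrite -scalerBr; apply/mspanZ/reprPspan. Qed.

Fact quot_addA : associative quot_add.
Proof.
by move=> u w t; rewrite -[u]projK -[w]projK -[t]projK !quot_addE addrA.
Qed.
Fact quot_addC : commutative quot_add.
Proof. by move=> u w; rewrite /quot_add addrC. Qed.
Fact quot_add0 : left_id (proj 0) quot_add.
Proof. by move=> u; rewrite -[u]projK quot_addE add0r. Qed.
Fact quot_addN : left_inverse (proj 0) quot_opp quot_add.
Proof. by move=> u; rewrite -[u]projK quot_oppE quot_addE addNr. Qed.
HB.instance Definition _ :=
  GRing.isZmodule.Build quot quot_addA quot_addC quot_add0 quot_addN.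

Fact quot_scaleA a b u : quot_scale a (quot_scale b u) = quot_scale (a * b) u.
Proof. by rewrite -[u]projK !quot_scaleE scalerA. Qed.
Fact quot_scale1 : left_id 1 quot_scale.
Proof. by move=> u; rewrite -[u]projK !quot_scaleE scale1r. Qed.
Fact quot_scaleDr : right_distributive quot_scale +%R.
Proof.
move=> a u w; rewrite -[u]projK -[w]projK.
by rewrite [_ + _]quot_addE !quot_scaleE [RHS]quot_addE scalerDr.
Qed.
Fact quot_scaleDl u : {morph quot_scale^~ u : a b / a + b}.
Proof.
by move=> a b; rewrite -[u]projK !quot_scaleE [RHS]quot_addE scalerDl.
Qed.
HB.instance Definition _ := GRing.Zmodule_isLmodule.Build R quot
  quot_scaleA quot_scale1 quot_scaleDr quot_scaleDl.

Fact proj_linear : linear proj.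
Proof. by move=> a x y; rewrite -quot_addE -quot_scaleE. Qed.
HB.instance Definition _ := GRing.isLinear.Build R M quot *:%R proj proj_linear.

Lemma proj0 : proj 0 = 0. Proof. exact: linear0. Qed.
Lemma projD x y : proj (x + y) = proj x + proj y. Proof. exact: linearD. Qed.
Lemma projN x : proj (- x) = - proj x. Proof. exact: linearN. Qed.
Lemma projZ a x : proj (a *: x) = a *: proj x. Proof. exact: linearZ. Qed.

End Span.

(** lim_p M / mspan (S p).  Compatibility of a family of classes is expressed by
  the existence of a common representative in degrees p and p + 1; when
  mspan (S p.+1) is included in mspan (S p), this says that the class in degree
  p + 1 is mapped to the class in degree p. *)

Section Completion.
Variables (R : pzRingType) (M : lmodType R) (S : nat -> set M).

Record compl := Compl {
  cproj : forall p, quot (S p);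
  cprojP : forall p, exists x : M, proj _ x = cproj p /\ proj _ x = cproj p.+1 }.

HB.instance Definition _ := gen_eqMixin compl.
HB.instance Definition _ := gen_choiceMixin compl.

Lemma complP (s t : compl) : (forall p, cproj s p = cproj t p) -> s = t.
Proof.
case: s t => [s sP] [t tP] /= st; have {}st := functional_extensionality_dep st.
by case: _ / st in tP *; congr Compl; apply: Prop_irrelevance.
Qed.

Fact compl_inP (x : M) p : exists y : M, proj (S p) y = proj _ x /\ proj (S p.+1) y = proj _ x.
Proof. by exists x. Qed.
Definition compl_in (x : M) : compl := Compl (compl_inP x).

Fact compl_addP (s t : compl) p : exists x : M,
  proj _ x = cproj s p + cproj t p /\ proj _ x = cproj s p.+1 + cproj t p.+1.
Proof.
have [x [x0 x1]] := cprojP s p; have [y [y0 y1]] := cprojP t p.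
by exists (x + y); rewrite !projD x0 x1 y0 y1.
Qed.
Definition compl_add s t := Compl (compl_addP s t).
Fact compl_oppP (s : compl) p : exists x : M,
  proj _ x = - cproj s p /\ proj _ x = - cproj s p.+1.
Proof.
by have [x [x0 x1]] := cprojP s p; exists (- x); rewrite !projN x0 x1.
Qed.
Definition compl_opp s := Compl (compl_oppP s).
Fact compl_scaleP a (s : compl) p : exists x : M,
  proj _ x = a *: cproj s p /\ proj _ x = a *: cproj s p.+1.
Proof.
by have [x [x0 x1]] := cprojP s p; exists (a *: x); rewrite !projZ x0 x1.
Qed.
Definition compl_scale a s := Compl (compl_scaleP a s).

Fact compl_addA : associative compl_add.
Proof. by move=> s t u; apply: complP => p /=; rewrite addrA. Qed.
Fact compl_addC : commutative compl_add.
Proof. by move=> s t; apply: complP => p /=; rewrite addrC. Qed.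
Fact compl_add0 : left_id (compl_in 0) compl_add.
Proof. by move=> s; apply: complP => p /=; rewrite proj0 add0r. Qed.
Fact compl_addN : left_inverse (compl_in 0) compl_opp compl_add.
Proof. by move=> s; apply: complP => p /=; rewrite proj0 addNr. Qed.
HB.instance Definition _ :=
  GRing.isZmodule.Build compl compl_addA compl_addC compl_add0 compl_addN.

Fact compl_scaleA a b s : compl_scale a (compl_scale b s) = compl_scale (a * b) s.
Proof. by apply: complP => p /=; rewrite scalerA. Qed.
Fact compl_scale1 : left_id 1 compl_scale.
Proof. by move=> s; apply: complP => p /=; rewrite scale1r. Qed.
Fact compl_scaleDr : right_distributive compl_scale +%R.
Proof. by move=> a s t; apply: complP => p /=; rewrite scalerDr. Qed.
Fact compl_scaleDl s : {morph compl_scale^~ s : a b / a + b}.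
Proof. by move=> a b; apply: complP => p /=; rewrite scalerDl. Qed.
HB.instance Definition _ := GRing.Zmodule_isLmodule.Build R compl
  compl_scaleA compl_scale1 compl_scaleDr compl_scaleDl.

End Completion.

(** The free module on n-tuples modulo the multilinearity relations. *)

Section TensorPower.
Variables (R : comNzRingType) (M : lmodType R) (n : nat).

Definition tsubst (x : n.-tuple M) (i : 'I_n) (u : M) : n.-tuple M :=
  [tuple if j == i then u else tnth x j | j < n].

Definition multilin_rel : set {malg R[n.-tuple M]} :=
  [set z | exists x i a u w,
    z = << tsubst x i (a *: u + w) >> - a *: << tsubst x i u >> - << tsubst x i w >>].

Definition tpow := quot multilin_rel.
HB.instance Definition _ := GRing.Lmodule.on tpow.

Definition tpure (x : n.-tuple M) : tpow := proj _ << x >>.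

End TensorPower.
Arguments tpow R M n : clear implicits.

Section Hadic.
Variable M : lmodType Qh.

Definition hpow (p : nat) : set M := [set h ^+ p *: x | x in setT].

Definition hcvg (u : nat -> M) (l : M) : Prop :=
  forall p, exists N, forall n, (N <= n)%N -> hpow p (u n - l).
Definition hlim (u : nat -> M) : M := xget 0 [set l | hcvg u l].
Definition hsum (u : nat -> M) : M := hlim (fun n => \sum_(i < n) u i).

Definition hexp (mul : M -> M -> M) (one x : M) : M :=
  hsum (fun n => (n`!%:R : Qh)^-1 *: iter n (mul x) one).

End Hadic.

Definition freeA := {malg rat[{fmonom 'I_3}]}.
HB.instance Definition _ := GRing.Lalgebra.on freeA.

Fact malg_scaleAr (K : monomType) (R : comNzRingType) (c : R) (f g : {malg R[K]}) :
  c *: (f * g) = f * (c *: g).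
Proof.
apply/malgP => k; rewrite mcoeffZ.
rewrite (mcoeffMlw k (finmap.fsubset_refl (msupp f)) (finmap.fsubset_refl (msupp g))).
rewrite (mcoeffMlw k (finmap.fsubset_refl (msupp f)) (msuppZ_le c g)).
rewrite mulr_sumr; apply: eq_bigr => i _; rewrite mulr_sumr.
by apply: eq_bigr => j _; rewrite mcoeffZ mulrnAr mulrCA.
Qed.
HB.instance Definition _ := GRing.Lalgebra_isAlgebra.Build rat freeA
  (@malg_scaleAr {fmonom 'I_3} rat).

Notation freeAh := (fps freeA).  (* Q<H,E,F>[[h]] *)

Definition gen (i : 'I_3) : freeAh := fpsC << fmu i >>.
Definition gH : freeAh := gen (inord 0%N).
Definition gE : freeAh := gen (inord 1%N).
Definition gF : freeAh := gen (inord 2%N).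
Definition gK : freeAh := hexp (M := freeAh) *%R 1 ((h / 2%:R) *: gH).
Definition gKinv : freeAh := hexp (M := freeAh) *%R 1 (- (h / 2%:R) *: gH).

(** In the last case y is (K - K^-1) / (v - v^-1), which exists and is unique
    since Q<H,E,F>[[h]] has no h-torsion. *)
Inductive Uh_rel : freeAh -> Prop :=
| rel_HE : Uh_rel (gH * gE - gE * gH - 2%:R * gE)
| rel_HF : Uh_rel (gH * gF - gF * gH + 2%:R * gF)
| rel_EF y : (v - v^-1) *: y = gK - gKinv -> Uh_rel (gE * gF - gF * gE - y).

Definition Uh_ideal : freeAh -> Prop :=
  @mspan Qh freeAh [set z | exists a r b, Uh_rel r /\ z = a * r * b].
Definition Uh_closed_ideal : set freeAh :=
  [set x | forall p, exists y, Uh_ideal y /\ hpow p (x - y)].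

Lemma Uh_ideal_mul a b x : Uh_ideal x -> Uh_ideal (a * x * b).
Proof.
elim=> [|z [c [r [d [rr ->]]]]|c y z _ IHy _ IHz].
- by rewrite mulr0 mul0r; apply: mspan0.
- by apply: mspan_in; exists (a * c), r, (d * b); rewrite !mulrA.
- by rewrite mulrDr mulrDl -scalerAr -scalerAl; apply: mspan_lin.
Qed.

Lemma Uh_closed_idealP x : mspan Uh_closed_ideal x -> Uh_closed_ideal x.
Proof.
elim=> [||c y z _ IHy _ IHz] //.
  by move=> p; exists 0; split; [exact: mspan0|exists 0; rewrite ?scaler0 ?subrr].
move=> p; have [y' [iy [ty _ ey]]] := IHy p; have [z' [iz [tz _ ez]]] := IHz p.
exists (c *: y' + z'); split; first exact: mspan_lin.
exists (c *: ty + tz) => //.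
by rewrite opprD addrACA -scalerBr -ey -ez scalerDr !scalerA [c * _]mulrC.
Qed.

Lemma Uh_closed_ideal_mul a b x :
  mspan Uh_closed_ideal x -> mspan Uh_closed_ideal (a * x * b).
Proof.
move=> /Uh_closed_idealP ix; apply: mspan_in => p.
have [y [iy [t _ et]]] := ix p; exists (a * y * b).
split; first exact: Uh_ideal_mul.
by exists (a * t * b) => //; rewrite scalerAl scalerAr et mulrBr mulrBl.
Qed.

(** the h-adically complete algebra topologically presented by [Uh_rel] *)
Definition Uh := quot Uh_closed_ideal.
HB.instance Definition _ := GRing.Lmodule.on Uh.

Definition toUh (a : freeAh) : Uh := proj _ a.
Definition Uh_mul (x y : Uh) : Uh := toUh (repr x * repr y).

Lemma Uh_mulE a b : Uh_mul (toUh a) (toUh b) = toUh (a * b).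
Proof.
apply/projP; set a' := repr _; set b' := repr _.
have -> : a' * b' - a * b = 1 * (a' - a) * b' + a * (b' - b) * 1.
  by rewrite mul1r mulr1 mulrBl mulrBr addrA subrK.
by apply: mspanD; apply: Uh_closed_ideal_mul; apply: reprPspan.
Qed.
Lemma toUhK (x : Uh) : toUh (repr x) = x. Proof. exact: projK. Qed.
Fact Uh_mulA : associative Uh_mul.
Proof.
by move=> x y z; rewrite -[x]toUhK -[y]toUhK -[z]toUhK !Uh_mulE mulrA.
Qed.
Fact Uh_mul1 : left_id (toUh 1) Uh_mul.
Proof. by move=> x; rewrite -[x]toUhK Uh_mulE mul1r. Qed.
Fact Uh_mulr1 : right_id (toUh 1) Uh_mul.
Proof. by move=> x; rewrite -[x]toUhK Uh_mulE mulr1. Qed.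
Fact Uh_mulDl : left_distributive Uh_mul +%R.
Proof.
move=> x y z; rewrite -[x]toUhK -[y]toUhK -[z]toUhK.
by rewrite -[_ + _]projD !Uh_mulE mulrDl [LHS]projD.
Qed.
Fact Uh_mulDr : right_distributive Uh_mul +%R.
Proof.
move=> x y z; rewrite -[x]toUhK -[y]toUhK -[z]toUhK.
by rewrite -[_ + _]projD !Uh_mulE mulrDr [LHS]projD.
Qed.
HB.instance Definition _ := GRing.Zmodule_isPzRing.Build Uh
  Uh_mulA Uh_mul1 Uh_mulr1 Uh_mulDl Uh_mulDr.

Definition uH : Uh := toUh gH.
Definition uE : Uh := toUh gE.
Definition uF : Uh := toUh gF.
Definition uK : Uh := hexp (M := Uh) *%R 1 ((h / 2%:R) *: uH).
Definition uKinv : Uh := hexp (M := Uh) *%R 1 (- (h / 2%:R) *: uH).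

(** the h-adically completed n-th tensor power of U_h over Q[[h]]; U_h itself is
    identified with T 1 by [pure1], and Q[[h]] with T 0 by the empty tensor *)
Definition T (n : nat) := compl (M := tpow Qh Uh n) (fun p => @hpow _ p).
HB.instance Definition _ n := GRing.Lmodule.on (T n).

Definition pure n (x : n.-tuple Uh) : T n := compl_in _ (tpure x).

(** The Q[[h]]-linear map T n -> N with prescribed values on pure tensors: it is
    unique when N is h-adically separated, and exists when N is h-adically
    complete and the values are multilinear. *)
Definition clift n (N : lmodType Qh) (f : n.-tuple Uh -> N) : T n -> N :=
  xget (fun=> 0) [set g : T n -> N | linear g /\ forall x, g (pure x) = f x].

(** [sweedler X f] is the sum of f x' x'' where X is the sum of x' (x) x''. *)
Definition sweedler (N : lmodType Qh) (X : T 2) (f : Uh -> Uh -> N) : N :=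
  clift (fun x : 2.-tuple Uh => f [tnth x 0] [tnth x 1]) X.

Definition pure1 (x : Uh) : T 1 := pure [tuple x].
Definition pure2 (x y : Uh) : T 2 := pure [tuple x; y].

Definition tmul n (X Y : T n) : T n :=
  clift (fun x : n.-tuple Uh =>
    clift (fun y : n.-tuple Uh => pure [tuple tnth x i * tnth y i | i < n]) Y) X.

Definition tone n : T n := pure [tuple of nseq n 1].

(** The Hopf structure of U_h: linearity over Q[[h]] entails h-adic continuity, so
    these (anti)homomorphisms are determined by their values on H, E, F. *)
Record Uh_Hopf := {
  cop : Uh -> T 2;
  cop_linear : linear cop;
  cop_1 : cop 1 = tone 2;
  cop_mul : forall x y, cop (x * y) = tmul (cop x) (cop y);
  cop_H : cop uH = pure2 uH 1 + pure2 1 uH;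
  cop_E : cop uE = pure2 uE 1 + pure2 uK uE;
  cop_F : cop uF = pure2 uF uKinv + pure2 1 uF;

  eps : Uh -> Qh;
  eps_linear : forall a x y, eps (a *: x + y) = a * eps x + eps y;
  eps_1 : eps 1 = 1;
  eps_mul : forall x y, eps (x * y) = eps x * eps y;
  eps_H : eps uH = 0;
  eps_E : eps uE = 0;
  eps_F : eps uF = 0;

  apd : Uh -> Uh;
  apd_linear : linear apd;
  apd_1 : apd 1 = 1;
  apd_mul : forall x y, apd (x * y) = apd y * apd x;
  apd_H : apd uH = - uH;
  apd_E : apd uE = - (uKinv * uE);
  apd_F : apd uF = - (uF * uK)
}.

Definition Rmx : T 2 :=
  tmul (hexp (@tmul 2) (tone 2) ((h / 4%:R) *: pure2 uH uH))
       (hsum (fun n => (v ^+ (n * n.-1)./2%N * ((v - v^-1) ^+ n / qfact n))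
                         *: pure2 (uF ^+ n) (uE ^+ n))).

Section BraidedMaps.
Variable D : Uh_Hopf.

(* the inverse of the bijection [apd D] *)
Definition apd_inv (x : Uh) : Uh := xget 0 [set y | apd D y = x].

Definition ad (x y : Uh) : Uh := sweedler (cop D x) (fun x1 x2 => x1 * y * apd D x2).

Definition psi : T 2 -> T 2 :=
  clift (fun t : 2.-tuple Uh => let x := [tnth t 0] in let y := [tnth t 1] in
    sweedler Rmx (fun a b => pure2 (ad b y) (ad a x))).
Definition psi_inv : T 2 -> T 2 :=
  clift (fun t : 2.-tuple Uh => let x := [tnth t 0] in let y := [tnth t 1] in
    sweedler Rmx (fun a b => pure2 (ad (apd D a) y) (ad b x))).
Definition bmul : T 2 -> T 1 := clift (fun t : 2.-tuple Uh => pure1 ([tnth t 0] * [tnth t 1])).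
Definition bunit : T 0 -> T 1 := clift (fun=> pure1 1).
Definition bcounit : T 1 -> T 0 := clift (fun t : 1.-tuple Uh => eps D [tnth t 0] *: pure [tuple]).
Definition bcop : T 1 -> T 2 :=
  clift (fun t : 1.-tuple Uh => let x := [tnth t 0] in
    sweedler (cop D x) (fun x1 x2 =>
      sweedler Rmx (fun a b => pure2 (x1 * apd D b) (ad a x2)))).
Definition bapd : T 1 -> T 1 :=
  clift (fun t : 1.-tuple Uh => let x := [tnth t 0] in
    pure1 (sweedler Rmx (fun a b => b * apd D (ad a x)))).
Definition bapd_inv : T 1 -> T 1 :=
  clift (fun t : 1.-tuple Uh => let x := [tnth t 0] in
    pure1 (sweedler Rmx (fun a b => apd_inv (ad a x) * b))).

End BraidedMaps.

Inductive is_Zq : Qh -> Prop :=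
| Zq_1 : is_Zq 1
| Zq_q : is_Zq q
| Zq_qinv : is_Zq q^-1
| Zq_sub x y : is_Zq x -> is_Zq y -> is_Zq (x - y)
| Zq_mul x y : is_Zq x -> is_Zq y -> is_Zq (x * y).

Definition Zq_pred : {pred Qh} := fun x => `[< is_Zq x >].
Fact Zq_subring : subring_closed Zq_pred.
Proof.
split=> [|x y /asboolP xz /asboolP yz|x y /asboolP xz /asboolP yz]; apply/asboolP.
- exact: Zq_1.
- exact: Zq_sub.
- exact: Zq_mul.
Qed.
HB.instance Definition _ := GRing.isSubringClosed.Build Qh Zq_pred Zq_subring.

Record Zq := MkZq { Zq_val :> Qh; _ : Zq_val \in Zq_pred }.
HB.instance Definition _ := [isSub for Zq_val].
HB.instance Definition _ := [Choice of Zq by <:].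
HB.instance Definition _ := [SubChoice_isSubComNzRing of Zq by <:].

Definition ue : Uh := (v - v^-1) *: uE.
Definition Fdiv (n : nat) : Uh := (qfactq n)^-1 *: (uF ^+ n * uK ^+ n).

Inductive is_Uev : Uh -> Prop :=
| Uev_K2 : is_Uev (uK ^+ 2)
| Uev_K2inv : is_Uev (uKinv ^+ 2)
| Uev_e : is_Uev ue
| Uev_F n : (0 < n)%N -> is_Uev (Fdiv n)
| Uev_1 : is_Uev 1
| Uev_add x y : is_Uev x -> is_Uev y -> is_Uev (x + y)
| Uev_scale a x : is_Zq a -> is_Uev x -> is_Uev (a *: x)
| Uev_mul x y : is_Uev x -> is_Uev y -> is_Uev (x * y).

Definition Uev_pred : {pred Uh} := fun x => `[< is_Uev x >].
Fact Uev_zmod : zmod_closed Uev_pred.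
Proof.
have Zq0 : is_Zq 0 by rewrite -(subrr 1); apply: Zq_sub; apply: Zq_1.
split=> [|x y /asboolP ux /asboolP uy]; apply/asboolP.
  have u0 : is_Uev ((0 : Qh) *: (1 : Uh)) by apply: Uev_scale => //; apply: Uev_1.
  by rewrite scale0r in u0.
apply: Uev_add => //; rewrite -scaleN1r; apply: Uev_scale => //.
by rewrite -sub0r; apply: Zq_sub => //; apply: Zq_1.
Qed.
HB.instance Definition _ := GRing.isZmodClosed.Build Uh Uev_pred Uev_zmod.

Record Uev := MkUev { Uev_val :> Uh; _ : Uev_val \in Uev_pred }.
HB.instance Definition _ := [isSub for Uev_val].
HB.instance Definition _ := [Choice of Uev by <:].
HB.instance Definition _ := [SubChoice_isSubZmodule of Uev by <:].

Fact Uev_scaleP (a : Zq) (x : Uev) : Zq_val a *: Uev_val x \in Uev_pred.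
Proof.
apply/asboolP; apply: Uev_scale; apply/asboolP.
  exact: (valP a).
exact: (valP x).
Qed.
Definition Uev_scale_op (a : Zq) (x : Uev) : Uev := MkUev (Uev_scaleP a x).
Fact Uev_scaleA a b x : Uev_scale_op a (Uev_scale_op b x) = Uev_scale_op (a * b) x.
Proof. by apply: val_inj; rewrite /= scalerA. Qed.
Fact Uev_scale1 : left_id 1 Uev_scale_op.
Proof. by move=> x; apply: val_inj; rewrite /= scale1r. Qed.
Fact Uev_scaleDr : right_distributive Uev_scale_op +%R.
Proof. by move=> a x y; apply: val_inj; rewrite /= scalerDr. Qed.
Fact Uev_scaleDl x : {morph Uev_scale_op^~ x : a b / a + b}.
Proof. by move=> a b; apply: val_inj; rewrite /= scalerDl. Qed.
HB.instance Definition _ := GRing.Zmodule_isLmodule.Build Zq Uev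
  Uev_scaleA Uev_scale1 Uev_scaleDr Uev_scaleDl.

Definition Uev_fil (p : nat) : set Uev :=
  @mspan Zq Uev
    [set z | exists a b : Uev, Uev_val z = Uev_val a * ue ^+ p * Uev_val b].

Definition Uevn (n : nat) := tpow Zq Uev n.

(** generators of F_p of the n-th tensor power; in degree 0 the filtration is
    F_0 = everything and F_p = 0 for p > 0 *)
Definition Uevn_fil (n p : nat) : set (Uevn n) :=
  if n is 0 then [set x | p = 0%N]
  else [set tpure x | x in [set x : n.-tuple Uev | exists i, Uev_fil p (tnth x i)]].

Definition Uevn_compl n := compl (@Uevn_fil n).

(** the map induced on tensor powers by the inclusion of U^ev into U_h *)
Definition Uevn_incl n : Uevn n -> T n :=
  xget (fun=> 0) [set g : Uevn n -> T n |
    (forall (a : Zq) x y, g (a *: x + y) = Zq_val a *: g x + g y) /\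
    (forall x, g (tpure x) = pure (map_tuple Uev_val x))].

(** The natural map from the inverse limit to T n: F_p is mapped into h^p T n,
    so the images of representatives of the successive classes converge. *)
Definition natmap n (s : Uevn_compl n) : T n :=
  hlim (fun p => Uevn_incl (repr (cproj s p))).

(** the n-th completed tensor power of U^ev, as a subset of T n, and its basis
    of neighborhoods of 0 *)
Definition Ut n : set (T n) := range (@natmap n).
Definition Ut_nbhs n p : set (T n) := @natmap n @` [set s | cproj s p = 0].

Arguments Ut n : clear implicits.
Arguments Ut_nbhs n p : clear implicits.

(** Continuity is spelled out at every point x; the sets x + Ut_nbhs i p form a
    basis of neighborhoods of x. *)
Definition induces_continuous i j (f : T i -> T j) : Prop :=
  f @` Ut i `<=` Ut j /\
  forall x, Ut i x -> forall p, exists p', forall y, Ut i y ->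
    Ut_nbhs i p' (y - x) -> Ut_nbhs j p (f y - f x).

(* Main.v *)
From HB Require Import structures.
From mathcomp Require Import all_boot all_order all_algebra.
From mathcomp Require Import boolp classical_sets.
From mathcomp Require finmap.
From mathcomp Require Import monalg zify ring lra.
Require Import Defs.

(**
  The R-matrix is exp(h/4 H (x) H) sum_n q^(n(n-1)/2) F^n/[n]_q! (x) e^n. On elements that
  are homogeneous for the weight, its Cartan factor only contributes powers of q and of K.
  Each structure map thus sends a tensor of monomials in K^(+-2), e and F~(n) to a series
  over n whose terms are q-powers times tensors built from e^n |> y, (F^n/[n]_q!) |> x, the
  coproduct and the antipode. There:
  - e^n |> y is a combination of the e^i y e^j with i + j = n, so that it lies in the ideal
    generated by e^(n/2): the series converges for the filtration;
  - (F^n/[n]_q!) |> x is a combination of the F~(i) x F~(j) with i + j = n, by the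
    q-binomial theorem;
  - the coproduct of x is a combination of the x' K^|x''| (x) x'' and K^|x| S(x) is, up to a
    unit, a monomial; the powers of K in these formulas are exactly cancelled by those
    coming from the Cartan factor.
  All these combinations have coefficients in Z[q,q^-1] and respect the filtration.
*)
Set Implicit Arguments.
Unset Strict Implicit.
Unset Printing Implicit Defensive.

(** The obstacle is that the Cartan factor is a series in H, and that the coproduct and the antipode
    of e and F~(n) involve odd powers of K, whereas the integral form is generated by K^(+-2), e and
    F~(n). Hence all computations take place in U_h, on monomials whose degree is recorded: summing
    over the powers of H gives a scalar q^(ab) when both legs of R act by the adjoint action, and a
    power K^a when only one does. Two topologies have to be reconciled: the structure maps are
    defined h-adically, the claim concerns powers of e. Since e = (v - v^-1) E is divisible by h,
    F_p is sent into h^p. A point of the completed power is therefore the h-adic limit of partial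
    sums whose increments lie in images of the F_p, and a Q[[h]]-linear map passes to such limits;
    single monomials remain to be estimated. Continuity only asks for some p' for each p. The choice
    p' = 2p suits every map: among 2p letters e, the coproduct sends at least p to one of its two
    factors. *)

Import Order.TTheory GRing.Theory Num.Theory.
Local Open Scope ring_scope.
Local Open Scope classical_set_scope.

(** * The h-adic topology *)

Section HadicTheory.
Variable M : lmodType Qh.
Implicit Types (x y z : M) (u w : nat -> M).

Lemma hpowI p x : hpow p (h ^+ p *: x).
Proof. by exists x. Qed.

Lemma hpow_0 p : hpow p (0 : M).
Proof. by exists 0 => //; rewrite scaler0. Qed.

Lemma hpowT x : hpow 0 x.
Proof. by exists x => //; rewrite scale1r. Qed.

Lemma hpowD p x y : hpow p x -> hpow p y -> hpow p (x + y).
Proof. by move=> [x' _ <-] [y' _ <-]; rewrite -scalerDr; apply: hpowI. Qed.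

Lemma hpowZ p c x : hpow p x -> hpow p (c *: x).
Proof. by move=> [x' _ <-]; rewrite scalerA mulrC -scalerA; apply: hpowI. Qed.

Lemma hpowN p x : hpow p x -> hpow p (- x).
Proof. by rewrite -scaleN1r; apply: hpowZ. Qed.

Lemma hpowB p x y : hpow p x -> hpow p y -> hpow p (x - y).
Proof. by move=> hx /hpowN; apply: hpowD. Qed.

Lemma hpowDn p n x : hpow p x -> hpow (n + p) (h ^+ n *: x).
Proof. by move=> [x' _ <-]; rewrite scalerA -exprD; apply: hpowI. Qed.

Lemma hpow_le p n x : (p <= n)%N -> hpow n x -> hpow p x.
Proof.
by move=> /subnKC <- [x' _ <-]; rewrite exprD -scalerA; apply: hpowI.
Qed.

Lemma hpow_sum p (I : Type) (r : seq I) (P : pred I) (F : I -> M) :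
  (forall i, P i -> hpow p (F i)) -> hpow p (\sum_(i <- r | P i) F i).
Proof.
move=> hF; elim/big_rec: _ => [|i x Pi hx]; first exact: hpow_0.
by apply: hpowD => //; apply: hF.
Qed.

Lemma hpow_trans p x y z : hpow p (x - y) -> hpow p (y - z) -> hpow p (x - z).
Proof. by move=> hx hy; rewrite -(subrKA y); apply: hpowD. Qed.

Lemma hpow_sym p x y : hpow p (x - y) -> hpow p (y - x).
Proof. by move=> /hpowN; rewrite opprB. Qed.

Lemma mspan_hpow p x : mspan (@hpow M p) x -> hpow p x.
Proof. by elim=> [||a y z _ hy _ hz] //; [apply: hpow_0 | apply/hpowD/hz/hpowZ]. Qed.

Definition hseparated := forall x, (forall p, hpow p x) -> x = 0.
Definition hcomplete := hseparated /\
  forall u, (forall n, hpow n (u n.+1 - u n)) -> exists l, hcvg u l.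

(** A module in which [sum_i h^i y_i] always exists: [L n] plays the role of
  [sum_i h^i y_(n+i)]. *)
Lemma hcompleteP : hseparated ->
  (forall y : nat -> M, exists L : nat -> M, forall n, L n = y n + h *: L n.+1) ->
  hcomplete.
Proof.
move=> sepM exL; split=> // u uP.
have /choice [y yE] n : exists y, h ^+ n *: y = u n.+1 - u n.
  by have [y _ yE] := uP n; exists y.
have [L LE] := exL y; exists (u 0%N + L 0%N) => p; exists p => n le_pn.
suff -> : u n - (u 0%N + L 0%N) = h ^+ n *: (- L n).
  exact: hpow_le le_pn (hpowI _ _).
elim: n {le_pn} => [|n IHn]; first by rewrite scale1r opprD addNKr.
rewrite -[u n.+1](subrK (u n)) -yE -addrA IHn -scalerDr LE opprD addNKr.
by rewrite scalerN scalerA -exprSr scalerN.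
Qed.

Section Separated.
Hypothesis sepM : hseparated.

Lemma hseparated_eq x y : (forall p, hpow p (x - y)) -> x = y.
Proof. by move=> /sepM /eqP; rewrite subr_eq0 => /eqP. Qed.

Lemma hcvg_uniq u x y : hcvg u x -> hcvg u y -> x = y.
Proof.
move=> ux uy; apply: hseparated_eq => p.
have [n nP] := ux p; have [m mP] := uy p.
apply: hpow_trans (u (n + m)%N) _ _ _; first by apply/hpow_sym/nP/leq_addr.
exact/mP/leq_addl.
Qed.

Lemma hlimE u x : hcvg u x -> hlim u = x.
Proof.
move=> ux; apply: (hcvg_uniq _ ux); rewrite /hlim.
exact: (xgetPex 0 (P := [set l | hcvg u l]) (ex_intro _ x ux)).
Qed.

End Separated.

Lemma hcvg_cst x : hcvg (fun=> x) x.
Proof. by move=> p; exists 0%N => n _; rewrite subrr; apply: hpow_0. Qed.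

Lemma hcvgD u w x y : hcvg u x -> hcvg w y -> hcvg (fun n => u n + w n) (x + y).
Proof.
move=> ux wy p; have [n nP] := ux p; have [m mP] := wy p.
exists (n + m)%N => k le_k; rewrite opprD addrACA.
by apply: hpowD; [apply: nP | apply: mP]; lia.
Qed.

Lemma hcvg_near u w x : hcvg u x -> (forall n, hpow n (w n - u n)) -> hcvg w x.
Proof.
move=> ux wu p; have [n nP] := ux p; exists (n + p)%N => m le_m.
apply: (hpow_trans (y := u m)); last by apply: nP; lia.
by apply: hpow_le (wu m); lia.
Qed.

Lemma hcvg_sub u x (f : nat -> nat) :
  hcvg u x -> (forall n, n <= f n)%N -> hcvg (u \o f) x.
Proof.
move=> ux fP p; have [n nP] := ux p; exists n => m le_m.
by apply: nP; apply: leq_trans le_m _.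
Qed.

(** Ultrametric estimate: all increments from index n on lie in h^(p+n), hence so does the whole
    tail. *)
Lemma hcvg_tail u x p : hcvg u x ->
  (forall n, hpow (p + n) (u n.+1 - u n)) -> forall n, hpow (p + n) (x - u n).
Proof.
move=> ux uP n; have [m mP] := ux (p + n)%N.
apply: (hpow_trans (y := u (n + m)%N)).
  by apply/hpow_sym/mP/leq_addl.
elim: m {mP} => [|m IHm]; first by rewrite addn0 subrr; apply: hpow_0.
apply: hpow_trans IHm; rewrite addnS; apply: hpow_le (uP _).
by rewrite leq_add2l leq_addr.
Qed.

Lemma hsum_cvg u : hcomplete -> (forall n, hpow n (u n)) ->
  hcvg (fun n => \sum_(i < n) u i) (hsum u).
Proof.
move=> [sepM cM] uP; have [n|l lP] := cM (fun n => \sum_(i < n) u i).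
  by rewrite big_ord_recr /= addrAC subrr add0r.
by rewrite /hsum (hlimE sepM lP).
Qed.

Lemma hsum_eq u x : hseparated -> hcvg (fun n => \sum_(i < n) u i) x -> hsum u = x.
Proof. by move=> sM ux; apply: hlimE. Qed.

Lemma hsum_tail u : hcomplete -> (forall n, hpow n (u n)) ->
  forall n, hpow n (hsum u - \sum_(i < n) u i).
Proof.
move=> cM uP n; apply: (hcvg_tail (p := 0) (hsum_cvg cM uP)) => m.
by rewrite big_ord_recr /= addrAC subrr add0r.
Qed.

Lemma eq_hsum u w : u =1 w -> hsum u = hsum w.
Proof. by move=> /funext ->. Qed.

End HadicTheory.

Section HadicLinear.
Variables (M N : lmodType Qh) (f : M -> N).
Hypothesis linf : linear f.

Let flin : {linear M -> N} := HB.pack f (GRing.isLinear.Build _ _ _ _ f linf).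

Lemma lin0 : f 0 = 0. Proof. exact: (linear0 flin). Qed.
Lemma linD x y : f (x + y) = f x + f y. Proof. exact: (linearD flin). Qed.
Lemma linN x : f (- x) = - f x. Proof. exact: (linearN flin). Qed.
Lemma linB x y : f (x - y) = f x - f y. Proof. exact: (linearB flin). Qed.
Lemma linZ c x : f (c *: x) = c *: f x. Proof. exact: (linearZZ flin). Qed.
Lemma lin_sum (I : Type) (r : seq I) (P : pred I) (F : I -> M) :
  f (\sum_(i <- r | P i) F i) = \sum_(i <- r | P i) f (F i).
Proof. exact: (linear_sum flin). Qed.

(** A Q[[h]]-linear map commutes with h^p, so it is h-adically continuous; this is why linearity
    alone lets the maps below pass through series. *)
Lemma hpow_lin p x : hpow p x -> hpow p (f x).
Proof. by move=> [y _ <-]; rewrite linZ; apply: hpowI. Qed.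

Lemma hcvg_lin u x : hcvg u x -> hcvg (f \o u) (f x).
Proof.
move=> ux p; have [n nP] := ux p; exists n => m /nP /= hm.
by rewrite -linB; apply: hpow_lin.
Qed.

Lemma hsum_lin u : hcomplete M -> hseparated N -> (forall n, hpow n (u n)) ->
  f (hsum u) = hsum (f \o u).
Proof.
move=> cM sN uP; symmetry; apply: hsum_eq => //.
have := hcvg_lin (hsum_cvg cM uP); congr hcvg.
by apply/funext => n /=; rewrite lin_sum.
Qed.

End HadicLinear.

Definition bilinear_for (M M' N : lmodType Qh) (B : M -> M' -> N) :=
  (forall y, linear (B^~ y)) /\ (forall x, linear (B x)).

Section Cauchy.
Variables (M M' N : lmodType Qh) (B : M -> M' -> N).
Hypothesis bilB : bilinear_for B.
Hypotheses (cM : hcomplete M) (cM' : hcomplete M') (cN : hcomplete N).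

Let linl y := bilB.1 y.
Let linr x := bilB.2 x.

Lemma hpow_bil p p' x y : hpow p x -> hpow p' y -> hpow (p + p') (B x y).
Proof.
move=> [x' _ <-] [y' _ <-]; rewrite (linZ (linl _)) (linZ (linr _)) scalerA.
by rewrite -exprD; apply: hpowI.
Qed.

(** The product of the n-th partial sums tends to the left-hand side; it differs from the n-th
    partial sum on the right by terms with i + j >= n, which are divisible by h^n. *)
Lemma hsum_Cauchy a b : (forall n, hpow n (a n)) -> (forall n, hpow n (b n)) ->
  B (hsum a) (hsum b) = hsum (fun n => \sum_(i < n.+1) B (a i) (b (n - i)%N)).
Proof.
move=> aP bP; symmetry; apply: (hsum_eq cN.1).
have near n : hpow n (B (\sum_(i < n) a i) (\sum_(j < n) b j) - B (hsum a) (hsum b)).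
  apply: (hpow_trans (y := B (hsum a) (\sum_(j < n) b j))).
    rewrite -(linB (linl _)) -[n]addn0; apply: hpow_bil (hpowT _).
    by rewrite addn0; apply/hpow_sym/hsum_tail.
  rewrite -(linB (linr _)) -[n]add0n; apply: hpow_bil (hpowT _) _.
  by rewrite add0n; apply/hpow_sym/hsum_tail.
apply: (@hcvg_near _ (fun n => B (\sum_(i < n) a i) (\sum_(j < n) b j))).
  by move=> p; exists p => n le_pn; apply: hpow_le le_pn (near n).
(* The square of indices is cut at j = n - i; its lower triangle, summed along the diagonals, is the
   Cauchy partial sum. *)
move=> n; rewrite (lin_sum (linl _)).
under [X in _ - X]eq_bigr => i _.
  rewrite (lin_sum (linr _)).
  rewrite -(big_mkord xpredT (fun j => B (a i) (b j))).
  rewrite (big_cat_nat (n := (n - i)%N)) ?leq_subr //=.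
  over.
rewrite big_split /= opprD addrA.
have -> : \sum_(i < n) \sum_(j < i.+1) B (a j) (b (i - j)%N) =
          \sum_(i < n) \sum_(0 <= j < n - i) B (a i) (b j).
  elim: n {near} => [|n IHn]; first by rewrite !big_ord0.
  rewrite big_ord_recr /= IHn [RHS]big_ord_recr /= subSnn big_nat1.
  under [in RHS]eq_bigr => i _ do
    rewrite subSn ?(ltnW (ltn_ord i)) // big_nat_recr //=.
  by rewrite big_split /= -addrA; congr (_ + _); rewrite big_ord_recr /= subnn.
rewrite subrr sub0r; apply/hpowN/hpow_sum => i _.
rewrite big_nat_cond; apply: hpow_sum => j /andP[/andP[lej _] _].
apply: (hpow_le (n := (i + j)%N)); first by rewrite -leq_subLR.
exact: hpow_bil.
Qed.

End Cauchy.

(** * Power series in h *)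

Section FpsCoef.
Variable A : nzRingType.
Implicit Types f g : fps A.

Lemma fcoefM f g n : fcoef (f * g) n = \sum_(i < n.+1) fcoef f i * fcoef g (n - i).
Proof. exact: fps_mulE. Qed.

Lemma fpsC0 : fpsC 0 = 0 :> fps A. Proof. by []. Qed.
Lemma fpsC1 : fpsC 1 = 1 :> fps A. Proof. by []. Qed.
Lemma fcoef_sum (I : Type) (r : seq I) (P : pred I) (F : I -> fps A) n :
  fcoef (\sum_(i <- r | P i) F i) n = \sum_(i <- r | P i) fcoef (F i) n.
Proof. by elim/big_rec2: _ => [|i y x _ <-] //=; rewrite if_same. Qed.

Lemma fcoefCM a f n : fcoef (fpsC a * f) n = a * fcoef f n.
Proof.
rewrite fcoefM big_ord_recl /= subn0 big1 ?addr0 // => i _.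
by rewrite mul0r.
Qed.

Lemma fpsCM a b : fpsC (a * b) = fpsC a * fpsC b :> fps A.
Proof. by apply: fpsP => -[|n] /=; rewrite fcoefCM //= mulr0. Qed.
Lemma fpsCD a b : fpsC (a + b) = fpsC a + fpsC b :> fps A.
Proof. by apply: fpsP => -[|n] //=; rewrite addr0. Qed.
Lemma fpsCN a : fpsC (- a) = - fpsC a :> fps A.
Proof. by apply: fpsP => -[|n] //=; rewrite oppr0. Qed.
Lemma fpsCX a n : fpsC (a ^+ n) = fpsC a ^+ n :> fps A.
Proof. by elim: n => [|n IHn] //; rewrite !exprS fpsCM IHn. Qed.
Lemma fpsC_nat n : fpsC n%:R = n%:R :> fps A.
Proof. by elim: n => [|n IHn] //; rewrite !mulrS fpsCD IHn. Qed.

End FpsCoef.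

Section QhCoef.
Implicit Types (f g : Qh) (r s : rat).

Lemma fcoef_scale (A : algType rat) f (x : fps A) n :
  fcoef (f *: x) n = \sum_(i < n.+1) fcoef f i *: fcoef x (n - i).
Proof.
by rewrite [LHS]fcoefM; apply: eq_bigr => i _; rewrite mulr_algl.
Qed.

Lemma fcoef_scaleh (A : algType rat) (x : fps A) n :
  fcoef (h *: x) n = if n is m.+1 then fcoef x m else 0.
Proof.
rewrite fcoef_scale; case: n => [|n]; first by rewrite big_ord1 scale0r.
rewrite 2!big_ord_recl /= scale0r add0r scale1r subSS subn0 big1 ?addr0 // => i _.
by rewrite scale0r.
Qed.

Lemma fcoefhM f n : fcoef (h * f) n = if n is m.+1 then fcoef f m else 0.
Proof.
rewrite fcoefM; case: n => [|n]; first by rewrite big_ord1 mul0r.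
rewrite 2!big_ord_recl /= mul0r add0r mul1r subSS subn0 big1 ?addr0 // => i _.
by rewrite mul0r.
Qed.

Lemma fcoefhXM p f n : fcoef (h ^+ p * f) n = if (n < p)%N then 0 else fcoef f (n - p).
Proof.
elim: p n => [|p IHp] n; first by rewrite mul1r subn0.
by rewrite exprS -mulrA fcoefhM; case: n => [|n] //; rewrite IHp ltnS subSS.
Qed.

Lemma hX_dvd p f : (forall n, (n < p)%N -> fcoef f n = 0) -> exists g, f = h ^+ p * g.
Proof.
move=> f0; exists (Fps (fun n => fcoef f (n + p))); apply: fpsP => n.
by rewrite fcoefhXM; case: ltnP => [/f0|/subnK /= ->].
Qed.

Lemma fcoef_hX p n : fcoef (h ^+ p) n = (n == p)%:R.
Proof.
rewrite -[h ^+ p]mulr1 fcoefhXM /=; case: ltngtP => // [lt_pn|->].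
  by rewrite subn_eq0 leqNgt lt_pn.
by rewrite subnn.
Qed.

Lemma hseparated_Qh f : (forall p, exists g, f = h ^+ p * g) -> f = 0.
Proof.
move=> fP; apply: fpsP => n; have [g ->] := fP n.+1.
by rewrite fcoefhXM ltnSn /= if_same.
Qed.

Lemma fpsC_unit r : r != 0 -> fpsC r \is a @GRing.unit Qh.
Proof.
move=> r0; apply/asboolP; exists (fpsC r^-1).
by rewrite -fpsCM mulVf.
Qed.

Lemma fpsCV r : fpsC r^-1 = (fpsC r : Qh)^-1.
Proof.
have [->|r0] := eqVneq r 0; first by rewrite invr0 invr0.
by apply: (mulrI (fpsC_unit r0)); rewrite divrr ?fpsC_unit // -fpsCM divff.
Qed.

(** The series exp(r h). *)
Definition expq r : Qh := Fps (fun n => r ^+ n / n`!%:R).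

Lemma factr_neq0 n : n`!%:R != 0 :> rat.
Proof. by rewrite pnatr_eq0 -lt0n fact_gt0. Qed.

Lemma expqD r s : expq (r + s) = expq r * expq s.
Proof.
apply: fpsP => n; rewrite fcoefM /= addrC exprDn mulr_suml.
apply: eq_bigr => i _; have le_in : (i <= n)%N by rewrite -ltnS.
rewrite -(bin_fact le_in) !natrM -mulr_natl.
have := factr_neq0 i; have := factr_neq0 (n - i).
have : 'C(n, i)%:R != 0 :> rat by rewrite pnatr_eq0 -lt0n bin_gt0.
by move=> *; field; apply/and3P.
Qed.

Lemma expq0 : expq 0 = 1.
Proof. by apply: fpsP => -[|n] /=; rewrite ?divr1 // expr0n mul0r. Qed.

Lemma expqN r : expq r * expq (- r) = 1.
Proof. by rewrite -expqD subrr expq0. Qed.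

Lemma expq_unit r : expq r \is a @GRing.unit Qh.
Proof. by apply/asboolP; exists (expq (- r)); rewrite mulrC expqN. Qed.

Lemma expqV r : (expq r)^-1 = expq (- r).
Proof. by apply: (mulrI (expq_unit r)); rewrite divrr ?expq_unit ?expqN. Qed.

Lemma expqX r n : expq r ^+ n = expq (r *+ n).
Proof. by elim: n => [|n IHn]; rewrite ?expq0 // exprS IHn -expqD mulrS. Qed.

Lemma vE : v = expq 2%:R^-1.
Proof. by apply: fpsP => n /=; rewrite exprVn. Qed.

Lemma vXE n : v ^+ n = expq (n%:R / 2%:R).
Proof. by rewrite vE expqX mulr_natl. Qed.

Lemma vVE : v^-1 = expq (- 2%:R^-1).
Proof. by rewrite vE expqV. Qed.

(** The power q^k for integral k, written as exp(k h) so that exponents add without any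
    invertibility side condition. *)
Definition qz (k : int) : Qh := expq k%:~R.

Lemma qE : q = qz 1.
Proof. by rewrite /q vXE divff. Qed.
Lemma qzD k l : qz (k + l) = qz k * qz l.
Proof. by rewrite /qz rmorphD expqD. Qed.
Lemma qz0 : qz 0 = 1. Proof. exact: expq0. Qed.
Lemma qX_qz n : q ^+ n = qz n.
Proof. by rewrite qE /qz expqX. Qed.
Lemma qzN k : qz (- k) = (qz k)^-1.
Proof. by rewrite /qz rmorphN expqV. Qed.
Lemma qzK k : qz k * qz (- k) = 1.
Proof. by rewrite -qzD subrr qz0. Qed.

Lemma qz_Zq k : is_Zq (qz k).
Proof.
have qX n : is_Zq (q ^+ n).
  by elim: n => [|n IHn]; rewrite ?exprS; [apply: Zq_1 | apply/Zq_mul/IHn/Zq_q].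
have qV n : is_Zq (q^-1 ^+ n).
  by elim: n => [|n IHn]; rewrite ?exprS; [apply: Zq_1 | apply/Zq_mul/IHn/Zq_qinv].
case: k => n; first by rewrite -qX_qz.
by rewrite NegzE qzN -qX_qz -exprVn.
Qed.

Lemma Zq0 : is_Zq 0.
Proof. by rewrite -(subrr 1); apply: Zq_sub Zq_1 Zq_1. Qed.
Lemma ZqN x : is_Zq x -> is_Zq (- x).
Proof. by rewrite -sub0r; apply: Zq_sub Zq0. Qed.
Lemma Zq_sign n : is_Zq ((-1) ^+ n).
Proof.
by elim: n => [|n IHn]; rewrite ?exprS; [apply: Zq_1 | apply/Zq_mul/IHn/ZqN/Zq_1].
Qed.

(** The n-th term (r h)^n / n! of exp(r h), kept as an element of Q[[h]]. *)
Definition dexp r n : Qh := fpsC (r ^+ n / n`!%:R) * h ^+ n.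

Lemma dexpE r n : (n`!%:R)^-1 * (fpsC r * h) ^+ n = dexp r n.
Proof. by rewrite /dexp exprMn fpsCM fpsCX fpsCV fpsC_nat mulrCA mulrA. Qed.

Lemma dexpM r s n : dexp r n * fpsC (s ^+ n) = dexp (r * s) n.
Proof. by rewrite /dexp mulrAC -fpsCM exprMn mulrAC. Qed.

Lemma dexp_bin r i n : (i <= n)%N ->
  dexp r i * dexp r (n - i) = 'C(n, i)%:R * dexp r n.
Proof.
move=> le_in; rewrite /dexp -fpsC_nat mulrACA -fpsCM -exprD subnKC // mulrA -fpsCM.
congr (fpsC _ * _); rewrite -[in RHS](subnKC le_in) exprD subnKC //.
rewrite -(bin_fact le_in) !natrM.
have := factr_neq0 i; have := factr_neq0 (n - i).
have : 'C(n, i)%:R != 0 :> rat by rewrite pnatr_eq0 -lt0n bin_gt0.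
by move=> *; field; apply/and3P.
Qed.

Lemma expq_tail r n : exists g, expq r - \sum_(i < n) dexp r i = h ^+ n * g.
Proof.
apply: hX_dvd => m lt_mn /=; rewrite fcoef_sum (bigD1 (Ordinal lt_mn)) //=.
rewrite /dexp fcoefCM fcoef_hX eqxx mulr1 big1 ?addr0 ?subrr // => i ne.
rewrite fcoefCM fcoef_hX; case: eqP => [mi|_]; last by rewrite mulr0.
by case/eqP: ne; apply: val_inj.
Qed.

Lemma hpow_dexp (M : lmodType Qh) r n (x : M) : hpow n (dexp r n *: x).
Proof. by rewrite /dexp mulrC -scalerA; apply: hpowI. Qed.

Lemma hcvg_expq (M : lmodType Qh) r (x : M) :
  hcvg (fun n => \sum_(i < n) dexp r i *: x) (expq r *: x).
Proof.
move=> p; exists p => n le_pn; rewrite -scaler_suml -scalerBl -opprB.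
have [g ->] := expq_tail r n; rewrite scaleNr -scalerA; apply/hpowN.
exact: hpow_le le_pn (hpowI _ _).
Qed.

(** After division by the constant coefficient, f = 1 - g with h dividing g, and the geometric
    series inverts 1 - g. *)
Lemma fps_unitP f : fcoef f 0 != 0 -> f \is a GRing.unit.
Proof.
move=> f0; have [g gdef] : exists g, g = 1 - fpsC (fcoef f 0)^-1 * f by eexists.
have [k gE] : exists k, g = h ^+ 1 * k.
  by apply: hX_dvd => -[|//] _; rewrite gdef /= fcoefCM mulVf ?subrr.
pose F n := \sum_(i < n) g ^+ i.
pose L : Qh := Fps (fun n => fcoef (F n.+1) n).
(* Coefficient n is stable from F (n + 1) on; the second alternative absorbs m = n, where the power
   g^n is still missing. *)
have Fn n m : (n <= m)%N -> fcoef (F m) n = fcoef (F n.+1) n \/ (n >= m)%N.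
  elim: m => [|m IHm]; first by right; lia.
  rewrite leq_eqVlt => /orP[/eqP->|]; first by right.
  rewrite ltnS leq_eqVlt => /orP[/eqP->|lt_nm]; first by left.
  left; have [<-|] := IHm (ltnW lt_nm); last lia.
  rewrite /F big_ord_recr /= gE exprMn expr1 fcoefhXM lt_nm.
  by rewrite addr0.
have Lg : (1 - g) * L = 1.
  apply: fpsP => n.
  have -> : fcoef ((1 - g) * L) n = fcoef ((1 - g) * F n.+1) n.
    rewrite !fcoefM; apply: eq_bigr => i _; congr (_ * _) => /=.
    by have [||] := Fn (n - i)%N n.+1; [lia | move=> -> | lia].
  have -> : (1 - g) * F n.+1 = 1 - g ^+ n.+1.
    by rewrite -[RHS]opprB subrX1 -[RHS]mulNr [X in _ = X * _]opprB.
  by rewrite gE exprMn expr1 /= fcoefhXM ltnSn oppr0 addr0.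
apply/asboolP; exists (L * fpsC (fcoef f 0)^-1).
have fE : fpsC (fcoef f 0)^-1 * f = 1 - g by rewrite gdef opprB addrC subrK.
by rewrite -mulrA fE mulrC.
Qed.

Lemma vv_h : exists k, v - v^-1 = h ^+ 1 * k.
Proof.
apply: hX_dvd => -[|//] _.
by rewrite vVE vE /= fact0 !divr1 subrr.
Qed.

Let b := v - v^-1.

(** The coefficient of h in v - v^-1 is 1, so v - v^-1 is h times a unit, and h is cancellable. This
    makes the quotients chosen by [exquo] unique. *)
Lemma vv_reg f g : f * b = g * b -> f = g.
Proof.
have [k bE] := vv_h.
have ku : k \is a GRing.unit.
  apply: fps_unitP; have := congr1 (fun f => fcoef f 1%N) bE.
  rewrite fcoefhXM /= /b vE expqV /= => <-; rewrite !expr1 !divr1 opprK.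
  by apply/eqP; lra.
rewrite /b bE expr1 !mulrA ![_ * h]mulrC => /(mulIr ku) fg; apply: fpsP => n.
by have := congr1 (fun f => fcoef f n.+1) fg; rewrite !fcoefhM.
Qed.

Lemma exquoP x y z : (forall f g : Qh, f * y = g * y -> f = g) -> z * y = x ->
  exquo x y = z.
Proof.
move=> yreg zy; apply: yreg; rewrite zy /exquo.
exact: (xgetPex 0 (P := [set c | c * y = x]) (ex_intro _ z zy)).
Qed.

Lemma qVv : q - 1 = v * b.
Proof. by rewrite /b mulrBr divrr // vE expq_unit. Qed.

Lemma qreg f g : f * (q - 1) = g * (q - 1) -> f = g.
Proof.
rewrite qVv !mulrA => /vv_reg; apply: mulIr.
by rewrite vE expq_unit.
Qed.

Lemma qintqE n : qintq n = \sum_(i < n) q ^+ i.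
Proof. by apply: exquoP qreg _; rewrite mulrC -subrX1. Qed.

Lemma v_unit : v \is a GRing.unit. Proof. by rewrite vE expq_unit. Qed.

Lemma qintE n : qint n = v * v ^- n * qintq n.
Proof.
apply: exquoP vv_reg _; rewrite -/b.
have -> : v * v ^- n * qintq n * b = v ^- n * (qintq n * (q - 1)).
  by rewrite qVv; ring.
rewrite qintqE [_ * (q - 1)]mulrC -subrX1 /q -exprM mul2n -addnn exprD.
by rewrite mulrBr mulrA mulVr ?unitrX ?v_unit // mul1r mulr1.
Qed.

Lemma qintq_unit n : (0 < n)%N -> qintq n \is a GRing.unit.
Proof.
move=> n0; apply: fps_unitP; rewrite qintqE fcoef_sum.
rewrite (eq_bigr (fun=> 1)) => [|i _]; last by rewrite qX_qz /= fact0 divr1.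
by rewrite sumr_const card_ord pnatr_eq0 -lt0n.
Qed.

Lemma qfactqS n : qfactq n.+1 = qfactq n * qintq n.+1.
Proof. by rewrite /qfactq big_nat_recr. Qed.

Lemma qfactq0 : qfactq 0 = 1. Proof. by rewrite /qfactq big_geq. Qed.

Lemma qfactq_unit n : qfactq n \is a GRing.unit.
Proof.
elim: n => [|n IHn]; first by rewrite qfactq0 unitr1.
by rewrite qfactqS unitrM IHn qintq_unit.
Qed.

Lemma qintq_split i n : (i <= n)%N -> qintq i + q ^+ i * qintq (n - i) = qintq n.
Proof.
move=> le_in; rewrite !qintqE -[in RHS](subnKC le_in) big_split_ord /= mulr_sumr.
by congr (_ + _); apply: eq_bigr => j _; rewrite exprD.
Qed.

(** As [n]! = v^(-n(n-1)/2) [n]_q!, the power of v is doubled and becomes an integral power of q. *)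
Lemma qfact_qfactq n : v ^+ (n * n.-1)./2 / qfact n = qz (n * n.-1)./2%:Z / qfactq n.
Proof.
have -> : qfactq n = v ^+ (n * n.-1)./2 * qfact n.
  elim: n => [|n IHn]; first by rewrite qfactq0 /qfact big_geq // mulr1.
  rewrite qfactqS IHn /qfact [in RHS]big_nat_recr //= -/(qfact n) qintE.
  have -> : ((n.+1 * n)./2 = (n * n.-1)./2 + n)%N.
    case: n {IHn} => [|n]; first by []. rewrite succnK.
    have -> : (n.+2 * n.+1 = n.+1 * n + n.+1.*2)%N by rewrite -muln2; ring.
    by rewrite halfD odd_double andbF doubleK.
  rewrite exprD !exprS invrM ?unitrX ?v_unit //.
  have /(mulrV) := v_unit; have := mulrV (unitrX n v_unit).
  move: (v ^- n) (v^-1) => vn v1 e1 e2.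
  have -> : v ^+ (n * n.-1)./2 * v ^+ n * (qfact n * (v * (vn * v1) * qintq n.+1)) =
     (v ^+ n * vn) * (v * v1) * (v ^+ (n * n.-1)./2 * qfact n * qintq n.+1) by ring.
  by rewrite e1 e2 !mul1r.
have fu : qfact n \is a GRing.unit.
  elim: n => [|n IHn]; first by rewrite /qfact big_geq // unitr1.
  rewrite /qfact big_nat_recr //= unitrM IHn qintE !unitrM v_unit unitrV.
  by rewrite unitrX ?v_unit // qintq_unit.
rewrite -qX_qz /q exprAC expr2; set w := v ^+ _.
have wu : w \is a GRing.unit by rewrite unitrX // v_unit.
move: w (qfact n) wu fu => w f wu fu.
by rewrite invrM // [_^-1 / _]mulrC mulrACA divrr // mul1r.
Qed.

End QhCoef.

(** Exponential generating series of x; the powers K^a and the Cartan factor of R are of this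
    kind. *)
Definition exp_sum (M : lmodType Qh) r (x : nat -> M) : M := hsum (fun n => dexp r n *: x n).

Lemma exp_sum_scalar (M : lmodType Qh) r s (x : M) : hseparated M ->
  exp_sum r (fun n => fpsC (s ^+ n) *: x) = expq (r * s) *: x.
Proof.
move=> sM; apply: hsum_eq => //; have := hcvg_expq (r * s) x; congr hcvg.
by apply/funext => n; apply: eq_bigr => i _; rewrite scalerA dexpM.
Qed.

Lemma exp_sum_geom (M : lmodType Qh) r s (x : nat -> M) :
  exp_sum r (fun n => fpsC (s ^+ n) *: x n) = exp_sum (r * s) x.
Proof. by apply: eq_hsum => n; rewrite scalerA dexpM. Qed.

Lemma exp_sum_lin (M N : lmodType Qh) (f : M -> N) r x : linear f -> hcomplete M -> hseparated N ->
  f (exp_sum r x) = exp_sum r (f \o x).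
Proof.
move=> linf cM sN; rewrite /exp_sum (hsum_lin linf) // => [|n]; last exact: hpow_dexp.
by apply: eq_hsum => n /=; rewrite (linZ linf).
Qed.

Lemma exp_sum_bin (M M' N : lmodType Qh) (B : M -> M' -> N) r x y : bilinear_for B ->
  hcomplete M -> hcomplete M' -> hcomplete N ->
  B (exp_sum r x) (exp_sum r y) =
  exp_sum r (fun n => \sum_(i < n.+1) 'C(n, i)%:R *: B (x i) (y (n - i)%N)).
Proof.
move=> bilB cM cM' cN; rewrite /exp_sum (hsum_Cauchy bilB) //; try by move=> m; apply: hpow_dexp.
apply: eq_hsum => n; rewrite scaler_sumr; apply: eq_bigr => i _.
rewrite (linZ (bilB.1 _)) (linZ (bilB.2 _)) !scalerA dexp_bin -1?ltnS //.
by rewrite [dexp r n * _]mulrC.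
Qed.

(** * Completed tensor powers *)

(** The scalar map [phi] lets one notion serve both for tensor powers of U_h over Q[[h]] and for
    those of U^ev over Z[q,q^-1], with values in a Q[[h]]-module. *)
Definition multilin (R : comNzRingType) (phi : R -> Qh) (M : lmodType R) n
    (N : lmodType Qh) (f : n.-tuple M -> N) :=
  forall x i a u w,
    f (tsubst x i (a *: u + w)) = phi a *: f (tsubst x i u) + f (tsubst x i w).

Section TensorLift.
Variables (R : comNzRingType) (phi : {rmorphism R -> Qh}) (M : lmodType R) (n : nat).
Variables (N : lmodType Qh) (f : n.-tuple M -> N).
Hypothesis mf : multilin phi f.

Let F (z : {malg R[n.-tuple M]}) : N := \sum_(k <- finmap.enum_fset (msupp z)) phi z@_k *: f k.

Let Fw (d : finmap.finset_of (Phant (n.-tuple M))) z : finmap.fsubset (msupp z) d ->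
  F z = \sum_(k <- finmap.enum_fset d) phi z@_k *: f k.
Proof.
move=> le_zd; rewrite /F (finmap.big_fset_incl _ le_zd) //= => k _ /mcoeff_outdom ->.
by rewrite rmorph0 scale0r.
Qed.

Let F_lin a z y : F (a *: z + y) = phi a *: F z + F y.
Proof.
pose d := finmap.fsetU (msupp (a *: z + y)) (finmap.fsetU (msupp z) (msupp y)).
have sub1 : finmap.fsubset (msupp (a *: z + y)) d by apply: finmap.fsubsetUl.
have sub2 : finmap.fsubset (msupp z) d.
  exact: finmap.fsubset_trans (finmap.fsubsetUl _ _) (finmap.fsubsetUr _ _).
have sub3 : finmap.fsubset (msupp y) d.
  exact: finmap.fsubset_trans (finmap.fsubsetUr _ _) (finmap.fsubsetUr _ _).
rewrite (Fw sub1) (Fw sub2) (Fw sub3) scaler_sumr -big_split.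
apply: eq_bigr => k _ /=.
by rewrite mcoeffD mcoeffZ rmorphD rmorphM scalerDl scalerA.
Qed.

Let F_U x : F << x >> = f x.
Proof.
by rewrite /F msuppU oner_eq0 finmap.big_seq_fset1 mcoeffUU rmorph1 scale1r.
Qed.

Let F_0 : F 0 = 0. Proof. by rewrite /F msupp0 finmap.big_seq_fset0. Qed.
Let F_Z a z : F (a *: z) = phi a *: F z.
Proof. by rewrite -[a *: z]addr0 F_lin F_0 addr0. Qed.
Let F_B z y : F (z - y) = F z - F y.
Proof. by rewrite -[- y]scaleN1r [z + _]addrC F_lin rmorphN1 scaleN1r addrC. Qed.

Let F_rel z : mspan (@multilin_rel R M n) z -> F z = 0.
Proof.
elim=> [|{}z [x [i [a [u [w ->]]]]]|a y {}z _ y0 _ z0].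
- exact: F_0.
- by rewrite !F_B F_Z !F_U mf -addrA -opprD subrr.
- by rewrite F_lin y0 z0 scaler0 addr0.
Qed.

(** The linear extension [F] to the free module kills the multilinearity relations, so evaluating it
    on representatives is well defined. *)
Lemma tensor_lift : exists g : tpow R M n -> N,
  (forall a x y, g (a *: x + y) = phi a *: g x + g y) /\ forall x, g (tpure x) = f x.
Proof.
have Fproj z : F (repr (proj (@multilin_rel R M n) z)) = F z.
  have /F_rel := reprPspan (@multilin_rel R M n) z.
  by rewrite F_B => /eqP; rewrite subr_eq0 => /eqP.
exists (fun u => F (repr u)); split=> [a x y|x]; last by rewrite Fproj F_U.
rewrite -{1}[x]projK -{1}[y]projK; move: (repr x) (repr y) => {}x {}y.
have -> : a *: proj (@multilin_rel R M n) x + proj (@multilin_rel R M n) y =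
  proj _ (a *: x + y) by rewrite projD projZ.
by rewrite Fproj F_lin.
Qed.

End TensorLift.

Lemma malgUZ (R : nzRingType) (K : choiceType) (c : R) (k : K) :
  << c *g k >> = c *: << k >> :> {malg R[K]}.
Proof. by apply/malgP => l; rewrite mcoeffZ !mcoeffU mulr_natr. Qed.

Lemma tpow_ind (R : comNzRingType) (M : lmodType R) n (P : tpow R M n -> Prop) :
  P 0 -> (forall a x y, P y -> P (a *: tpure x + y)) -> forall z, P z.
Proof.
move=> P0 PD z; rewrite -[z]projK; move: (repr z) => {}z.
rewrite [z]monalgE.
elim: (finmap.enum_fset (msupp z)) => [|k r IHr]; first by rewrite big_nil proj0.
rewrite big_cons projD malgUZ [X in P (X + _)]projZ.
exact: PD z@_k k _ IHr.
Qed.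

Lemma proj_sum (R : pzRingType) (M : lmodType R) (S : set M) (I : Type) (r : seq I)
    (P : pred I) (F : I -> M) :
  proj S (\sum_(i <- r | P i) F i) = \sum_(i <- r | P i) proj S (F i).
Proof. by elim/big_rec2: _ => [|i y x _ <-]; rewrite ?proj0 ?projD. Qed.

Section ComplTheory.
Variables (R : pzRingType) (M : lmodType R) (S : nat -> set M).
Hypothesis decS : forall p x, mspan (S p.+1) x -> mspan (S p) x.
Implicit Types s t : compl S.

Lemma compl_rep s p : mspan (S p) (repr (cproj s p.+1) - repr (cproj s p)).
Proof.
have [x [x0 x1]] := cprojP s p.
rewrite -(subrKA x); apply: mspanD.
  by apply/decS/projP; rewrite projK.
by apply/projP; rewrite projK.
Qed.

End ComplTheory.

Section ComplHadic.
Variable M : lmodType Qh.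
Notation CM := (compl (fun p => @hpow M p)).
Implicit Types s t : CM.

Lemma mspan_hpowS p x : mspan (@hpow M p.+1) x -> mspan (@hpow M p) x.
Proof. by move=> /mspan_hpow hx; apply/mspan_in/(hpow_le _ hx). Qed.

Lemma hproj0 p x : hpow p x -> proj (@hpow M p) x = 0.
Proof. by move=> hx; rewrite -(proj0 (@hpow M p)); apply/projP; rewrite subr0; apply: mspan_in. Qed.

Lemma cproj_h p n s : (p <= n)%N -> cproj (h ^+ n *: s) p = 0.
Proof.
move=> le_pn; rewrite /= -[cproj s p]projK -projZ; apply: hproj0.
exact: hpow_le le_pn (hpowI _ _).
Qed.

Lemma cprojD s t p : cproj (s + t) p = cproj s p + cproj t p. Proof. by []. Qed.
Lemma cprojZ a s p : cproj (a *: s) p = a *: cproj s p. Proof. by []. Qed.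
Lemma cprojN s p : cproj (- s) p = - cproj s p. Proof. by []. Qed.
Lemma cproj0 p : cproj (0 : CM) p = 0. Proof. by rewrite /= proj0. Qed.

Lemma hseparated_compl : hseparated CM.
Proof.
move=> s sP; apply: complP => p; have [t _ <-] := sP p.
by rewrite cproj_h // cproj0.
Qed.

(** In degree p only the first p terms of a series sum h^i y_i count, so each class of the sum is a
    finite sum. *)
Lemma hcomplete_compl : hcomplete CM.
Proof.
apply: (hcompleteP hseparated_compl) => y.
have LP n p : exists x : M,
    proj _ x = \sum_(i < p) h ^+ i *: cproj (y (n + i)%N) p /\
    proj _ x = \sum_(i < p.+1) h ^+ i *: cproj (y (n + i)%N) p.+1.
  have /choice[x xP] i := cprojP (y (n + i)%N) p.
  exists (\sum_(i < p.+1) h ^+ i *: x i); split.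
    rewrite proj_sum big_ord_recr /= [X in _ + X]hproj0 ?addr0.
      by apply: eq_bigr => i _; rewrite projZ; case: (xP i) => ->.
    exact: hpowI.
  rewrite proj_sum; apply: eq_bigr => i _.
  by rewrite projZ; case: (xP i) => _ ->.
exists (fun n => Compl (LP n)) => n; apply: complP => p.
rewrite cprojD cprojZ /=; case: p => [|p].
  rewrite !big_ord0 scaler0 addr0 -[cproj _ _]projK; symmetry.
  exact/hproj0/hpowT.
rewrite big_ord_recl /= expr0 scale1r addn0; congr (_ + _).
rewrite scaler_sumr [in RHS]big_ord_recr /=.
have -> : h *: (h ^+ p *: cproj (y (n.+1 + p)%N) p.+1) = 0.
  by rewrite scalerA -exprS -cprojZ cproj_h.
rewrite addr0; apply: eq_bigr => i _.
by rewrite scalerA -exprS /bump /= add1n addSnnS.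
Qed.

Lemma compl_in_linear : linear (@compl_in Qh M (fun p => @hpow M p)).
Proof. by move=> a x y; apply: complP => p; rewrite cprojD cprojZ /= projD projZ. Qed.

(** Density of M in its completion: the representatives of the successive classes converge to the
    point. *)
Lemma hcvg_compl s : hcvg (fun p => compl_in _ (repr (cproj s p)) : CM) s.
Proof.
pose u p : CM := compl_in _ (repr (cproj s p)).
have uP n : hpow n (u n.+1 - u n).
  have /mspan_hpow[y _ yE] := compl_rep mspan_hpowS s n.
  by rewrite /u -(linB compl_in_linear) -yE (linZ compl_in_linear); apply: hpowI.
have [l ul] := hcomplete_compl.2 _ uP.
suff e : l = s by rewrite e in ul.
apply: complP => p; have := hcvg_tail (p := 0) ul uP p => -[t _ tE].
have := congr1 (fun s : CM => cproj s p) tE.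
rewrite cproj_h // cprojD cprojN => /esym/eqP; rewrite subr_eq0 => /eqP ->.
by rewrite /u /= projK.
Qed.

End ComplHadic.

Lemma hcomplete_T n : hcomplete (T n). Proof. exact: hcomplete_compl. Qed.
Lemma hseparated_T n : hseparated (T n). Proof. exact: (hcomplete_T n).1. Qed.

(** Finite combinations of pure tensors are dense, and linear maps are continuous. *)
Lemma lin_extT n (N : lmodType Qh) (f g : T n -> N) : hseparated N ->
  linear f -> linear g -> (forall x, f (pure x) = g (pure x)) -> f =1 g.
Proof.
move=> sN lf lg fg s.
have fg0 z : f (compl_in _ z) = g (compl_in _ z).
  elim/tpow_ind: z => [|a x y IHy].
    have -> : compl_in _ 0 = 0 :> T n by [].
    by rewrite (lin0 lf) (lin0 lg).
  rewrite compl_in_linear lf lg IHy; congr (_ *: _ + _); exact: fg.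
apply: (hcvg_uniq sN (hcvg_lin lf (hcvg_compl s))).
have := hcvg_lin lg (hcvg_compl s); congr hcvg.
by apply/funext => p /=; rewrite fg0.
Qed.

Section CliftSpec.
Variables (n : nat) (N : lmodType Qh) (f : n.-tuple Uh -> N).
Hypotheses (cN : hcomplete N) (mf : multilin idfun f).

(** The map chosen by [clift] exists: the lift to the uncompleted tensor power, evaluated on
    successive representatives, is a Cauchy sequence in the complete module N. *)
Lemma clift_spec : linear (clift f) /\ forall x, clift f (pure x) = f x.
Proof.
suff ex : exists g : T n -> N, linear g /\ forall x, g (pure x) = f x.
  exact: (xgetPex (fun=> 0)
    (P := [set g : T n -> N | linear g /\ forall x, g (pure x) = f x]) ex).
have [g [lg gf]] := tensor_lift (phi := idfun) mf.
have {}lg : linear g := lg.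
have gcvg (s : T n) : hcvg (fun p => g (repr (cproj s p))) (hlim (fun p => g (repr (cproj s p)))).
  have [p|l lP] := cN.2 (fun p => g (repr (cproj s p))).
    rewrite -(linB lg); apply: hpow_lin => //.
    exact/mspan_hpow/(compl_rep (@mspan_hpowS _)).
  by rewrite (hlimE cN.1 lP).
exists (fun s => hlim (fun p => g (repr (cproj s p)))); split=> [a s t|x].
  apply: (hlimE cN.1).
  have lZ : linear (fun x : N => a *: x).
    by move=> b x y; rewrite scalerDr !scalerA mulrC.
  apply: (hcvg_near (hcvgD (hcvg_lin lZ (gcvg s)) (gcvg t))) => p /=.
  rewrite -lg -(linB lg); apply: hpow_lin => //; apply: mspan_hpow.
  by apply/projP; rewrite projK projD projZ !projK.
apply: (hlimE cN.1); rewrite -gf; apply: (hcvg_near (hcvg_cst _)) => p.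
rewrite -(linB lg); apply: hpow_lin => //; apply: mspan_hpow.
by apply/projP; rewrite projK.
Qed.

Lemma clift_linear : linear (clift f). Proof. exact: clift_spec.1. Qed.
Lemma clift_pure x : clift f (pure x) = f x. Proof. exact: clift_spec.2. Qed.

End CliftSpec.

(** * U_h and Sweedler sums *)

Lemma toUhZ a X : toUh (a *: X) = a *: toUh X. Proof. exact: projZ. Qed.
Lemma toUhD X Y : toUh (X + Y) = toUh X + toUh Y. Proof. exact: projD. Qed.
Lemma toUhM X Y : toUh (X * Y) = toUh X * toUh Y. Proof. by rewrite -Uh_mulE. Qed.

Lemma UhZl a (x y : Uh) : a *: (x * y) = (a *: x) * y.
Proof.
by rewrite -[x]toUhK -[y]toUhK -toUhM -!toUhZ -toUhM scalerAl.
Qed.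

Lemma UhZr a (x y : Uh) : a *: (x * y) = x * (a *: y).
Proof.
by rewrite -[x]toUhK -[y]toUhK -toUhM -!toUhZ -toUhM scalerAr.
Qed.

(** The defining ideal is h-adically closed: an element divisible by every h^p has a representative
    that the ideal approximates modulo each h^p. *)
Lemma hseparated_Uh : hseparated Uh.
Proof.
move=> x xP; rewrite -[x]toUhK -[RHS]projK -/(toUh _); apply/projP/mspan_in => p.
(* The chosen representative of 0 is only known to lie in the closed ideal. *)
have e0 : repr (0 : Uh) = repr (0 : Uh) - 0 by rewrite subr0.
have /Uh_closed_idealP/(_ p)[y0 [iy0 hy0]] : mspan Uh_closed_ideal (repr (0 : Uh)).
  by rewrite e0; apply/projP; rewrite projK proj0.
have [y _ yE] := xP p.
have /Uh_closed_idealP/(_ p)[y1 [iy1 hy1]] :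
    mspan Uh_closed_ideal (repr x - h ^+ p *: repr y).
  by apply/projP; rewrite projZ !projK.
exists (y1 - y0); split; first by apply: mspanD => //; apply: mspanN.
have -> : repr x - repr (0 : Uh) - (y1 - y0) =
  (repr x - h ^+ p *: repr y - y1) - (repr (0 : Uh) - y0) + h ^+ p *: repr y.
  move: (repr x) (repr (0 : Uh)) (h ^+ p *: repr y) => a b c.
  rewrite !opprB -!addrA; congr (_ + _); rewrite !addrA [RHS]addrC -!addrA addNKr.
  by rewrite addrCA [RHS]addrCA [- b - _]addrC.
by apply: hpowD (hpowI _ _); apply: hpowB.
Qed.

(** Sums are formed on representatives in Q<H,E,F>[[h]], where each coefficient of sum h^i y_(n+i)
    is a finite sum. *)
Lemma hcomplete_Uh : hcomplete Uh.
Proof.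
apply: (hcompleteP hseparated_Uh) => y.
pose L n : freeAh := Fps (fun k => \sum_(i < k.+1) fcoef (repr (y (n + i)%N)) (k - i)).
exists (fun n => toUh (L n)) => n; rewrite -{1}[y n]toUhK -toUhZ -toUhD.
congr toUh; apply: fpsP => k /=; rewrite fcoef_scaleh big_ord_recl /= addn0 subn0.
congr (_ + _); case: k => [|k]; first by rewrite big_ord0.
by apply: eq_bigr => i _; rewrite /bump /= add1n addnS addSn subSS.
Qed.

Lemma fpsCZ (A : algType rat) c (x : A) : fpsC (c *: x) = (fpsC c : Qh) *: fpsC x.
Proof.
apply: fpsP => n; rewrite fcoef_scale big_ord_recl /= subn0 big1 ?addr0.
  by case: n => [|n] //; rewrite scaler0.
by move=> i _; apply: scale0r.
Qed.

Lemma freeA_ind (P : freeA -> Prop) :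
  P 0 -> (forall c m y, P y -> P (c *: << m >> + y)) -> forall z, P z.
Proof.
move=> P0 PD z; rewrite [z]monalgE.
elim: (finmap.enum_fset _) => [|k r IHr]; first by rewrite big_nil.
by rewrite big_cons malgUZ; apply: PD.
Qed.

Lemma ord3P (i : 'I_3) : i = inord 0 \/ i = inord 1 \/ i = inord 2.
Proof.
by case: i => [[|[|[|//]]]] ilt; [left | right; left | right; right];
  apply: val_inj; rewrite /= inordK.
Qed.

(** The difference vanishes on words in H, E, F by induction on their length, hence on constant
    series. *)
Lemma Uh_ext (N : lmodType Qh) (f g : Uh -> N) : hseparated N -> linear f -> linear g ->
  f 1 = g 1 ->
  (forall x, f x = g x -> [/\ f (uH * x) = g (uH * x), f (uE * x) = g (uE * x) &
                              f (uF * x) = g (uF * x)]) ->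
  f =1 g.
Proof.
move=> sN lf lg fg1 fgM x.
pose d z := f z - g z.
have ld : linear d.
  by move=> a y z; rewrite /d lf lg opprD addrACA -scalerBr.
suff d0 : d x = 0 by apply/eqP; rewrite -subr_eq0 -/(d x) d0.
have dmon (m : {fmonom 'I_3}) : d (toUh (fpsC << m >>)) = 0.
  apply/eqP; rewrite subr_eq0; apply/eqP.
  case: m; elim=> [|i s IHs].
    by rewrite -fmoneE.
  have -> : fpsC << FMonom (i :: s) >> = gen i * fpsC << FMonom s >> :> freeAh.
    rewrite /gen -fpsCM; congr fpsC.
    rewrite malgM_def fgmulUU mul1r; congr << _ >>.
    by rewrite -[RHS]/(fmmul (fmu i) (FMonom s)) fmmulE fmuE.
  rewrite toUhM; have [fgH fgE fgF] := fgM _ IHs.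
  have [->|[->|->]] := ord3P i; [exact: fgH | exact: fgE | exact: fgF].
have dC (c : freeA) : d (toUh (fpsC c)) = 0.
  elim/freeA_ind: c => [|c m y IHy].
    by rewrite -[toUh _]/(proj _ 0) proj0 (lin0 ld).
  by rewrite fpsCD fpsCZ toUhD toUhZ ld IHy dmon scaler0 addr0.
(* Splitting off the constant coefficient of a series leaves h times a series, which gains one power
   of h at each step. *)
apply: sN => p; rewrite -[x]toUhK; elim: p (repr x) => [|p IHp] X; first exact: hpowT.
have -> : X = fpsC (fcoef X 0) + h *: Fps (fun n => fcoef X n.+1).
  apply: fpsP => -[|n]; rewrite /= fcoef_scaleh ?addr0 //.
  by rewrite add0r.
rewrite toUhD toUhZ (linD ld) (linZ ld) dC add0r -add1n.
exact: (hpowDn 1 (IHp _)).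
Qed.

Lemma pure_multilin n : multilin (M := Uh) idfun (@pure n).
Proof.
move=> x i a u w; rewrite /pure -compl_in_linear; congr compl_in.
rewrite /tpure -projZ -projD; apply/projP; apply: mspan_in.
by exists x, i, a, u, w; rewrite opprD addrA.
Qed.

Lemma multilin2 (N : lmodType Qh) (B : Uh -> Uh -> N) : bilinear_for B ->
  multilin idfun (fun t : 2.-tuple Uh => B [tnth t 0] [tnth t 1]).
Proof.
move=> [Bl Br] x i a u w; rewrite !tnth_mktuple.
by case: i => [[|[|//]]] ilt /=; rewrite ?Bl ?Br.
Qed.

Lemma multilin1 (N : lmodType Qh) (B : Uh -> N) : linear B ->
  multilin idfun (fun t : 1.-tuple Uh => B [tnth t 0]).
Proof.
move=> lB x i a u w; rewrite !tnth_mktuple.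
by case: i => [[|//]] ilt /=; rewrite lB.
Qed.

Lemma tuple2E (A : Type) (x : 2.-tuple A) : x = [tuple [tnth x 0]; [tnth x 1]].
Proof.
by apply: eq_from_tnth => -[[|[|//]]] ilt; rewrite [RHS](tnth_nth [tnth x 0]) /=;
  congr tnth; apply: val_inj.
Qed.

Lemma tuple1E (A : Type) (x : 1.-tuple A) : x = [tuple [tnth x 0]].
Proof.
by apply: eq_from_tnth => -[[|//]] ilt; rewrite [RHS](tnth_nth [tnth x 0]) /=;
  congr tnth; apply: val_inj.
Qed.

Lemma pureE2 (x : 2.-tuple Uh) : pure x = pure2 [tnth x 0] [tnth x 1].
Proof. by rewrite /pure2 -tuple2E. Qed.

Lemma pureE1 (x : 1.-tuple Uh) : pure x = pure1 [tnth x 0].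
Proof. by rewrite /pure1 -tuple1E. Qed.

Lemma pure2_bilin : bilinear_for pure2.
Proof.
split=> [y|x] a u w.
  have := @pure_multilin 2 [tuple 0; y] ord0 a u w.
  by rewrite !pureE2 !tnth_mktuple.
have := @pure_multilin 2 [tuple x; 0] ord_max a u w.
by rewrite !pureE2 !tnth_mktuple.
Qed.

Lemma pure1_linear : linear pure1.
Proof.
move=> a u w; have := @pure_multilin 1 [tuple 0] ord0 a u w.
by rewrite !pureE1 !tnth_mktuple.
Qed.

Lemma lin_ext2 (N : lmodType Qh) (f g : T 2 -> N) : hseparated N ->
  linear f -> linear g -> (forall x y, f (pure2 x y) = g (pure2 x y)) -> f =1 g.
Proof. by move=> sN lf lg fg; apply: lin_extT => // x; rewrite pureE2 fg. Qed.

Lemma lin_comp (M N P : lmodType Qh) (f : N -> P) (g : M -> N) :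
  linear f -> linear g -> linear (f \o g).
Proof. by move=> lf lg a x y; rewrite /= lg lf. Qed.

Lemma linDf (M N : lmodType Qh) (f g : M -> N) a : linear f -> linear g ->
  linear (fun x => a *: f x + g x).
Proof.
move=> lf lg b x y; rewrite lf lg !scalerDr !scalerA addrACA mulrC.
by congr (_ + _).
Qed.

Lemma linZf (M N : lmodType Qh) (f : M -> N) a : linear f -> linear (fun x => a *: f x).
Proof. by move=> lf b x y; rewrite lf scalerDr !scalerA mulrC. Qed.

Lemma mulUh_bilin : bilinear_for (fun x y : Uh => x * y).
Proof.
by split=> [y|x] a u w; rewrite ?mulrDl ?mulrDr -?UhZl -?UhZr.
Qed.

Section Sweedler.
Variables (N : lmodType Qh) (B : Uh -> Uh -> N).
Hypotheses (cN : hcomplete N) (bB : bilinear_for B).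

Lemma sweedler_linear : linear (fun X => sweedler X B).
Proof. exact/(clift_linear cN)/multilin2. Qed.

Lemma sweedler_pure2 x y : sweedler (pure2 x y) B = B x y.
Proof. by rewrite /sweedler (clift_pure cN) //; apply: multilin2. Qed.

Lemma sweedlerE (g : T 2 -> N) X : linear g -> (forall x y, g (pure2 x y) = B x y) ->
  sweedler X B = g X.
Proof.
move=> lg gE; apply: (lin_ext2 cN.1 sweedler_linear lg) => x y.
by rewrite sweedler_pure2 gE.
Qed.

End Sweedler.

Lemma sweedler_linear_param (P N : lmodType Qh) (B : P -> Uh -> Uh -> N) X : hcomplete N ->
  (forall p, bilinear_for (B p)) -> (forall x y, linear (fun p => B p x y)) ->
  linear (fun p => sweedler X (B p)).
Proof.
move=> cN bB lB a p p'.
apply: (sweedlerE cN (bB _) (g := fun X => a *: sweedler X (B p) + sweedler X (B p'))) => [|x y].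
  by apply: linDf; apply: sweedler_linear.
by rewrite !sweedler_pure2 // lB.
Qed.

Section Tmul.
Variable n : nat.

Let mulc (x y : n.-tuple Uh) : n.-tuple Uh := [tuple tnth x i * tnth y i | i < n].

Let multi_r x : multilin idfun (fun y => pure (mulc x y)).
Proof.
move=> y i a u w.
have mulcE z : mulc x (tsubst y i z) = tsubst (mulc x y) i (tnth x i * z).
  apply: eq_from_tnth => j; rewrite !tnth_mktuple.
  by case: eqP => // ->.
by rewrite !mulcE (mulUh_bilin.2 _) pure_multilin.
Qed.

Let multi_l Y : multilin idfun (fun x => clift (fun y => pure (mulc x y)) Y).
Proof.
move=> x i a u w.
have mulcE y z : mulc (tsubst x i z) y = tsubst (mulc x y) i (z * tnth y i).
  apply: eq_from_tnth => j; rewrite !tnth_mktuple.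
  by case: eqP => // ->.
move: Y; apply: lin_extT; first exact: hseparated_T.
- by apply: clift_linear; [apply: hcomplete_T | apply: multi_r].
- by apply: linDf; (apply: clift_linear; [apply: hcomplete_T | apply: multi_r]).
- move=> y; rewrite !(clift_pure (@hcomplete_T n) (multi_r _)).
  by rewrite !mulcE (mulUh_bilin.1 _) pure_multilin.
Qed.

Lemma tmul_bilin : bilinear_for (@tmul n).
Proof.
split=> [Y|X]; first exact: clift_linear (@hcomplete_T n) (multi_l Y).
move=> a Y Z; rewrite /tmul -/(mulc _ _).
(* Linearity in the second argument is an equality of two linear maps of X, so it is enough to test
   it on pure X. *)
have := @lin_extT n (T n) (fun X => tmul X (a *: Y + Z)) (fun X => a *: tmul X Y + tmul X Z).
apply; first exact: hseparated_T.
- exact: clift_linear (@hcomplete_T n) (multi_l _).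
- by apply: linDf; apply: clift_linear (@hcomplete_T n) (multi_l _).
- move=> x; rewrite /tmul !(clift_pure (@hcomplete_T n) (multi_l _)).
  exact: clift_linear (@hcomplete_T n) (multi_r x) _ _ _.
Qed.

Lemma tmul_pure x y : tmul (pure x) (pure y) = pure (mulc x y).
Proof.
rewrite /tmul (clift_pure (@hcomplete_T n) (multi_l _)).
exact: (clift_pure (@hcomplete_T n) (multi_r x)).
Qed.

End Tmul.

Lemma tmul_pure2 x y x' y' : tmul (pure2 x y) (pure2 x' y') = pure2 (x * x') (y * y').
Proof. by rewrite /pure2 tmul_pure pureE2 !tnth_mktuple. Qed.

(** * The filtration topology *)

Lemma UhZX c (x : Uh) n : (c *: x) ^+ n = c ^+ n *: x ^+ n.
Proof.
elim: n => [|n IHn]; first by rewrite scale1r.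
by rewrite [LHS]exprS IHn -(UhZl c) -(UhZr (c ^+ n) x) scalerA -!exprS.
Qed.

Section Zspan.
Variables (N : lmodType Qh) (S : set N).

(** Span over Z[q,q^-1] inside a Q[[h]]-module: the integral form and its filtration are treated as
    subsets of U_h, without a change of scalars. *)
Inductive Zspan : N -> Prop :=
| Zspan0 : Zspan 0
| Zspan_in x : S x -> Zspan x
| Zspan_lin c x y : is_Zq c -> Zspan x -> Zspan y -> Zspan (c *: x + y).

Lemma ZspanD x y : Zspan x -> Zspan y -> Zspan (x + y).
Proof. by move=> sx sy; rewrite -[x]scale1r; apply: Zspan_lin => //; apply: Zq_1. Qed.
Lemma ZspanZ c x : is_Zq c -> Zspan x -> Zspan (c *: x).
Proof. by move=> Zc sx; rewrite -[_ *: _]addr0; apply: Zspan_lin => //; apply: Zspan0. Qed.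
Lemma ZspanN x : Zspan x -> Zspan (- x).
Proof. by move=> sx; rewrite -scaleN1r; apply: ZspanZ => //; apply/ZqN/Zq_1. Qed.
Lemma ZspanB x y : Zspan x -> Zspan y -> Zspan (x - y).
Proof. by move=> sx /ZspanN; apply: ZspanD. Qed.
Lemma Zspan_sum (I : Type) (r : seq I) (P : pred I) (F : I -> N) :
  (forall i, P i -> Zspan (F i)) -> Zspan (\sum_(i <- r | P i) F i).
Proof.
move=> sF; elim/big_rec: _ => [|i x Pi sx]; first exact: Zspan0.
by apply: ZspanD => //; apply: sF.
Qed.

End Zspan.

Lemma Zspan_bind (N P : lmodType Qh) (f : N -> P) (S : set N) (S' : set P) x :
  linear f -> (forall y, S y -> Zspan S' (f y)) -> Zspan S x -> Zspan S' (f x).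
Proof.
move=> lf SS'; elim=> [|y /SS' //|c y z Zc _ IHy _ IHz].
  by rewrite (lin0 lf); apply: Zspan0.
by rewrite lf; apply: Zspan_lin.
Qed.

Lemma lin_id (N : lmodType Qh) : linear (@id N). Proof. by []. Qed.

Lemma Zspan_sub (N : lmodType Qh) (S S' : set N) x :
  (forall y, S y -> Zspan S' y) -> Zspan S x -> Zspan S' x.
Proof. exact: Zspan_bind (@lin_id N). Qed.

Lemma Zspan_bind2 (M N P : lmodType Qh) (B : M -> N -> P) (S1 : set M) (S2 : set N)
    (S' : set P) x y :
  bilinear_for B -> (forall x y, S1 x -> S2 y -> Zspan S' (B x y)) ->
  Zspan S1 x -> Zspan S2 y -> Zspan S' (B x y).
Proof.
move=> bB SS' sx sy; apply: (Zspan_bind (bB.1 y) _ sx) => x' sx'.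
by apply: (Zspan_bind (bB.2 x') _ sy) => y' sy'; apply: SS'.
Qed.

Definition Uev_ideal p : set Uh :=
  Zspan [set z | exists a b, [/\ is_Uev a, is_Uev b & z = a * ue ^+ p * b]].

Lemma Uev_idealS p x : Uev_ideal p.+1 x -> Uev_ideal p x.
Proof.
apply: Zspan_sub => y [a [b [Ua Ub ->]]]; apply: Zspan_in; exists a, (ue * b).
by split=> //; [apply: Uev_mul => //; apply: Uev_e | rewrite exprSr !mulrA].
Qed.

Lemma Uev_valP (u : Uev) : is_Uev (Uev_val u).
Proof. by case: u => u /= /asboolP. Qed.

Lemma Zq_valP (c : Zq) : is_Zq (Zq_val c).
Proof. by case: c => c /= /asboolP. Qed.

Definition mkUev x (xU : is_Uev x) : Uev := @MkUev x (asboolT xU).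
Definition mkZq c (cZ : is_Zq c) : Zq := @MkZq c (asboolT cZ).

Lemma Uev_valZD (a : Zq) (x y : Uev) :
  Uev_val (a *: x + y) = Zq_val a *: Uev_val x + Uev_val y.
Proof. by []. Qed.

Lemma Uev_filE p u : Uev_fil p u <-> Uev_ideal p (Uev_val u).
Proof.
split.
  elim=> [|x [a [b xE]]|a x y _ IHx _ IHy]; first exact: Zspan0.
    by apply: Zspan_in; exists (Uev_val a), (Uev_val b); split=> //; apply: Uev_valP.
  by rewrite Uev_valZD; apply: Zspan_lin => //; apply: Zq_valP.
move=> F; suff [w wE wF] : exists2 w, Uev_val w = Uev_val u & Uev_fil p w.
  by rewrite -(val_inj wE).
elim: F => [|x [a [b [Ua Ub xE]]]|c x y Zc _ [x' <- Fx] _ [y' <- Fy]].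
- by exists 0 => //; apply: mspan0.
- have Ux : is_Uev x.
    rewrite xE; apply: Uev_mul => //; apply: Uev_mul => //; elim: p {xE} => [|p IHp].
      exact: Uev_1.
    by rewrite exprS; apply: Uev_mul => //; apply: Uev_e.
  by exists (mkUev Ux) => //; apply: mspan_in; exists (mkUev Ua), (mkUev Ub).
- by exists (mkZq Zc *: x' + y') => //; apply: mspan_lin.
Qed.

(** The element e carries the factor v - v^-1, which is divisible by h. *)
Lemma Uev_ideal_hpow p x : Uev_ideal p x -> hpow p x.
Proof.
elim=> [|y [a [b [_ _ ->]]]|c y z _ _ hy _ hz]; first exact: hpow_0.
  have [k bE] := vv_h.
  have ueX : ue ^+ p = (v - v^-1) ^+ p *: uE ^+ p by exact: UhZX.
  rewrite ueX -(UhZr _ a) -UhZl bE expr1 exprMn -scalerA; exact: hpowI.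
by apply: hpowD => //; apply: hpowZ.
Qed.

Section Incl.
Variable n : nat.

Let phi : {rmorphism Zq -> Qh} := val.

Let incl_multilin : multilin phi (fun x : n.-tuple Uev => pure (map_tuple Uev_val x)).
Proof.
move=> x i a u w.
have subE z : map_tuple Uev_val (tsubst x i z) = tsubst (map_tuple Uev_val x) i (Uev_val z).
  by apply: eq_from_tnth => j; rewrite tnth_map !tnth_mktuple tnth_map; case: eqP.
by rewrite !subE Uev_valZD pure_multilin.
Qed.

Let incl_spec :
  (forall (a : Zq) x y, @Uevn_incl n (a *: x + y) = Zq_val a *: Uevn_incl x + Uevn_incl y) /\
  (forall x : n.-tuple Uev, Uevn_incl (tpure x) = pure (map_tuple Uev_val x)).
Proof. exact: (xgetPex (fun=> 0) (tensor_lift incl_multilin)). Qed.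

Lemma incl_lin (a : Zq) x y :
  @Uevn_incl n (a *: x + y) = Zq_val a *: Uevn_incl x + Uevn_incl y.
Proof. exact: incl_spec.1. Qed.

Lemma incl_pure x : @Uevn_incl n (tpure x) = pure (map_tuple Uev_val x).
Proof. exact: incl_spec.2. Qed.

Lemma inclD x y : @Uevn_incl n (x + y) = Uevn_incl x + Uevn_incl y.
Proof. by rewrite -[x]scale1r incl_lin !scale1r. Qed.

Lemma incl0 : @Uevn_incl n 0 = 0.
Proof. by apply: (addrI (Uevn_incl 0)); rewrite -inclD !addr0. Qed.

Lemma inclB x y : @Uevn_incl n (x - y) = Uevn_incl x - Uevn_incl y.
Proof. by apply: (addIr (Uevn_incl y)); rewrite -inclD !subrK. Qed.

(** The image of F_p in T n; all estimates are about images, just as [Ut] and [Ut_nbhs] are. *)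
Definition tens_fil p : set (T n) :=
  [set z | exists2 x, mspan (@Uevn_fil n p) x & Uevn_incl x = z].

Lemma tens_fil_0 p : tens_fil p 0. Proof. by exists 0; [apply: mspan0 | apply: incl0]. Qed.

Lemma tens_fil_lin p c x y : is_Zq c -> tens_fil p x -> tens_fil p y -> tens_fil p (c *: x + y).
Proof.
move=> Zc [x' Fx <-] [y' Fy <-]; exists (mkZq Zc *: x' + y'); first exact: mspan_lin.
by rewrite incl_lin.
Qed.

Lemma tens_fil_Zspan p (S : set (T n)) z :
  (forall x, S x -> tens_fil p x) -> Zspan S z -> tens_fil p z.
Proof.
by move=> SI; elim=> [|x /SI//|c x y Zc _ Ix _ Iy]; [apply: tens_fil_0 | apply: tens_fil_lin].
Qed.

Lemma tens_filD p x y : tens_fil p x -> tens_fil p y -> tens_fil p (x + y).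
Proof. by move=> Ix Iy; rewrite -[x]scale1r; apply: tens_fil_lin => //; apply: Zq_1. Qed.

Lemma tens_fil_sum p (I : Type) (r : seq I) (P : pred I) (F : I -> T n) :
  (forall i, P i -> tens_fil p (F i)) -> tens_fil p (\sum_(i <- r | P i) F i).
Proof.
move=> sF; elim/big_rec: _ => [|i x Pi sx]; first exact: tens_fil_0.
by apply: tens_filD => //; apply: sF.
Qed.

Lemma fil_decS p x : mspan (@Uevn_fil n p.+1) x -> mspan (@Uevn_fil n p) x.
Proof.
elim=> [|y|a y z _ IHy _ IHz]; [exact: mspan0 | move=> Fy | exact: mspan_lin].
apply: mspan_in; move: y Fy; rewrite /Uevn_fil; case: n => // m _ [y [i Fy] <-].
by exists y => //; exists i; apply/Uev_filE/Uev_idealS/Uev_filE.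
Qed.

Lemma fil_dec p k x : (p <= k)%N -> mspan (@Uevn_fil n k) x -> mspan (@Uevn_fil n p) x.
Proof.
by move=> /subnKC <-; elim: (k - p)%N x => [|m IHm] x; rewrite ?addn0 // addnS => /fil_decS/IHm.
Qed.

Lemma tens_fil_le p k z : (p <= k)%N -> tens_fil k z -> tens_fil p z.
Proof. by move=> le_pk [x /(fil_dec le_pk) Fx <-]; exists x. Qed.

End Incl.

Lemma tens_fil_hpow n p z : @tens_fil n p z -> hpow p z.
Proof.
move=> [x Fx <-] {z}; elim: Fx => [|y Fy|a y y' _ IHy _ IHy']; first last.
- by rewrite incl_lin; apply: hpowD => //; apply: hpowZ.
(* For n = 0 a generator of F_p exists only when p = 0, and h^0 imposes no condition. *)
- case: n {x} y Fy => [|n] y; first by move=> /= ->; apply: hpowT.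
  case=> {}y [i /Uev_filE/Uev_ideal_hpow[u _ uE]] <-; rewrite incl_pure.
  have -> : map_tuple Uev_val y = tsubst (map_tuple Uev_val y) i (h ^+ p *: u + 0).
    apply: eq_from_tnth => j; rewrite tnth_mktuple; case: eqP => // ->.
    by rewrite tnth_map uE addr0.
  rewrite pure_multilin.
  have lin_i : pure (tsubst (map_tuple Uev_val y) i 0) = 0.
    have := @pure_multilin n.+1 (map_tuple Uev_val y) i 1 0 0.
    rewrite scaler0 addr0 scale1r => e0; apply: (addrI (pure (tsubst (map_tuple Uev_val y) i 0))).
    by rewrite -e0 addr0.
  by rewrite lin_i addr0; apply: hpowI.
- by rewrite incl0; apply: hpow_0.
Qed.

(** The elements [sum_(k >= p) a_k] with [a_k] in the image of [F_k], described by their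
  partial sums. *)
Definition tens_nbhs n p : set (T n) := [set z | exists w : nat -> T n,
  [/\ tens_fil p (w 0%N), forall k, tens_fil (p + k) (w k.+1 - w k) & hcvg w z]].

Section TensNbhs.
Variable n : nat.
Implicit Types z : T n.

Lemma tens_fil_nbhs p z : tens_fil p z -> tens_nbhs p z.
Proof.
move=> Iz; exists (fun=> z); split=> //; last exact: hcvg_cst.
by move=> k; rewrite subrr; apply: tens_fil_0.
Qed.

Lemma hcvgZ (M : lmodType Qh) u c (x : M) : hcvg u x -> hcvg (fun k => c *: u k) (c *: x).
Proof. exact/hcvg_lin/linZf/lin_id. Qed.

Lemma tens_nbhs_lin p c x y :
  is_Zq c -> @tens_nbhs n p x -> tens_nbhs p y -> tens_nbhs p (c *: x + y).
Proof.
move=> Zc [w [w0 wS wx]] [w' [w'0 w'S w'y]].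
exists (fun k => c *: w k + w' k); split; first exact: tens_fil_lin.
  by move=> k; rewrite opprD addrACA -scalerBr; apply: tens_fil_lin.
by apply: hcvgD => //; apply: hcvgZ.
Qed.

Lemma tens_nbhs_0 p : @tens_nbhs n p 0. Proof. exact/tens_fil_nbhs/tens_fil_0. Qed.

Lemma tens_nbhs_Zspan p (S : set (T n)) z :
  (forall x, S x -> tens_nbhs p x) -> Zspan S z -> tens_nbhs p z.
Proof.
by move=> SI; elim=> [|x /SI//|c x y Zc _ Ix _ Iy]; [apply: tens_nbhs_0 | apply: tens_nbhs_lin].
Qed.

Lemma tens_nbhsD p x y : @tens_nbhs n p x -> tens_nbhs p y -> tens_nbhs p (x + y).
Proof. by move=> Ix Iy; rewrite -[x]scale1r; apply: tens_nbhs_lin => //; apply: Zq_1. Qed.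

(** The two hypotheses say that [t k] lies in the filtration degree [max(p, k/2)]. *)
Lemma tens_nbhs_hsum p (t : nat -> T n) z :
  (forall k, tens_fil p (t k)) -> (forall k, tens_fil k./2 (t k)) ->
  hcvg (fun k => \sum_(i < k) t i) z -> tens_nbhs p z.
Proof.
(* Summing two terms at a time makes the increments consist of the terms of index 2(p + k) and 2(p +
   k) + 1, both in degree p + k. *)
move=> tp t2 tz; exists (fun k => \sum_(i < (p + k).*2) t i); split.
- exact: tens_fil_sum.
- move=> k; rewrite addnS doubleS !big_ord_recr /= -addrA addrAC subrr add0r.
  apply: tens_filD; first by have := t2 (p + k).*2; rewrite doubleK.
  by have := t2 (p + k).*2.+1; rewrite /= uphalf_double.
- have := hcvg_sub (f := fun k => (p + k).*2) tz; apply => k.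
  by rewrite -addnn; lia.
Qed.

(** A diagonal argument: the [k]-th partial sum collects the terms [u m (k - m)]. *)
Lemma tens_nbhs_hcvg p (b : nat -> T n) z : (forall k, tens_nbhs (p + k) (b k)) ->
  hcvg (fun k => \sum_(i < k) b i) z -> tens_nbhs p z.
Proof.
move=> /choice[u uP] bz.
pose W k := \sum_(m < k.+1) u m (k - m)%N.
have tail m k : hpow (m + k) (b m - u m k).
  have [_ uS ub] := uP m; apply: hcvg_tail ub _ k => k.
  by apply: (hpow_le _ (tens_fil_hpow (uS k))); lia.
exists W; split.
- by rewrite /W big_ord1; have [+ _ _] := uP 0%N; rewrite addn0.
(* The increment of row m is that of [u m] at k - m, in degree (p + m) + (k - m); the new row k + 1
   starts in degree p + k + 1. *)
- move=> k; rewrite {1}/W big_ord_recr /= subnn addrAC -sumrB.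
  apply: tens_filD; last by have [+ _ _] := uP k.+1; apply: tens_fil_le; lia.
  apply: tens_fil_sum => i _; have le_ik : (i <= k)%N by rewrite -ltnS.
  rewrite subSn //; have [_ + _] := uP i => /(_ (k - i)%N).
  by apply: tens_fil_le; lia.
- have bzS : hcvg (fun k => \sum_(i < k.+1) b i) z by apply: hcvg_sub bz _.
  apply: hcvg_near bzS _ => k; rewrite /W -sumrB; apply: hpow_sum => i _.
  apply: hpow_sym; apply: hpow_le (tail _ _).
  by rewrite subnKC // -ltnS.
Qed.

(** Representatives of a compatible family are partial sums; conversely, lifting the increments to
    the uncompleted tensor power rebuilds such a family. *)
Lemma Ut_nbhsE p z : Ut_nbhs n p z <-> @tens_nbhs n p z.
Proof.
split=> [[s sp <-]|[w [[x0 Fx0 x0E] wS wz]]].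
  (* Starting at index p, the first representative lies in F_p because the class in degree p is
     zero. *)
  pose r k := repr (cproj s (p + k)).
  have rS k : mspan (@Uevn_fil n (p + k)) (r k.+1 - r k).
    by rewrite /r addnS; apply: compl_rep; apply: fil_decS.
  have F0 : mspan (@Uevn_fil n p) (r 0%N).
    rewrite /r addn0 sp -[repr _]subr0; apply/projP; rewrite projK.
    by rewrite proj0.
  have wS k : tens_fil (p + k) (Uevn_incl (r k.+1) - Uevn_incl (r k)).
    by rewrite -inclB; exists (r k.+1 - r k).
  have [l wl] : exists l, hcvg (fun k => Uevn_incl (r k)) l.
    apply: (hcomplete_T n).2 => k; apply: (hpow_le _ (tens_fil_hpow (wS k))); lia.
  exists (fun k => Uevn_incl (r k)); split=> //; first by exists (r 0%N).
  suff -> : natmap s = l by [].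
  apply: (hlimE (@hseparated_T n)); move=> m; have [N NP] := wl m.
  exists (p + N)%N => k le_k; have := NP (k - p)%N; rewrite /r subnKC; last lia.
  by apply; lia.
have /choice[d dP] k : exists d, mspan (@Uevn_fil n (p + k)) d /\ Uevn_incl d = w k.+1 - w k.
  by have [x Fx xE] := wS k; exists x.
pose y k := x0 + \sum_(i < k) d i.
have yS k : mspan (@Uevn_fil n (p + k)) (y k.+1 - y k).
  have -> : y k.+1 = y k + d k by rewrite /y big_ord_recr /= addrA.
  by rewrite [y k + _]addrC addrK; case: (dP k).
have yw k : Uevn_incl (y k) = w k.
  elim: k => [|k IHk]; first by rewrite /y big_ord0 addr0.
  by rewrite /y big_ord_recr /= addrA inclD -/(y k) IHk; have [_ ->] := dP k; rewrite subrKC.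
(* Truncated subtraction puts the class of y 0 = x0 in all degrees up to p; in degree p it is zero
   since x0 lies in F_p. *)
have sP k : exists x, proj (@Uevn_fil n k) x = proj _ (y (k - p)%N) /\
                      proj (@Uevn_fil n k.+1) x = proj _ (y (k.+1 - p)%N).
  exists (y (k.+1 - p)%N); split=> //; apply/projP.
  case: (leqP p k) => le_pk.
    by rewrite subSn // -[X in Uevn_fil X](subnKC le_pk).
  have -> : (k.+1 - p = k - p)%N by lia.
  by rewrite subrr; apply: mspan0.
exists (Compl sP).
  by rewrite /= subnn /y big_ord0 addr0 -(proj0 (@Uevn_fil n p)); apply/projP; rewrite subr0.
apply: (hlimE (@hseparated_T n)) => m; have [N NP] := wz m.
exists (p + N + m)%N => k le_k /=.
apply: (hpow_trans (y := w (k - p)%N)); last by apply: NP; lia.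
rewrite -yw -inclB; apply: (@hpow_le _ _ k); first lia.
apply: tens_fil_hpow; exists (repr (proj (@Uevn_fil n k) (y (k - p)%N)) - y (k - p)%N) => //.
exact: reprPspan.
Qed.

Lemma UtE z : Ut n z <-> @tens_nbhs n 0 z.
Proof.
rewrite -Ut_nbhsE; split=> [[s _ <-]|[s _ <-]]; exists s => //.
rewrite /= -[cproj s 0]projK -(proj0 (@Uevn_fil n 0)); apply/projP; rewrite subr0.
elim/tpow_ind: (repr _) => [|a x y Fy]; first exact: mspan0.
apply: mspan_lin => //; apply: mspan_in.
case: n x {a y s z Fy} => [|m] x //=.
exists x => //; exists ord0; apply: mspan_in; exists (tnth x ord0), (mkUev Uev_1).
by rewrite /= expr0 !mulr1.
Qed.

End TensNbhs.

(** By linearity, continuity at every point reduces to an estimate at 0, and by the diagonal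
    argument to finite sums in the image of F_2p. *)
Lemma induces_continuousP i j (f : T i -> T j) : linear f ->
  (forall p z, tens_fil p.*2 z -> tens_nbhs p (f z)) -> induces_continuous f.
Proof.
move=> lf fI.
have fJ p z : tens_nbhs p.*2 z -> tens_nbhs p (f z).
  move=> [w [w0 wS wz]].
  (* Increments are taken in pairs: the k-th one then lies in degree 2(p + k), and its image in
     degree p + k. *)
  pose b k := f (if k is k'.+1 then w k'.+2.*2 - w k'.+1.*2 else w 2%N).
  have w2 k : tens_fil (p.*2 + k) (w k.+2 - w k).
    rewrite -(subrKA (w k.+1)); apply: tens_filD; apply: tens_fil_le (wS _); lia.
  apply: (@tens_nbhs_hcvg _ p b (f z)) => [k|].
    apply: fI; case: k => [|k].
      rewrite addn0 -(subrK (w 0%N) (w 2%N)); apply: tens_filD => //.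
      by rewrite -[X in tens_fil X]addn0.
    by rewrite [k.+2.*2]doubleS; apply: tens_fil_le (w2 _); lia.
  have wz2 : hcvg (f \o (fun k => w k.*2)) (f z).
    by apply: hcvg_lin => //; apply: hcvg_sub wz _ => k; lia.
  move=> m; have [N NP] := wz2 m; exists N.+1 => -[|k] le_k; first by lia.
  have -> : \sum_(i < k.+1) b i = f (w k.+1.*2).
    elim: k {le_k} => [|k IHk]; first by rewrite big_ord1.
    by rewrite big_ord_recr /= IHk -(linD lf) subrKC.
  by apply: (NP k.+1); lia.
split=> [_ [z /UtE Uz <-]|x _ p]; first exact/UtE/(fJ 0%N).
exists p.*2 => y _ /Ut_nbhsE Jyx; apply/Ut_nbhsE.
by rewrite -(linB lf); apply: fJ.
Qed.

(** * Weights, the adjoint action and the R-matrix *)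

(** The induction step of all the q-binomial formulas below. *)
Lemma two_term_sum (N : lmodType Qh) (f : N -> N) (z : nat -> nat -> N)
    (alpha : nat -> Qh) (gamma : nat -> nat -> Qh) (nu : nat -> Qh) n :
  linear f ->
  (forall i j, f (z i j) = alpha i.+1 *: z i.+1 j + gamma i j.+1 *: z i j.+1) ->
  alpha 0%N = 0 -> (forall i, gamma i 0%N = 0) ->
  (forall i j, alpha i + gamma i j = nu (i + j)%N) ->
  f (\sum_(i < n.+1) z i (n - i)%N) = nu n.+1 *: \sum_(i < n.+2) z i (n.+1 - i)%N.
Proof.
move=> lf fz a0 g0 ag; rewrite (lin_sum lf).
transitivity (\sum_(i < n.+2) alpha i *: z i (n.+1 - i)%N +
              \sum_(i < n.+2) gamma i (n.+1 - i)%N *: z i (n.+1 - i)%N).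
  rewrite [X in _ = X + _]big_ord_recl a0 scale0r add0r.
  rewrite [X in _ = _ + X]big_ord_recr /= subnn g0 scale0r addr0 -big_split.
  by apply: eq_bigr => i _; rewrite fz /bump /= add1n subSS subSn -1?ltnS.
rewrite -big_split scaler_sumr; apply: eq_bigr => i _.
by rewrite /= -scalerDl ag subnKC -1?ltnS.
Qed.

Lemma toUh_rel X : Uh_rel X -> toUh X = 0.
Proof.
move=> relX; rewrite -[RHS](proj0 Uh_closed_ideal); apply/projP; rewrite subr0.
apply: mspan_in => p; exists X; split; last by rewrite subrr; apply: hpow_0.
by apply: mspan_in; exists 1, X, 1; rewrite mul1r mulr1.
Qed.

Lemma toUhN X : toUh (- X) = - toUh X. Proof. exact: projN. Qed.

Lemma toUh_nat n X : toUh (n%:R * X) = fpsC n%:R *: toUh X.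
Proof. by rewrite fpsC_nat mulr_natl -scaler_nat toUhZ. Qed.

Lemma uHE : uH * uE = uE * uH + fpsC 2%:R *: uE.
Proof.
have /eqP : toUh gH * toUh gE - toUh gE * toUh gH - fpsC 2%:R *: toUh gE = 0.
  rewrite -(toUhM gH) -(toUhM gE) -toUh_nat -(toUhN (gE * _)) -(toUhN (_ * gE)).
  by rewrite -(toUhD (gH * gE)) -toUhD (toUh_rel rel_HE).
by rewrite subr_eq0 subr_eq addrC => /eqP.
Qed.

Lemma uHF : uH * uF = uF * uH - fpsC 2%:R *: uF.
Proof.
have /eqP : toUh gH * toUh gF - toUh gF * toUh gH + fpsC 2%:R *: toUh gF = 0.
  rewrite -(toUhM gH) -(toUhM gF) -toUh_nat -(toUhN (gF * _)).
  by rewrite -(toUhD (gH * gF)) -toUhD (toUh_rel rel_HF).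
by rewrite addr_eq0 subr_eq addrC => /eqP.
Qed.

(** The generators are locked: without it, a failing unification between two of these
  closed terms unfolds the free algebra and the canonical representatives. *)
Definition xH : Uh := locked uH.
Definition xE : Uh := locked uE.
Definition xF : Uh := locked uF.
Lemma xH_def : xH = uH. Proof. by rewrite /xH -lock. Qed.
Lemma xE_def : xE = uE. Proof. by rewrite /xE -lock. Qed.
Lemma xF_def : xF = uF. Proof. by rewrite /xF -lock. Qed.

Lemma fpsC_invn n : fpsC (n%:R^-1) = (n%:R : Qh)^-1.
Proof. by rewrite fpsCV fpsC_nat. Qed.

Lemma hexp_Uh r : hexp (M := Uh) *%R 1 ((fpsC r * h) *: xH) = exp_sum r (fun n => xH ^+ n).
Proof.
apply: eq_hsum => n.
have -> : iter n ( *%R ((fpsC r * h) *: xH)) 1 = (fpsC r * h) ^+ n *: xH ^+ n.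
  by rewrite -UhZX; elim: n => [|n IHn] //=; rewrite IHn exprS.
by rewrite scalerA dexpE.
Qed.

(** [K^a] *)
Definition Kx : int -> Uh :=
  locked (fun a => exp_sum (a%:~R / 2%:R) (fun n => xH ^+ n)).
Lemma KxE a : Kx a = exp_sum (a%:~R / 2%:R) (fun n => xH ^+ n).
Proof. by rewrite /Kx -lock. Qed.

Lemma uKE : uK = Kx 1.
Proof. by rewrite KxE -hexp_Uh xH_def mul1r fpsC_invn [_^-1 * h]mulrC. Qed.

Lemma uKinvE : uKinv = Kx (- 1).
Proof.
by rewrite KxE -hexp_Uh xH_def rmorphN1 mulN1r fpsCN fpsC_invn mulNr [_^-1 * h]mulrC.
Qed.

Lemma Kx_geom a : Kx a = exp_sum (2%:R^-1) (fun n => fpsC (a%:~R ^+ n) *: xH ^+ n).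
Proof. by rewrite KxE exp_sum_geom mulrC. Qed.

Lemma KxD a b : Kx (a + b) = Kx a * Kx b.
Proof.
rewrite !Kx_geom (exp_sum_bin _ _ _ mulUh_bilin hcomplete_Uh hcomplete_Uh hcomplete_Uh).
apply: eq_hsum => n; congr (_ *: _).
rewrite rmorphD /= addrC exprDn.
have -> : fpsC (\sum_(i < n.+1) b%:~R ^+ (n - i) * a%:~R ^+ i *+ 'C(n, i)) =
    \sum_(i < n.+1) 'C(n, i)%:R * (fpsC (a%:~R ^+ i) * fpsC (b%:~R ^+ (n - i))) :> Qh.
  elim/big_rec2: _ => [|i x y _ <-]; first exact: fpsC0.
  by rewrite fpsCD -mulr_natl fpsCM fpsC_nat [b%:~R ^+ _ * _]mulrC fpsCM.
rewrite scaler_suml; apply: eq_bigr => i _.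
rewrite -UhZl -UhZr scalerA -exprD subnKC ?scalerA //.
by rewrite -ltnS.
Qed.

Lemma Kx0 : Kx 0 = 1.
Proof.
rewrite KxE mul0r; apply: (hsum_eq hseparated_Uh); move=> p; exists 1%N => -[|n] // _.
rewrite big_ord_recl /= expr0 /dexp expr0 fact0 divr1 fpsC1 mul1r scale1r.
rewrite big1 ?addr0 ?subrr; first exact: hpow_0.
by move=> i _; rewrite /dexp expr0n /= mul0r fpsC0 mul0r scale0r.
Qed.

Lemma KxK a : Kx a * Kx (- a) = 1. Proof. by rewrite -KxD subrr Kx0. Qed.
Lemma KxNK a : Kx (- a) * Kx a = 1. Proof. by rewrite -KxD addNr Kx0. Qed.

Lemma KxX (n : nat) a : Kx a ^+ n = Kx (a * n%:Z).
Proof.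
elim: n => [|n IHn]; first by rewrite mulr0 Kx0.
by rewrite exprS IHn -KxD; congr Kx; lia.
Qed.

(** Degree [k] means [H]-weight [2 k], so that [K] acts by [q ^ k] under conjugation. *)
Definition wt (k : int) (x : Uh) := xH * x = x * xH + fpsC (2%:R * k%:~R) *: x.

Lemma wtM k l x y : wt k x -> wt l y -> wt (k + l) (x * y).
Proof.
rewrite /wt rmorphD mulrDr fpsCD; move: (fpsC _) (fpsC _) => d c wx wy.
rewrite mulrA wx mulrDl -(UhZl c) -mulrA wy mulrDr -(UhZr d) mulrA.
by rewrite [c + d]addrC scalerDl addrA.
Qed.

Lemma wt1 : wt 0 1.
Proof. by rewrite /wt [2%:R * _]mulr0 scale0r addr0 mulr1 mul1r. Qed.

Lemma wtX k x n : wt k x -> wt (k * n%:Z) (x ^+ n).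
Proof.
move=> wx; elim: n => [|n IHn]; first by rewrite mulr0; apply: wt1.
rewrite exprS; have -> : k * n.+1%:Z = k + k * n%:Z by lia.
exact: wtM.
Qed.

Lemma wtZ k c x : wt k x -> wt k (c *: x).
Proof.
by rewrite /wt -UhZr => ->; rewrite scalerDr UhZl !scalerA mulrC.
Qed.

Lemma wt_exp k x n : wt k x -> xH ^+ n * x = x * (xH + fpsC (2%:R * k%:~R) *: (1 : Uh)) ^+ n.
Proof.
move=> wx; elim: n => [|n IHn]; first by rewrite mulr1 mul1r.
rewrite exprS -mulrA IHn mulrA wx exprS mulrA; congr (_ * _).
by rewrite mulrDr -UhZr mulr1.
Qed.

(** Moving x to the left turns H into H + 2k, and exp(a h (H + 2k) / 2) = q^(ak) K^a. *)
Lemma Kx_wt k x a : wt k x -> Kx a * x = qz (a * k) *: (x * Kx a).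
Proof.
move=> wx; rewrite UhZl KxE.
(* With q^(ak) x also written as an exponential series, the right-hand side is the binomial
   expansion of x (H + 2k)^n. *)
have -> : qz (a * k) *: x =
    exp_sum (a%:~R / 2%:R) (fun n => fpsC ((2%:R * k%:~R) ^+ n) *: x).
  have -> : qz (a * k) = expq (a%:~R / 2%:R * (2%:R * k%:~R)).
    by rewrite /qz intrM mulrA divfK.
  exact/esym/(exp_sum_scalar _ _ _ hseparated_Uh).
rewrite (exp_sum_bin _ _ _ mulUh_bilin hcomplete_Uh hcomplete_Uh hcomplete_Uh).
rewrite [LHS](exp_sum_lin _ _ (mulUh_bilin.1 x) hcomplete_Uh hseparated_Uh).
apply: eq_hsum => n; congr (_ *: _) => /=; rewrite (wt_exp _ wx) exprDn_comm; last first.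
  by rewrite /GRing.comm -(UhZl _ 1 xH) -(UhZr _ xH 1) mulr1 mul1r.
rewrite mulr_sumr; apply: eq_bigr => i _.
rewrite UhZX expr1n -fpsCX; move: (fpsC (_ ^+ i)) (xH ^+ (n - i)) => d y.
by rewrite -(UhZr d y 1) mulr1 -(UhZl d x y) mulrnAr -(UhZr d x y) scaler_nat.
Qed.

Lemma wt_E : wt 1 xE.
Proof. by rewrite /wt mulr1 xH_def xE_def uHE. Qed.

Lemma wt_F : wt (- 1) xF.
Proof. by rewrite /wt rmorphN1 mulrN1 fpsCN scaleNr xH_def xF_def uHF. Qed.

Lemma wt_H : wt 0 xH.
Proof. by rewrite /wt [2%:R * _]mulr0 scale0r addr0. Qed.

Lemma wt_Kx a : wt 0 (Kx a).
Proof.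
rewrite /wt [2%:R * _]mulr0 scale0r addr0 KxE.
rewrite (exp_sum_lin _ _ (mulUh_bilin.1 xH) hcomplete_Uh hseparated_Uh).
rewrite (exp_sum_lin _ _ (mulUh_bilin.2 xH) hcomplete_Uh hseparated_Uh).
by apply: eq_hsum => n /=; rewrite -exprS exprSr.
Qed.

Definition Rcoef n : Qh := v ^+ (n * n.-1)./2 * ((v - v^-1) ^+ n / qfact n).

Lemma Rcoef_hpow (M : lmodType Qh) n (x : M) : hpow n (Rcoef n *: x).
Proof.
have [k bE] := vv_h.
by rewrite /Rcoef mulrCA bE expr1 exprMn -!mulrA -scalerA; apply: hpowI.
Qed.

(** The power of v - v^-1 is to be absorbed by E^n, giving e^n, and 1/[n]_q! by F^n; only a power of
    q is left. *)
Lemma RcoefE n : Rcoef n = (v - v^-1) ^+ n * (qz (n * n.-1)./2%:Z / qfactq n).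
Proof. by rewrite -qfact_qfactq /Rcoef; ring. Qed.

Lemma tmulX c x y n :
  iter n (tmul (c *: pure2 x y)) (tone 2) = c ^+ n *: pure2 (x ^+ n) (y ^+ n).
Proof.
elim: n => [|n IHn] /=; first by rewrite scale1r /tone pureE2.
rewrite IHn (linZ ((@tmul_bilin 2).2 _)) (linZ ((@tmul_bilin 2).1 _)) scalerA.
rewrite tmul_pure2 [x ^+ n.+1]exprS [y ^+ n.+1]exprS [c ^+ n.+1]exprSr.
reflexivity.
Qed.

Lemma hexp_T2 r :
  hexp (@tmul 2) (tone 2) ((fpsC r * h) *: pure2 xH xH) =
  exp_sum r (fun n => pure2 (xH ^+ n) (xH ^+ n)).
Proof. by apply: eq_hsum => n; rewrite tmulX scalerA dexpE. Qed.

(** The outer sum is the quasi-R-matrix, the inner one the Cartan factor, expanded in powers of H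
    (x) H. *)
Lemma sweedler_Rmx (N : lmodType Qh) (f : Uh -> Uh -> N) : hcomplete N -> bilinear_for f ->
  sweedler Rmx f = hsum (fun n => Rcoef n *:
    exp_sum 4%:R^-1 (fun m => f (xH ^+ m * xF ^+ n) (xH ^+ m * xE ^+ n))).
Proof.
move=> cN bf; have lg := sweedler_linear cN bf.
rewrite /Rmx -xH_def -xE_def -xF_def.
have -> : h / 4%:R = fpsC 4%:R^-1 * h by rewrite fpsC_invn mulrC.
rewrite hexp_T2.
have lS D : linear (fun X => sweedler (tmul D X) f).
  exact: lin_comp lg ((@tmul_bilin 2).2 D).
rewrite (hsum_lin (lS _) (hcomplete_T 2) cN.1) => [|n]; last exact: Rcoef_hpow.
apply: eq_hsum => n /=; rewrite (linZ (lS _)); congr (_ *: _).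
have lD X : linear (fun D => sweedler (tmul D X) f).
  exact: lin_comp lg ((@tmul_bilin 2).1 X).
rewrite (exp_sum_lin _ _ (lD _) (hcomplete_T 2) cN.1).
by apply: eq_hsum => m /=; rewrite tmul_pure2 sweedler_pure2.
Qed.

Lemma eq_pure2 x x' y y' : x = x' -> y = y' -> pure2 x y = pure2 x' y'.
Proof. by move=> -> ->. Qed.

Lemma eq_scale (M : lmodType Qh) (c c' : Qh) (x x' : M) :
  c = c' -> x = x' -> c *: x = c' *: x'.
Proof. by move=> -> ->. Qed.

Lemma mul_conj (R : pzRingType) (k k' a x : R) : k * k' = 1 ->
  k' * (a * x) * k = k' * a * k * (k' * x * k).
Proof. by move=> kk; rewrite -!mulrA (mulrA k k') kk mul1r. Qed.

Lemma conjKV (R : pzRingType) (k k' x : R) : k * k' = 1 -> k * (k' * x * k) * k' = x.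
Proof. by move=> kk; rewrite -!mulrA kk mulr1 mulrA kk mul1r. Qed.

(** * The Hopf structure and the adjoint action on H, E, F and K^a *)

Section Hopf.
Variable D : Uh_Hopf.

Lemma apd_xH : apd D xH = - xH.
Proof. by rewrite xH_def apd_H. Qed.
Lemma apd_xE : apd D xE = - (Kx (- 1) * xE).
Proof. by rewrite xE_def apd_E uKinvE. Qed.
Lemma apd_xF : apd D xF = - (xF * Kx 1).
Proof. by rewrite xF_def apd_F uKE. Qed.
Lemma cop_xH : cop D xH = pure2 xH 1 + pure2 1 xH.
Proof. by rewrite xH_def cop_H. Qed.
Lemma cop_xE : cop D xE = pure2 xE 1 + pure2 (Kx 1) xE.
Proof. by rewrite xE_def cop_E uKE. Qed.
Lemma cop_xF : cop D xF = pure2 xF (Kx (- 1)) + pure2 1 xF.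
Proof. by rewrite xF_def cop_F uKinvE. Qed.

Local Notation S := (apd D).
Let lc : linear (cop D) := @cop_linear D.
Let lS : linear S := @apd_linear D.

Let adB y x1 x2 : Uh := x1 * y * S x2.

Let adB_bilin y : bilinear_for (adB y).
Proof.
split=> [x2|x1] a u w; rewrite /adB; first by rewrite !mulrDl -!UhZl.
by rewrite lS mulrDr -UhZr.
Qed.

Lemma ad_bilin : bilinear_for (ad D).
Proof.
split=> [y|x].
  exact: lin_comp (sweedler_linear hcomplete_Uh (adB_bilin y)) lc.
apply: (sweedler_linear_param _ hcomplete_Uh adB_bilin) => x1 x2 a u w.
by rewrite /adB mulrDr mulrDl -UhZr -UhZl.
Qed.

Let adE y x : ad D x y = sweedler (cop D x) (adB y). Proof. by []. Qed.

Lemma ad_1 y : ad D 1 y = y.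
Proof.
rewrite adE cop_1 /tone pureE2 (sweedler_pure2 hcomplete_Uh (adB_bilin y)).
by rewrite /adB apd_1 mulr1 -[tnth _ _]/1 mul1r.
Qed.

Let swP y x1 x2 : sweedler (pure2 x1 x2) (adB y) = x1 * y * S x2.
Proof. exact: (sweedler_pure2 hcomplete_Uh (adB_bilin y)). Qed.

Lemma ad_mul a b y : ad D (a * b) y = ad D a (ad D b y).
Proof.
have lswe z := sweedler_linear hcomplete_Uh (adB_bilin z).
have lswp X : linear (fun z => sweedler X (adB z)).
  apply: (sweedler_linear_param _ hcomplete_Uh adB_bilin) => x1 x2 c u w.
  by rewrite /adB mulrDr mulrDl -UhZr -UhZl.
(* With both coproducts replaced by arbitrary X and Y, the identity is linear in each and is checked
   on pure tensors. *)
rewrite !adE cop_mul; move: (cop D a) (cop D b) => X Y.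
have lY := lin_comp (lswe y) ((@tmul_bilin 2).1 Y).
apply: (lin_ext2 hseparated_Uh lY (lswe _)) => x1 x2 /=.
have lX := lin_comp (lswe y) ((@tmul_bilin 2).2 (pure2 x1 x2)).
have lX' : linear (fun Y => sweedler (pure2 x1 x2) (adB (sweedler Y (adB y)))).
  exact: lin_comp (lswp _) (lswe y).
apply: (lin_ext2 hseparated_Uh lX lX') => y1 y2 /=.
rewrite tmul_pure2; apply: etrans (swP y _ _) _; apply: etrans _ (esym (swP _ _ _)).
by rewrite swP apd_mul !mulrA.
Qed.

Let swD y X Y : sweedler (X + Y) (adB y) = sweedler X (adB y) + sweedler Y (adB y).
Proof. exact: linD (sweedler_linear hcomplete_Uh (adB_bilin y)) _ _. Qed.

Lemma apd_xHX n : S (xH ^+ n) = fpsC ((-1) ^+ n) *: xH ^+ n.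
Proof.
elim: n => [|n IHn]; first by rewrite apd_1 scale1r.
rewrite [in LHS]exprSr apd_mul IHn apd_xH mulNr -(UhZr _ xH) -exprS.
by rewrite [(-1) ^+ n.+1]exprS mulN1r fpsCN scaleNr.
Qed.

Lemma apd_Kx a : S (Kx a) = Kx (- a).
Proof.
rewrite KxE (exp_sum_lin _ _ lS hcomplete_Uh hseparated_Uh).
transitivity (exp_sum (a%:~R / 2%:R) (fun n => fpsC ((-1) ^+ n) *: xH ^+ n)).
  by apply: eq_hsum => n /=; rewrite apd_xHX.
by rewrite exp_sum_geom KxE rmorphN mulNr mulrN1.
Qed.

Lemma cop_1E : cop D 1 = pure2 1 1.
Proof. by rewrite cop_1 /tone pureE2. Qed.

Lemma pure2D_mul x1 y1 x2 y2 X : tmul (pure2 x1 y1 + pure2 x2 y2) X =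
  tmul (pure2 x1 y1) X + tmul (pure2 x2 y2) X.
Proof. exact: linD ((@tmul_bilin 2).1 X) _ _. Qed.

Let fi n : Qh := fpsC (n`!%:R^-1).

Let fiS n : n.+1%:R * fi n.+1 = fi n.
Proof.
rewrite -fpsC_nat -fpsCM factS natrM invfM mulrA divff ?mul1r //.
by rewrite pnatr_eq0.
Qed.

Lemma tmul_cop_xH i j : tmul (cop D xH) (pure2 (xH ^+ i) (xH ^+ j)) =
  pure2 (xH ^+ i.+1) (xH ^+ j) + pure2 (xH ^+ i) (xH ^+ j.+1).
Proof.
rewrite cop_xH pure2D_mul; congr (_ + _); apply: etrans (tmul_pure2 _ _ _ _) _.
  by apply: eq_pure2; [rewrite exprS | apply: mul1r].
by apply: eq_pure2; [apply: mul1r | rewrite exprS].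
Qed.

Lemma cop_xHX n : cop D (xH ^+ n) =
  \sum_(i < n.+1) 'C(n, i)%:R *: pure2 (xH ^+ i) (xH ^+ (n - i)).
Proof.
(* With divided powers H^i / i!, the coproduct of H^n / n! has all coefficients equal to 1, which is
   the form required by [two_term_sum]. *)
pose z i j := (fi i * fi j) *: pure2 (xH ^+ i) (xH ^+ j).
have ltm := (@tmul_bilin 2).2 (cop D xH).
have step m : tmul (cop D xH) (\sum_(i < m.+1) z i (m - i)%N) =
    m.+1%:R *: \sum_(i < m.+2) z i (m.+1 - i)%N.
  apply: (@two_term_sum _ _ z (fun i => i%:R) (fun _ j => j%:R) (fun k => k%:R)) => //.
    move=> i j; rewrite /z (linZ ltm) tmul_cop_xH scalerDr !scalerA.
    by rewrite mulrA fiS mulrCA fiS.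
  by move=> i j; rewrite natrD.
have copE : cop D (xH ^+ n) = n`!%:R *: \sum_(i < n.+1) z i (n - i)%N.
  elim: n => [|m IHm].
    rewrite cop_1E fact0 scale1r big_ord1 /z /fi fact0 invr1 fpsC1 mul1r scale1r.
    by [].
  rewrite exprS cop_mul IHm (linZ ltm) step scalerA -natrM mulnC.
  by rewrite factS.
apply: etrans copE _; rewrite scaler_sumr; apply: eq_bigr => i _.
apply: etrans (scalerA _ _ _) _; apply: eq_scale => //.
have le_in : (i <= n)%N by rewrite -ltnS.
rewrite -fpsC_nat -[RHS]fpsC_nat /fi -!fpsCM -(bin_fact le_in) !natrM; congr fpsC.
have := factr_neq0 i; have := factr_neq0 (n - i).
by move=> *; field; apply/andP.
Qed.

Lemma cop_Kx a : cop D (Kx a) = pure2 (Kx a) (Kx a).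
Proof.
rewrite KxE; apply: etrans (exp_sum_lin _ _ lc hcomplete_Uh (@hseparated_T 2)) _.
apply: etrans _ (esym (exp_sum_bin _ _ _ pure2_bilin hcomplete_Uh hcomplete_Uh (hcomplete_T 2))).
by apply: eq_hsum => n /=; rewrite cop_xHX.
Qed.

Lemma ad_cop2 x y a b c d : cop D x = pure2 a b + pure2 c d ->
  ad D x y = a * y * S b + c * y * S d.
Proof.
move=> e; rewrite adE e; apply: etrans (swD _ _ _) _.
by apply: (f_equal2 +%R); apply: swP.
Qed.

Lemma ad_xH y : ad D xH y = xH * y - y * xH.
Proof.
by rewrite (ad_cop2 y cop_xH) apd_1 apd_xH (mulr1 (xH * y)) (mul1r y) mulrN.
Qed.

Lemma ad_xE y : ad D xE y = xE * y - Kx 1 * y * Kx (- 1) * xE.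
Proof.
by rewrite (ad_cop2 y cop_xE) apd_1 apd_xE (mulr1 (xE * y)) mulrN mulrA.
Qed.

Lemma ad_xF y : ad D xF y = (xF * y - y * xF) * Kx 1.
Proof.
by rewrite (ad_cop2 y cop_xF) apd_xF apd_Kx opprK (mul1r y) mulrN mulrBl mulrA.
Qed.

Lemma ad_Kx a y : ad D (Kx a) y = Kx a * y * Kx (- a).
Proof. by rewrite adE cop_Kx swP apd_Kx. Qed.

Lemma Kx_conj k a y : wt k y -> Kx a * y * Kx (- a) = qz (a * k) *: y.
Proof. by move=> wy; rewrite (Kx_wt _ wy) -UhZl -mulrA KxK mulr1. Qed.

Lemma ad_xH_wt k y : wt k y -> ad D xH y = fpsC (2%:R * k%:~R) *: y.
Proof. by rewrite ad_xH => ->; rewrite addrC addKr. Qed.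

Lemma ad_xHX_wt k y m : wt k y -> ad D (xH ^+ m) y = fpsC ((2%:R * k%:~R) ^+ m) *: y.
Proof.
move=> wy; elim: m => [|m IHm]; first by rewrite ad_1 scale1r.
rewrite exprS ad_mul IHm (linZ (ad_bilin.2 _)) (ad_xH_wt wy) scalerA.
by apply: eq_scale => //; rewrite exprSr -fpsCM.
Qed.

Lemma ad_xE_wt k y : wt k y -> ad D xE y = xE * y - qz k *: (y * xE).
Proof. by move=> wy; rewrite ad_xE (Kx_conj _ wy) mul1r UhZl. Qed.

Lemma wtD k x y : wt k x -> wt k y -> wt k (x + y).
Proof. by rewrite /wt => wx wy; rewrite mulrDr mulrDl wx wy scalerDr addrACA. Qed.

Lemma wtN k x : wt k x -> wt k (- x).
Proof. by rewrite -scaleN1r; apply: wtZ. Qed.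

Lemma wt_eq k l x : wt k x -> k = l -> wt l x.
Proof. by move=> wx <-. Qed.

Lemma wt_ad_xE k y : wt k y -> wt (k + 1) (ad D xE y).
Proof.
move=> wy; rewrite (ad_xE_wt wy); apply: wtD.
  by apply: wt_eq (wtM wt_E wy) _; rewrite addrC.
by apply/wtN/wtZ/wtM => //; apply: wt_E.
Qed.

Lemma wt_ad_xF k y : wt k y -> wt (k - 1) (ad D xF y).
Proof.
move=> wy; rewrite ad_xF -[k - 1]addr0; apply: wtM (wt_Kx _); apply: wtD.
  by apply: wt_eq (wtM wt_F wy) _; rewrite addrC.
by apply/wtN/wtM => //; apply: wt_F.
Qed.

Lemma wt_ad_xEX k n y : wt k y -> wt (k + n%:Z) (ad D (xE ^+ n) y).
Proof.
move=> wy; elim: n => [|n IHn]; first by rewrite ad_1 addr0.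
by rewrite exprS ad_mul; apply: wt_eq (wt_ad_xE IHn) _; lia.
Qed.

Lemma wt_ad_xFX k n y : wt k y -> wt (k - n%:Z) (ad D (xF ^+ n) y).
Proof.
move=> wy; elim: n => [|n IHn]; first by rewrite ad_1 subr0.
by rewrite exprS ad_mul; apply: wt_eq (wt_ad_xF IHn) _; lia.
Qed.

(** Both sides are algebra endomorphisms, so they are compared on H, E and F. *)
Lemma apd_apd x : S (S x) = Kx (- 1) * x * Kx 1.
Proof.
move: x; apply: (Uh_ext hseparated_Uh (lin_comp lS lS)).
- by move=> a x y /=; rewrite mulrDr mulrDl -(UhZr a) -(UhZl a).
- by rewrite /= !apd_1 mulr1 KxNK.
move=> x /= IHx.
have conjM a : Kx (- 1) * (a * x) * Kx 1 = Kx (- 1) * a * Kx 1 * (Kx (- 1) * x * Kx 1).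
  exact: mul_conj (KxK 1).
have key a : S (S a) = Kx (- 1) * a * Kx 1 -> S (S (a * x)) = Kx (- 1) * (a * x) * Kx 1.
  by move=> ea; rewrite apd_mul apd_mul ea IHx (conjM a).
split; apply: key.
- rewrite -xH_def apd_xH (linN lS) apd_xH opprK (Kx_wt _ wt_H) mulr0 qz0 scale1r.
  by rewrite -mulrA (KxNK 1) mulr1.
- rewrite -xE_def apd_xE (linN lS) apd_mul apd_xE (apd_Kx (- 1)) opprK mulNr.
  by rewrite opprK.
- by rewrite -xF_def apd_xF (linN lS) apd_mul apd_xF (apd_Kx 1) mulrN opprK mulrA.
Qed.

(** The square of S is conjugation by K^-1, so S is bijective and its inverse is S composed with
    conjugation by K. *)
Lemma apd_invE x : apd_inv D x = S (Kx 1 * x * Kx (- 1)).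
Proof.
have injS y z : S y = S z -> y = z.
  move=> eSyz; have := congr1 S eSyz; rewrite (apd_apd y) (apd_apd z) => e.
  by rewrite -[y](conjKV y (KxK 1)) e (conjKV z (KxK 1)).
have ex : S (S (Kx 1 * x * Kx (- 1))) = x.
  by apply: etrans (apd_apd _) _; apply: conjKV _ (KxNK 1).
apply: injS; rewrite ex.
exact: (xgetPex 0 (P := [set y | S y = x]) (ex_intro _ _ ex)).
Qed.

Lemma apd_inv_wt k x : wt k x -> apd_inv D x = qz k *: S x.
Proof. by move=> wx; rewrite apd_invE (Kx_conj _ wx) mul1r (linZ lS). Qed.

Lemma apd_inv_linear : linear (apd_inv D).
Proof.
move=> a x y; rewrite !apd_invE -lS; congr (apd D _).
by rewrite mulrDr mulrDl -(UhZr a) -(UhZl a).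
Qed.

End Hopf.

(** * Monomials of the integral form *)

Definition xe : Uh := locked ue.
Definition Fd : nat -> Uh := locked Fdiv.
(** This is F~(1); multiplication by it passes from F~(n) to F~(n+1) up to the unit [nu n.+1]. *)
Definition Xf : Uh := locked (xF * Kx 1).

Lemma xe_ue : xe = ue. Proof. by rewrite /xe -lock. Qed.
Lemma xe_def : xe = (v - v^-1) *: xE. Proof. by rewrite xe_ue xE_def. Qed.
Lemma Xf_def : Xf = xF * Kx 1. Proof. by rewrite /Xf -lock. Qed.
Lemma Fd_Fdiv n : Fd n = Fdiv n. Proof. by rewrite /Fd -lock. Qed.
Lemma Fd_def n : Fd n = (qfactq n)^-1 *: (xF ^+ n * Kx n%:Z).
Proof. by rewrite Fd_Fdiv /Fdiv -xF_def uKE KxX mul1r. Qed.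

Lemma xeX n : xe ^+ n = (v - v^-1) ^+ n *: xE ^+ n.
Proof. by rewrite xe_def; apply: UhZX. Qed.

Lemma wt_e : wt 1 xe. Proof. by rewrite xe_def; apply/wtZ/wt_E. Qed.
Lemma wt_eX n : wt n%:Z (xe ^+ n).
Proof. by apply: wt_eq (wtX _ wt_e) _; rewrite mul1r. Qed.
Lemma wt_Xf : wt (- 1) Xf.
Proof. by rewrite Xf_def -[- 1]addr0; apply: wtM (wt_Kx _); apply: wt_F. Qed.
Lemma wt_FX n : wt (- n%:Z) (xF ^+ n).
Proof. by apply: wt_eq (wtX _ wt_F) _; rewrite mulN1r. Qed.
Lemma wt_Fd n : wt (- n%:Z) (Fd n).
Proof.
by rewrite Fd_def; apply: wtZ; rewrite -[- n%:Z]addr0; apply: wtM (wt_Kx _); apply: wt_FX.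
Qed.

Lemma mul4_swap (f k f' k' : Uh) c : k * f' = c *: (f' * k) ->
  (f * k) * (f' * k') = c *: ((f * f') * (k * k')).
Proof. by move=> e; rewrite mulrA -(mulrA f k) e -(UhZr c f) -(UhZl c) !mulrA. Qed.

(** [nu n] is the q-integer in [q^-1], the factor in [(F K) F~(n-1) = nu n F~(n)]. *)
Definition nu n : Qh := qz (1 - n%:Z) * qintq n.

Lemma nu_unit n : nu n.+1 \is a GRing.unit.
Proof. by rewrite unitrM qintq_unit // /qz expq_unit. Qed.

Lemma nu0 : nu 0 = 0.
Proof. by rewrite /nu qintqE big_ord0 mulr0. Qed.

Lemma nuD i j : nu i + qz (- i%:Z) * nu j = nu (i + j).
Proof.
have := qintq_split (leq_addl i j); rewrite addnK qX_qz /nu => <-.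
rewrite mulrDr addrC !mulrA -!qzD; congr (qz _ * _ + qz _ * _); lia.
Qed.

Lemma qfactqV n : (qfactq n)^-1 = qintq n.+1 * (qfactq n.+1)^-1.
Proof.
rewrite qfactqS invrM ?qfactq_unit ?qintq_unit // mulrA divrr ?qintq_unit //.
by rewrite mul1r.
Qed.

Lemma Xf_Fd n : Xf * Fd n = nu n.+1 *: Fd n.+1.
Proof.
rewrite Xf_def !Fd_def -(UhZr _ (xF * Kx 1)).
rewrite (mul4_swap xF (Kx n%:Z) (Kx_wt 1 (wt_FX n))) -KxD -exprS !scalerA.
apply: eq_scale; last by congr (_ * Kx _); lia.
rewrite qfactqV /nu; have -> : 1 - n.+1%:Z = 1 * - n%:Z by lia.
by ring.
Qed.

Lemma Fd_Xf n : Fd n * Xf = nu n.+1 *: Fd n.+1.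
Proof.
rewrite Xf_def !Fd_def -(UhZl _ (xF ^+ n * Kx n%:Z)).
rewrite (mul4_swap (xF ^+ n) (Kx 1) (Kx_wt n%:Z wt_F)) -KxD -exprSr !scalerA.
apply: eq_scale; last by congr (_ * Kx _); lia.
rewrite qfactqV /nu; have -> : 1 - n.+1%:Z = n%:Z * - 1 by lia.
by ring.
Qed.

Lemma Fd0 : Fd 0 = 1.
Proof. by rewrite Fd_def Kx0 qfactq0 invr1 scale1r mulr1. Qed.

Lemma xFX n : xF ^+ n = qfactq n *: (Fd n * Kx (- n%:Z)).
Proof.
rewrite Fd_def -(UhZl _ (xF ^+ n * _)) scalerA divrr ?qfactq_unit // scale1r.
by rewrite -mulrA KxK mulr1.
Qed.

Lemma scalerI_unit (M : lmodType Qh) (c : Qh) (x y : M) : c \is a GRing.unit ->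
  c *: x = c *: y -> x = y.
Proof. by move=> cu e; rewrite -[x]scale1r -(mulVr cu) -scalerA e scalerA mulVr // scale1r. Qed.

Lemma wt_KxV k x a : wt k x -> x * Kx a = qz (- (a * k)) *: (Kx a * x).
Proof. by move=> wx; rewrite (Kx_wt a wx) scalerA mulrC qzK scale1r. Qed.

(** * Action, coproduct and antipode on e^n and F~(n) *)

Section HopfMon.
Variable D : Uh_Hopf.
Local Notation S := (apd D).
Let lS : linear S := @apd_linear D.
Let lc : linear (cop D) := @cop_linear D.

Lemma ad_e k y : wt k y -> ad D xe y = xe * y - qz k *: (y * xe).
Proof.
move=> wy; rewrite xe_def (linZ ((ad_bilin D).1 y)) (ad_xE_wt D wy) scalerBr.
rewrite (UhZl _ xE y) scalerA [_ * qz k]mulrC -scalerA; congr (_ - _ *: _).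
exact: UhZr.
Qed.

(** The factor K compensates the K on the right of the action of F, so that F K acts by the same
    skew commutator as e. *)
Lemma ad_Xf k y : wt k y -> ad D Xf y = Xf * y - qz k *: (y * Xf).
Proof.
move=> wy; rewrite Xf_def ad_mul ad_Kx (Kx_conj 1 wy) mul1r (linZ ((ad_bilin D).2 _)).
rewrite ad_xF mulrBl scalerBr; congr (_ - _ *: _); last by rewrite -mulrA.
by rewrite -[RHS]mulrA (Kx_wt 1 wy) mul1r -(UhZr _ xF) mulrA.
Qed.

Lemma apd_e : S xe = - (Kx (- 1) * xe).
Proof. by rewrite xe_def (linZ lS) apd_xE scalerN (UhZr _ (Kx (- 1)) xE). Qed.

Lemma apd_Xf : S Xf = - (Kx (- 1) * Xf).
Proof. by rewrite Xf_def apd_mul apd_xF apd_Kx mulrN. Qed.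

Lemma cop_e : cop D xe = pure2 xe 1 + pure2 (Kx 1) xe.
Proof.
rewrite xe_def (linZ lc) cop_xE scalerDr (linZ (pure2_bilin.1 _)).
by rewrite (linZ (pure2_bilin.2 _)).
Qed.

Lemma cop_Xf : cop D Xf = pure2 Xf 1 + pure2 (Kx 1) Xf.
Proof.
rewrite Xf_def cop_mul cop_xF cop_Kx pure2D_mul.
apply: (f_equal2 +%R); apply: etrans (tmul_pure2 _ _ _ _) _; apply: eq_pure2 => //.
  exact: KxNK.
exact: mul1r.
Qed.

Lemma tmul_two x x' y x2 y2 : cop D x = pure2 x 1 + pure2 x' y ->
  tmul (cop D x) (pure2 x2 y2) = pure2 (x * x2) y2 + pure2 (x' * x2) (y * y2).
Proof.
move=> ->; rewrite pure2D_mul; apply: (f_equal2 +%R).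
  by apply: etrans (tmul_pure2 _ _ _ _) _; apply: eq_pure2 => //; apply: mul1r.
exact: tmul_pure2.
Qed.

(** F K has the two-term coproduct F K (x) 1 + K (x) F K with q-commuting terms; the divided powers
    absorb the q-binomial coefficients. *)
Lemma cop_Fd n :
  cop D (Fd n) = \sum_(i < n.+1) pure2 (Fd i * Kx (n - i)%N%:Z) (Fd (n - i)).
Proof.
pose z i j := pure2 (Fd i * Kx j%:Z) (Fd j).
have ltm := (@tmul_bilin 2).2 (cop D Xf).
have step m : tmul (cop D Xf) (\sum_(i < m.+1) z i (m - i)%N) =
    nu m.+1 *: \sum_(i < m.+2) z i (m.+1 - i)%N.
  apply: (@two_term_sum _ _ z nu (fun i j => qz (- i%:Z) * nu j) nu) => //.
  - move=> i j; rewrite /z (tmul_two _ _ cop_Xf); apply: (f_equal2 +%R).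
      by rewrite mulrA Xf_Fd -(UhZl _ (Fd i.+1)) (linZ (pure2_bilin.1 _)).
    rewrite Xf_Fd (linZ (pure2_bilin.2 _)) mulrA (Kx_wt 1 (wt_Fd i)) mul1r.
    rewrite -(UhZl _ (Fd i * Kx 1)) (linZ (pure2_bilin.1 _)) scalerA mulrC -mulrA -KxD.
    by apply: eq_scale => //; apply: eq_pure2 => //; congr (_ * Kx _); lia.
  - exact: nu0.
  - by move=> i; rewrite nu0 mulr0.
  - exact: nuD.
elim: n => [|n IHn].
  by rewrite big_ord1 subnn Fd0 Kx0 mulr1 cop_1E.
apply: (scalerI_unit (nu_unit n)); rewrite -(linZ lc) -Xf_Fd cop_mul IHn.
exact: step.
Qed.

(** The product of the factors -q^(k-i), i < j, picked up when j copies of F K are multiplied on the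
    right of an element of degree k. *)
Definition cAd (k : int) j : Qh := (-1) ^+ j * qz (k * j%:Z - 'C(j, 2)%:Z).

Lemma ad_Fd k x n : wt k x ->
  ad D (Fd n) x = \sum_(i < n.+1) cAd k (n - i)%N *: (Fd i * x * Fd (n - i)).
Proof.
move=> wx; pose z i j := cAd k j *: (Fd i * x * Fd j).
have lad := (ad_bilin D).2 Xf.
have step m : ad D Xf (\sum_(i < m.+1) z i (m - i)%N) =
    nu m.+1 *: \sum_(i < m.+2) z i (m.+1 - i)%N.
  apply: (@two_term_sum _ _ z nu (fun i j => qz (- i%:Z) * nu j) nu) => //.
  - move=> i j; rewrite /z (linZ lad) (ad_Xf (wtM (wtM (wt_Fd i) wx) (wt_Fd j))).
    rewrite scalerBr; apply: (f_equal2 +%R).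
      rewrite !mulrA Xf_Fd -(UhZl _ (Fd i.+1)) -(UhZl _ (Fd i.+1 * x)) !scalerA.
      by rewrite mulrC.
    rewrite -(mulrA (Fd i * x)) Fd_Xf -(UhZr _ (Fd i * x)) -scalerN -scaleNr !scalerA.
    apply: eq_scale => //; rewrite /cAd exprS binS bin1.
    have -> : k * j.+1%:Z - ('C(j, 2) + j)%:Z = (k * j%:Z - 'C(j, 2)%:Z) + (k - j%:Z) by lia.
    have -> : - i%:Z + k - j%:Z = - i%:Z + (k - j%:Z) by lia.
    by rewrite !qzD; ring.
  - exact: nu0.
  - by move=> i; rewrite nu0 mulr0.
  - exact: nuD.
elim: n => [|n IHn].
  have c0 : cAd k 0 = 1 by rewrite /cAd expr0 mul1r mulr0 subr0 qz0.
  by rewrite big_ord1 subnn c0 Fd0 ad_1 scale1r mul1r mulr1.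
apply: (scalerI_unit (nu_unit n)).
rewrite -(linZ ((ad_bilin D).1 x)) -Xf_Fd ad_mul IHn.
exact: step.
Qed.

Lemma wt_apd k y : wt k y -> wt k (S y).
Proof.
rewrite /wt => /(congr1 S); rewrite apd_mul (linD lS) apd_mul (linZ lS) apd_xH.
move: (fpsC _) => c; rewrite mulrN mulNr => /eqP.
by rewrite eqr_oppLR opprD opprK -subr_eq0 opprB addrA subr_eq0 addrC => /eqP.
Qed.

(** [twS k y = K^k S(y)] preserves the integral form, unlike [S] itself. *)
Definition twS (k : int) y := Kx k * S y.

Lemma twSM k l x y : wt k x -> wt l y ->
  twS (k + l) (x * y) = qz (k * l) *: (twS l y * twS k x).
Proof.
move=> wx wy; rewrite /twS apd_mul.
rewrite (mul4_swap (Kx l) (S x) (wt_KxV k (wt_apd wy))) scalerA qzK scale1r.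
by rewrite -(KxD l k) [l + k]addrC.
Qed.

Lemma twS_Kx a : twS 0 (Kx a) = Kx (- a).
Proof. by rewrite /twS Kx0 mul1r apd_Kx. Qed.

Lemma twS_e : twS 1 xe = - xe.
Proof. by rewrite /twS apd_e mulrN mulrA KxK mul1r. Qed.

Lemma twS_Xf : twS (- 1) Xf = - (qz 2 *: (Xf * Kx (- 2))).
Proof.
by rewrite /twS apd_Xf mulrN mulrA -KxD (Kx_wt _ wt_Xf).
Qed.

Lemma twS_eX n : exists2 c, is_Zq c & twS n%:Z (xe ^+ n) = c *: xe ^+ n.
Proof.
elim: n => [|n [c Zc IHn]].
  by exists 1; [apply: Zq_1 | rewrite /twS Kx0 apd_1 mulr1 scale1r].
exists (qz (1 * n%:Z) * - c); first by apply: Zq_mul (qz_Zq _) (ZqN Zc).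
have -> : n.+1%:Z = 1 + n%:Z by lia.
rewrite exprS (twSM wt_e (wt_eX n)) IHn twS_e (mulrN (c *: xe ^+ n)) -(UhZl c) -scaleNr scalerA.
by rewrite -exprSr exprS.
Qed.

Lemma twS_Fd n : exists2 c, is_Zq c & twS (- n%:Z) (Fd n) = c *: (Fd n * Kx (- (n%:Z *+ 2))).
Proof.
elim: n => [|n [c Zc IHn]].
  by exists 1; [apply: Zq_1 | rewrite /twS Fd0 Kx0 apd_1 mulr1 scale1r].
exists (qz n%:Z * (- qz 2 * c * qz (2 * n%:Z))).
  by do !apply: Zq_mul => //; rewrite ?(qz_Zq _) //; try exact: qz_Zq; apply/ZqN/qz_Zq.
apply: (scalerI_unit (nu_unit n)).
have -> : nu n.+1 *: twS (- n.+1%:Z) (Fd n.+1) = twS (- 1 + - n%:Z) (Xf * Fd n).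
  have -> : - n.+1%:Z = - 1 + - n%:Z by lia.
  by rewrite Xf_Fd /twS (linZ lS) (UhZr _ (Kx _)).
rewrite (twSM wt_Xf (wt_Fd n)) IHn twS_Xf (mulrN (c *: (Fd n * _))) -(UhZl c) -(UhZr _ (Fd n * _)).
rewrite (mul4_swap (Fd n) (Kx (- 2)) (Kx_wt (- (n%:Z *+ 2)) wt_Xf)) Fd_Xf.
rewrite -KxD -(UhZl _ (Fd n.+1)) -!scaleNr !scalerA.
apply: eq_scale; last by congr (_ * Kx _); lia.
have -> : - 1 * - n%:Z = n%:Z by lia.
have -> : - (n%:Z *+ 2) * -1 = 2 * n%:Z by lia.
by ring.
Qed.

End HopfMon.

(** The monomials spanning U^ev, with their degree: the twisted formulas hold for homogeneous
    elements only. *)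
Inductive hmon : int -> Uh -> Prop :=
| hmon1 : hmon 0 1
| hmonK : hmon 0 (Kx 2)
| hmonKV : hmon 0 (Kx (- 2))
| hmon_e : hmon 1 xe
| hmon_F n : hmon (- n%:Z) (Fd n)
| hmonM k l x y : hmon k x -> hmon l y -> hmon (k + l) (x * y).

Lemma hmon_eq k l x : hmon k x -> k = l -> hmon l x.
Proof. by move=> hx <-. Qed.

Lemma hmon_wt k x : hmon k x -> wt k x.
Proof.
elim=> [|||||{}k l {}x y _ wx _ wy]; [exact: wt1 | exact: wt_Kx | exact: wt_Kx |
  exact: wt_e | exact: wt_Fd | exact: wtM].
Qed.

Lemma hmonX n x : hmon 0 x -> hmon 0 (x ^+ n).
Proof.
move=> hx; elim: n => [|n IHn]; first exact: hmon1.
by rewrite exprS; apply: hmon_eq (hmonM hx IHn) _.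
Qed.

Lemma hmon_eX n : hmon n%:Z (xe ^+ n).
Proof.
elim: n => [|n IHn]; first exact: hmon1.
by rewrite exprS; apply: hmon_eq (hmonM hmon_e IHn) _; lia.
Qed.

Lemma hmon_K (n : nat) : hmon 0 (Kx (2 * n%:Z)).
Proof. by rewrite -KxX; apply/hmonX/hmonK. Qed.

Lemma hmon_KV (n : nat) : hmon 0 (Kx (- (2 * n%:Z))).
Proof. by rewrite -mulNr -KxX; apply/hmonX/hmonKV. Qed.

Lemma uK2E : uK ^+ 2 = Kx 2. Proof. by rewrite uKE KxX. Qed.
Lemma uKinv2E : uKinv ^+ 2 = Kx (- 2). Proof. by rewrite uKinvE KxX. Qed.

Lemma hmon_Uev k x : hmon k x -> is_Uev x.
Proof.
elim=> [||||n|{}k l {}x y _ ux _ uy]; rewrite -?uK2E -?uKinv2E ?xe_ue.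
- exact: Uev_1.
- exact: Uev_K2.
- exact: Uev_K2inv.
- exact: Uev_e.
- by case: n => [|n]; [rewrite Fd0; apply: Uev_1 | rewrite Fd_Fdiv; apply: Uev_F].
- exact: Uev_mul.
Qed.

(** Homogeneous monomials that contain e^p explicitly; they span F_p over Z[q,q^-1]. *)
Definition mon p k x := exists a b ka kb,
  [/\ hmon ka a, hmon kb b, k = ka + p%:Z + kb & x = a * xe ^+ p * b].

Notation hmon_span p k := (Zspan (mon p k)).
Notation mon_span p := (Zspan [set x | exists k, mon p k x]).

Lemma hmon_mon0 k x : hmon k x -> mon 0 k x.
Proof.
move=> hx; exists x, 1, k, 0; split=> //; [exact: hmon1 | lia | by rewrite expr0 !mulr1].
Qed.

Lemma mon_hmon p k x : mon p k x -> hmon k x.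
Proof.
move=> [a [b [ka [kb [ha hb -> ->]]]]].
exact: hmonM (hmonM ha (hmon_eX p)) hb.
Qed.

Lemma mon_wt p k x : mon p k x -> wt k x.
Proof. by move/mon_hmon/hmon_wt. Qed.

Lemma monMl p k l a x : hmon k a -> mon p l x -> mon p (k + l) (a * x).
Proof.
move=> ha [a' [b [ka [kb [ha' hb -> ->]]]]]; exists (a * a'), b, (k + ka), kb.
by split; rewrite ?mulrA //; [apply: hmonM | lia].
Qed.

Lemma monMr p k l b x : mon p k x -> hmon l b -> mon p (k + l) (x * b).
Proof.
move=> [a [b' [ka [kb [ha hb' -> ->]]]]] hb; exists a, (b' * b), ka, (kb + l).
by split; rewrite ?mulrA //; [apply: hmonM | lia].
Qed.

Lemma mon_eX n : mon n n%:Z (xe ^+ n).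
Proof.
by exists 1, 1, 0, 0; split; [exact: hmon1 | exact: hmon1 | lia | rewrite mul1r mulr1].
Qed.

Lemma mon_le p q k x : (p <= q)%N -> mon q k x -> mon p k x.
Proof.
move=> /subnKC <- [a [b [ka [kb [ha hb -> ->]]]]].
exists a, (xe ^+ (q - p) * b), ka, ((q - p)%N%:Z + kb).
by split; rewrite ?exprD ?mulrA //; [apply: hmonM => //; apply: hmon_eX | lia].
Qed.

Lemma mon_eq p k l x : mon p k x -> k = l -> mon p l x.
Proof. by move=> hx <-. Qed.

Lemma hmon_span_sub p k x : hmon_span p k x -> mon_span p x.
Proof. by apply: Zspan_sub => y my; apply: Zspan_in; exists k. Qed.

(** * Integrality of the braided structure *)

Lemma Uev_mon_span x : is_Uev x -> mon_span 0 x.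
Proof.
have mon_spanI k y : hmon k y -> mon_span 0 y.
  by move=> hy; apply: Zspan_in; exists k; apply: hmon_mon0.
elim=> [|||n _||{}x y _ mx _ my|a {}x Za _ mx|{}x y _ mx _ my].
- by rewrite uK2E; apply: mon_spanI hmonK.
- by rewrite uKinv2E; apply: mon_spanI hmonKV.
- by rewrite -xe_ue; apply: mon_spanI hmon_e.
- by rewrite -Fd_Fdiv; apply: mon_spanI (hmon_F n).
- exact: mon_spanI hmon1.
- exact: ZspanD.
- exact: ZspanZ.
- apply: (Zspan_bind2 mulUh_bilin _ mx my) => {mx my}x {}y.
  move=> [k /mon_hmon hx] [l /mon_hmon hy].
  exact: mon_spanI (hmonM hx hy).
Qed.

Lemma Uev_ideal_mon_span p x : Uev_ideal p x -> mon_span p x.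
Proof.
apply: Zspan_sub => _ [a [b [/Uev_mon_span Ma /Uev_mon_span Mb ->]]].
apply: (Zspan_bind2 mulUh_bilin (S1 := [set x | exists k, mon p k x]) _ _ Mb).
  move=> {}x y [k mx] [l /mon_hmon hy]; apply: Zspan_in; exists (k + l).
  exact: monMr.
apply: (Zspan_bind (mulUh_bilin.1 _) _ Ma) => y [k /mon_hmon hy].
by apply: Zspan_in; exists (k + p%:Z); apply: monMl => //; rewrite -xe_ue; apply: mon_eX.
Qed.

Lemma mon_Uev_ideal p k x : mon p k x -> Uev_ideal p x.
Proof.
move=> [a [b [ka [kb [/hmon_Uev Ua /hmon_Uev Ub _ ->]]]]]; apply: Zspan_in.
by exists a, b; rewrite xe_ue.
Qed.

Lemma mon_Uev p k x : mon p k x -> is_Uev x.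
Proof. by move/mon_hmon/hmon_Uev. Qed.

Lemma tens_fil_pure1 p x : mon_span p x -> tens_fil p (pure1 x).
Proof.
move=> Mx; apply: (tens_fil_Zspan (S := tens_fil p)) => //.
apply: (Zspan_bind pure1_linear _ Mx) => y [k my]; apply: Zspan_in.
exists (tpure [tuple mkUev (mon_Uev my)]).
  apply: mspan_in; exists [tuple mkUev (mon_Uev my)] => //.
  by exists ord0; apply/Uev_filE/(mon_Uev_ideal my).
by rewrite incl_pure pureE1.
Qed.

Lemma tens_fil_pure2_mon p i x y k l : mon (if i == 0 :> 'I_2 then p else 0) k x ->
  mon (if i == 0 then 0 else p) l y -> tens_fil p (pure2 x y).
Proof.
move=> mx my; exists (tpure [tuple mkUev (mon_Uev mx); mkUev (mon_Uev my)]).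
  apply: mspan_in; exists [tuple mkUev (mon_Uev mx); mkUev (mon_Uev my)] => //.
  exists i; apply/Uev_filE; move: mx my.
  case: i => [[|[|//]]] ilt /= mx my; [exact: mon_Uev_ideal mx | exact: mon_Uev_ideal my].
by rewrite incl_pure pureE2.
Qed.

Lemma tens_fil_pure2l p x y : mon_span p x -> mon_span 0 y -> tens_fil p (pure2 x y).
Proof.
move=> Mx My; apply: (tens_fil_Zspan (S := tens_fil p)) => //.
apply: (Zspan_bind2 pure2_bilin _ Mx My) => {Mx My}x {}y [k mx] [l my].
by apply: Zspan_in; apply: (@tens_fil_pure2_mon p 0 x y k l).
Qed.

Lemma tens_fil_pure2r p x y : mon_span 0 x -> mon_span p y -> tens_fil p (pure2 x y).
Proof.
move=> Mx My; apply: (tens_fil_Zspan (S := tens_fil p)) => //.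
apply: (Zspan_bind2 pure2_bilin _ Mx My) => {Mx My}x {}y [k mx] [l my].
by apply: Zspan_in; apply: (@tens_fil_pure2_mon p 1 x y k l).
Qed.

Section TensFil.
Variables (j : nat) (p q : nat).

Let nbhs_bind (N : lmodType Qh) (f : N -> T j) (S : set N) x : linear f ->
  (forall y, S y -> tens_nbhs q (f y)) -> Zspan S x -> tens_nbhs q (f x).
Proof.
move=> lf SJ sx; apply: (tens_nbhs_Zspan (S := tens_nbhs q)) => //.
by apply: (Zspan_bind lf _ sx) => y Sy; apply/Zspan_in/SJ.
Qed.

Lemma tens_fil1_bind (f : T 1 -> T j) z : linear f ->
  (forall k x, mon p k x -> tens_nbhs q (f (pure1 x))) -> tens_fil p z -> tens_nbhs q (f z).
Proof.
move=> lf fJ [x Fx <-].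
elim: Fx => [|_ [{}x [i /Uev_filE/Uev_ideal_mon_span Fx] <-]|a {}x y _ Jx _ Jy].
- by rewrite incl0 (lin0 lf); apply: tens_nbhs_0.
- rewrite incl_pure pureE1 tnth_map.
  have {}Fx : mon_span p (Uev_val [tnth x 0]).
    by move: Fx; congr (mon_span p (Uev_val _)); case: i => [[|//]] ilt; congr tnth; apply: val_inj.
  by apply: (nbhs_bind (lin_comp lf pure1_linear) _ Fx) => y [k my]; apply: fJ my.
- by rewrite incl_lin lf; apply: tens_nbhs_lin => //; apply: Zq_valP.
Qed.

(** Reduction to tensors of monomials; the two hypotheses correspond to the factor that carries
    e^p. *)
Lemma tens_fil2_bind (f : T 2 -> T j) z : linear f ->
  (forall k l x y, mon p k x -> mon 0 l y -> tens_nbhs q (f (pure2 x y))) ->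
  (forall k l x y, mon 0 k x -> mon p l y -> tens_nbhs q (f (pure2 x y))) ->
  tens_fil p z -> tens_nbhs q (f z).
Proof.
move=> lf fJl fJr [x Fx <-].
elim: Fx => [|_ [{}x [i /Uev_filE/Uev_ideal_mon_span Fx] <-]|a {}x y _ Jx _ Jy].
- by rewrite incl0 (lin0 lf); apply: tens_nbhs_0.
- rewrite incl_pure pureE2 !tnth_map.
  case: i Fx => [[|[|//]]] ilt Fx.
    have {}Fx : mon_span p (Uev_val [tnth x 0]).
      by move: Fx; congr (mon_span p (Uev_val (tnth _ _))); apply: val_inj.
    have Fy := Uev_mon_span (Uev_valP [tnth x 1]).
    apply: (nbhs_bind (lin_comp lf (pure2_bilin.1 _)) _ Fx) => y [k my].
    apply: (nbhs_bind (lin_comp lf (pure2_bilin.2 _)) _ Fy) => y' [k' my'].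
    exact: fJl my my'.
  have {}Fx : mon_span p (Uev_val [tnth x 1]).
    by move: Fx; congr (mon_span p (Uev_val (tnth _ _))); apply: val_inj.
  have Fy := Uev_mon_span (Uev_valP [tnth x 0]).
  apply: (nbhs_bind (lin_comp lf (pure2_bilin.1 _)) _ Fy) => y [k my].
  apply: (nbhs_bind (lin_comp lf (pure2_bilin.2 _)) _ Fx) => y' [k' my'].
  exact: fJr my my'.
- by rewrite incl_lin lf; apply: tens_nbhs_lin => //; apply: Zq_valP.
Qed.

Lemma tens_nbhs_bind (f : T 2 -> T j) (S : set (T 2)) X : linear f ->
  (forall Y, S Y -> tens_nbhs q (f Y)) -> Zspan S X -> tens_nbhs q (f X).
Proof. exact: nbhs_bind. Qed.

End TensFil.

Lemma tens_fil0_Zspan z : @tens_fil 0 0 z -> Zspan [set pure [tuple]] z.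
Proof.
move=> [x _ <-]; elim/tpow_ind: x => [|a x y IHy].
  by rewrite incl0; apply: Zspan0.
rewrite incl_lin; apply: Zspan_lin => //; first exact: Zq_valP.
by apply: Zspan_in; rewrite incl_pure /=; congr pure; apply: tuple0.
Qed.

Lemma tens_fil0_eq0 p z : @tens_fil 0 p.+1 z -> z = 0.
Proof.
move=> [x Fx <-]; elim: Fx => [|//|a y y' _ IHy _ IHy']; first exact: incl0.
by rewrite incl_lin IHy IHy' scaler0 addr0.
Qed.

Lemma tens_fil0_pure c : is_Zq c -> @tens_fil 0 0 (c *: pure [tuple]).
Proof.
move=> Zc; exists (mkZq Zc *: tpure [tuple]); first exact: mspan_in.
rewrite -[_ *: tpure _]addr0 incl_lin incl0 incl_pure addr0 /=; congr (_ *: pure _).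
exact: tuple0.
Qed.

(** * Integral adjoint actions and the terms of the R-matrix series *)

Lemma ad_eX_span D k y n : wt k y ->
  Zspan [set z | exists i j, (i + j)%N = n /\ z = xe ^+ i * y * xe ^+ j] (ad D (xe ^+ n) y).
Proof.
move=> wy; elim: n => [|n IHn].
  by rewrite ad_1; apply: Zspan_in; exists 0%N, 0%N; rewrite mul1r mulr1.
rewrite exprS ad_mul; apply: (Zspan_bind ((ad_bilin D).2 xe) _ IHn).
move=> _ [i [j [ijn ->]]]; rewrite (ad_e D (wtM (wtM (wt_eX i) wy) (wt_eX j))).
apply: ZspanB; last apply: ZspanZ (qz_Zq _) _; apply: Zspan_in.
  by exists i.+1, j; rewrite exprS !mulrA; split=> //; lia.
by exists i, j.+1; rewrite [xe ^+ j.+1]exprSr !mulrA; split=> //; lia.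
Qed.

Lemma ad_eX_hmon_span D p k y n : mon p k y -> hmon_span p (k + n%:Z) (ad D (xe ^+ n) y).
Proof.
move=> my; apply: Zspan_sub (ad_eX_span D n (mon_wt my)) => _ [i [j [ijn ->]]].
apply: Zspan_in; apply: mon_eq (monMr (monMl (hmon_eX i) my) (hmon_eX j)) _; lia.
Qed.

(** This is what makes the series over the R-matrix converge for the filtration. *)
Lemma ad_eX_half D k y n : hmon k y -> hmon_span n./2 (k + n%:Z) (ad D (xe ^+ n) y).
Proof.
move=> hy; apply: Zspan_sub (ad_eX_span D n (hmon_wt hy)) => _ [i [j [ijn ->]]].
apply: Zspan_in; case: (leqP n./2 i) => le_i.
  apply: mon_le le_i (mon_eq (monMr (monMr (mon_eX i) hy) (hmon_eX j)) _); lia.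
have le_j : (n./2 <= j)%N by lia.
apply: mon_le le_j (mon_eq (monMl (hmonM (hmon_eX i) hy) (mon_eX j)) _); lia.
Qed.

Lemma cAd_Zq k j : is_Zq (cAd k j).
Proof. by apply: Zq_mul (Zq_sign _) (qz_Zq _). Qed.

Lemma ad_Fd_hmon_span D p k x n : mon p k x -> hmon_span p (k - n%:Z) (ad D (Fd n) x).
Proof.
move=> mx; rewrite (ad_Fd D n (mon_wt mx)); apply: Zspan_sum => i _.
apply: ZspanZ (cAd_Zq _ _) _; apply: Zspan_in.
apply: mon_eq (monMr (monMl (hmon_F i) mx) (hmon_F (n - i))) _.
by have := ltn_ord i; lia.
Qed.

Definition Rqpow n : Qh := qz (n * n.-1)./2%:Z.

Definition adF D n x := (qfactq n)^-1 *: ad D (xF ^+ n) x.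

(** F^n/[n]_q! = F~(n) K^(-n), and K^(-n) acts on degree k by q^(-nk). *)
Lemma adFE D k x n : wt k x -> adF D n x = qz (- (n%:Z * k)) *: ad D (Fd n) x.
Proof.
move=> wx; rewrite /adF xFX (linZ ((ad_bilin D).1 x)) scalerA mulVr ?qfactq_unit //.
rewrite scale1r ad_mul ad_Kx (Kx_conj _ wx) (linZ ((ad_bilin D).2 _)).
by apply: eq_scale => //; congr qz; lia.
Qed.

Lemma adF_hmon_span D p k x n : mon p k x -> hmon_span p (k - n%:Z) (adF D n x).
Proof.
by move=> mx; rewrite (adFE D n (mon_wt mx)); apply: ZspanZ (qz_Zq _) (ad_Fd_hmon_span D n mx).
Qed.

Lemma Rcoef_split (N P Q : lmodType Qh) (B : N -> P -> Q) n d x y : bilinear_for B ->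
  Rcoef n *: (d *: B x y) = (Rqpow n * d) *: B ((v - v^-1) ^+ n *: x) ((qfactq n)^-1 *: y).
Proof.
move=> bB; rewrite (linZ (bB.1 _)) (linZ (bB.2 _)) !scalerA RcoefE; apply: eq_scale => //.
by rewrite /Rqpow; ring.
Qed.

Lemma eq_exp_sum (N : lmodType Qh) r (x y : nat -> N) : x =1 y -> exp_sum r x = exp_sum r y.
Proof. by move=> /funext ->. Qed.

(** Cartan factor when both legs act on weight vectors: exp(h/4 (2a)(2b)) = q^(ab). *)
Lemma exp_sum_cartan (N : lmodType Qh) (a b : int) (z : N) : hseparated N ->
  exp_sum 4%:R^-1 (fun m => fpsC ((2%:R * a%:~R) ^+ m) *: (fpsC ((2%:R * b%:~R) ^+ m) *: z)) =
  qz (a * b) *: z.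
Proof.
move=> sN; rewrite /qz.
have -> : (a * b)%:~R = 4%:R^-1 * ((2%:R * a%:~R) * (2%:R * b%:~R)) :> rat.
  by rewrite intrM; field.
rewrite -(exp_sum_scalar _ _ _ sN); apply: eq_hsum => m.
by apply: eq_scale => //; rewrite scalerA -fpsCM -exprMn.
Qed.

(** Cartan factor when a single leg acts on a weight vector: exp(h/4 (2a) H) = K^a. *)
Lemma exp_sum_Kx a : exp_sum 4%:R^-1 (fun m => fpsC ((2%:R * a%:~R) ^+ m) *: xH ^+ m) = Kx a.
Proof.
have e : a%:~R / 2%:R = 4%:R^-1 * (2%:R * a%:~R) :> rat by field.
rewrite KxE e; exact: exp_sum_geom.
Qed.

Lemma tens_nbhs_Rmx j p (f : Uh -> Uh -> T j) (t : nat -> T j) : bilinear_for f ->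
  (forall n, Rcoef n *:
     exp_sum 4%:R^-1 (fun m => f (xH ^+ m * xF ^+ n) (xH ^+ m * xE ^+ n)) = t n) ->
  (forall n, tens_fil p (t n)) -> (forall n, tens_fil n./2 (t n)) -> tens_nbhs p (sweedler Rmx f).
Proof.
move=> bf tE tp t2; rewrite (sweedler_Rmx (hcomplete_T j) bf) (eq_hsum tE).
apply: (tens_nbhs_hsum tp t2); apply: hsum_cvg (hcomplete_T j) _ => n.
by rewrite -tE; apply: Rcoef_hpow.
Qed.

Lemma bilinear_sweedler (N : lmodType Qh) (B : Uh -> Uh -> Uh -> Uh -> N) X : hcomplete N ->
  (forall x y, bilinear_for (B x y)) ->
  (forall a b, bilinear_for (fun x y => B x y a b)) ->
  bilinear_for (fun x y => sweedler X (B x y)).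
Proof.
move=> cN bB bB'; split=> [y|x].
  by apply: (sweedler_linear_param (B := fun x => B x y)) => // a b; apply: (bB' a b).1.
by apply: (sweedler_linear_param (B := B x)) => // a b; apply: (bB' a b).2.
Qed.

Lemma bilin_comp (M M' N : lmodType Qh) (B : M -> M' -> N) (f : Uh -> M) (g : Uh -> M') :
  bilinear_for B -> linear f -> linear g -> bilinear_for (fun x y => B (f x) (g y)).
Proof.
move=> bB lf lg; split=> [y|x].
  exact: lin_comp (bB.1 (g y)) lf.
exact: lin_comp (bB.2 (f x)) lg.
Qed.

Lemma bilin_swap (M M' N : lmodType Qh) (B : M -> M' -> N) :
  bilinear_for B -> bilinear_for (fun x y => B y x).
Proof. by move=> [bl br]; split. Qed.

(** * The braiding *)

Section Maps.
Variable D : Uh_Hopf.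
Local Notation S := (apd D).
Let lS : linear S := @apd_linear D.

Let ad_l y := (ad_bilin D).1 y.
Let ad_r x := (ad_bilin D).2 x.

Lemma ad_xHX_mul m l a y : wt l (ad D a y) ->
  ad D (xH ^+ m * a) y = fpsC ((2%:R * l%:~R) ^+ m) *: ad D a y.
Proof. by move=> wl; rewrite ad_mul (ad_xHX_wt D m wl). Qed.

Definition psi_ab x y a b := pure2 (ad D b y) (ad D a x).

Lemma psi_ab_bilin x y : bilinear_for (psi_ab x y).
Proof. exact: bilin_swap (bilin_comp pure2_bilin (ad_l y) (ad_l x)). Qed.

Let psi_ab_bilin' a b : bilinear_for (fun x y => psi_ab x y a b).
Proof. exact: bilin_swap (bilin_comp pure2_bilin (ad_r b) (ad_r a)). Qed.

Let psi_multi := multilin2 (bilinear_sweedler Rmx (hcomplete_T 2) psi_ab_bilin psi_ab_bilin').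

Lemma psi_linear : linear (psi D).
Proof. exact: clift_linear (hcomplete_T 2) psi_multi. Qed.

Lemma psi_pure2 x y : psi D (pure2 x y) = sweedler Rmx (psi_ab x y).
Proof. exact: clift_pure (hcomplete_T 2) psi_multi [tuple x; y]. Qed.

(** The exponent is the product of the degrees l + n of e^n |> y and k - n of F^n |> x. *)
Lemma psi_term k l x y n : wt k x -> wt l y ->
  Rcoef n *: exp_sum 4%:R^-1 (fun m => psi_ab x y (xH ^+ m * xF ^+ n) (xH ^+ m * xE ^+ n)) =
  (Rqpow n * qz ((l + n%:Z) * (k - n%:Z))) *: pure2 (ad D (xe ^+ n) y) (adF D n x).
Proof.
move=> wx wy.
have e m : psi_ab x y (xH ^+ m * xF ^+ n) (xH ^+ m * xE ^+ n) =
    fpsC ((2%:R * (l + n%:Z)%:~R) ^+ m) *: (fpsC ((2%:R * (k - n%:Z)%:~R) ^+ m) *: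
      pure2 (ad D (xE ^+ n) y) (ad D (xF ^+ n) x)).
  rewrite -(linZ (pure2_bilin.2 _)) -(linZ (pure2_bilin.1 _)).
  by apply: eq_pure2; apply: ad_xHX_mul; [apply: wt_ad_xEX | apply: wt_ad_xFX].
rewrite (eq_exp_sum _ e) (exp_sum_cartan _ _ _ (@hseparated_T 2)).
apply: etrans (Rcoef_split _ _ _ _ pure2_bilin) _.
by rewrite xeX (linZ (ad_l y)).
Qed.
End Maps.

Lemma tens_filZ n p c (x : T n) : is_Zq c -> tens_fil p x -> tens_fil p (c *: x).
Proof. by move=> Zc Ix; rewrite -[_ *: _]addr0; apply: tens_fil_lin => //; apply: tens_fil_0. Qed.

Lemma mon_span_le p q x : (p <= q)%N -> mon_span q x -> mon_span p x.
Proof.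
move=> le_pq; apply: Zspan_sub => y [k my]; apply: Zspan_in; exists k.
exact: mon_le my.
Qed.

Lemma tens_fil_mon_l p q x y : mon_span p x -> mon_span q y -> tens_fil p (pure2 x y).
Proof. by move=> Mx My; apply: tens_fil_pure2l => //; apply: mon_span_le My. Qed.

Lemma tens_fil_mon_r p q x y : mon_span p x -> mon_span q y -> tens_fil q (pure2 x y).
Proof. by move=> Mx My; apply: tens_fil_pure2r => //; apply: mon_span_le Mx. Qed.

Lemma Rqpow_Zq n : is_Zq (Rqpow n). Proof. exact: qz_Zq. Qed.

Lemma half_le n : (n./2 <= n)%N. Proof. lia. Qed.

Section Maps.
Variable D : Uh_Hopf.
Local Notation S := (apd D).
Let lS : linear S := @apd_linear D.
Let ad_l y := (ad_bilin D).1 y.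
Let ad_r x := (ad_bilin D).2 x.

Lemma psi_nbhs p p1 p2 k l x y : mon p1 k x -> mon p2 l y -> p = p1 \/ p = p2 ->
  tens_nbhs p (psi D (pure2 x y)).
Proof.
move=> mx my pE; rewrite psi_pure2.
have Zc n := Zq_mul (Rqpow_Zq n) (qz_Zq ((l + n%:Z) * (k - n%:Z))).
apply: (tens_nbhs_Rmx (psi_ab_bilin D x y) (fun n => psi_term D n (mon_wt mx) (mon_wt my))) => n;
  apply: tens_filZ (Zc n) _; have MF := hmon_span_sub (adF_hmon_span D n mx).
  have ME := hmon_span_sub (ad_eX_hmon_span D n my).
  by case: pE => ->; [apply: tens_fil_mon_r ME MF | apply: tens_fil_mon_l ME MF].
exact: tens_fil_mon_l (hmon_span_sub (ad_eX_half D n (mon_hmon my))) MF.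
Qed.

Lemma psi_continuous : induces_continuous (psi D).
Proof.
apply: (induces_continuousP (psi_linear D)) => p z Iz.
(* The braiding loses no degree, so F_2p is only used through F_p. *)
have {}Iz : tens_fil p z by apply: tens_fil_le Iz; lia.
apply: (tens_fil2_bind (psi_linear D) _ _ Iz) => k l x y mx my.
  by apply: psi_nbhs mx my _; left.
by apply: psi_nbhs mx my _; right.
Qed.

(** * The inverse braiding *)

Definition psi_inv_ab x y a b := pure2 (ad D (S a) y) (ad D b x).

Lemma psi_inv_ab_bilin x y : bilinear_for (psi_inv_ab x y).
Proof. exact: bilin_comp pure2_bilin (lin_comp (ad_l y) lS) (ad_l x). Qed.

Let psi_inv_ab_bilin' a b : bilinear_for (fun x y => psi_inv_ab x y a b).
Proof. exact: bilin_swap (bilin_comp pure2_bilin (ad_r (S a)) (ad_r b)). Qed.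

Let psi_inv_multi :=
  multilin2 (bilinear_sweedler Rmx (hcomplete_T 2) psi_inv_ab_bilin psi_inv_ab_bilin').

Lemma psi_inv_linear : linear (psi_inv D).
Proof. exact: clift_linear (hcomplete_T 2) psi_inv_multi. Qed.

Lemma psi_inv_pure2 x y : psi_inv D (pure2 x y) = sweedler Rmx (psi_inv_ab x y).
Proof. exact: clift_pure (hcomplete_T 2) psi_inv_multi [tuple x; y]. Qed.

Lemma apd_xFX n : exists2 c, is_Zq c & (qfactq n)^-1 *: S (xF ^+ n) = c *: Fd n.
Proof.
have [c Zc cE] := twS_Fd D n.
exists (c * qz (n%:Z *+ 2 * - n%:Z)); first by apply: Zq_mul Zc (qz_Zq _).
rewrite xFX (linZ lS) scalerA mulVr ?qfactq_unit // scale1r apd_mul apd_Kx opprK.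
(* K^(-n) S(F~(n)) is a multiple of F~(n) K^(-2n), and the remaining K^(2n) conjugates F~(n) into a
   q-power multiple of itself. *)
have -> : Kx n%:Z = Kx (n%:Z *+ 2) * Kx (- n%:Z) by rewrite -KxD; congr Kx; lia.
rewrite -mulrA -/(twS D (- n%:Z) (Fd n)) cE -(UhZr c) mulrA (Kx_conj _ (wt_Fd n)).
by rewrite scalerA.
Qed.

(** S(H^m F^n) = S(F^n) (-H)^m, so H^m acts first, on y itself; hence the degree -l in the
    exponent. *)
Lemma psi_inv_term k l x y n : wt k x -> wt l y ->
  Rcoef n *: exp_sum 4%:R^-1 (fun m => psi_inv_ab x y (xH ^+ m * xF ^+ n) (xH ^+ m * xE ^+ n)) =
  (Rqpow n * qz ((- l) * (k + n%:Z))) *: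
    pure2 (ad D ((qfactq n)^-1 *: S (xF ^+ n)) y) (ad D (xe ^+ n) x).
Proof.
move=> wx wy.
have e m : psi_inv_ab x y (xH ^+ m * xF ^+ n) (xH ^+ m * xE ^+ n) =
    fpsC ((2%:R * (- l)%:~R) ^+ m) *: (fpsC ((2%:R * (k + n%:Z)%:~R) ^+ m) *:
      pure2 (ad D (S (xF ^+ n)) y) (ad D (xE ^+ n) x)).
  rewrite -(linZ (pure2_bilin.2 _)) -(linZ (pure2_bilin.1 _)).
  apply: eq_pure2; last by apply: ad_xHX_mul; apply: wt_ad_xEX.
  rewrite apd_mul ad_mul apd_xHX (linZ (ad_l y)) (ad_xHX_wt D m wy) scalerA.
  rewrite (linZ (ad_r _)) -fpsCM -exprMn; apply: eq_scale => //.
  by congr (fpsC (_ ^+ _)); rewrite rmorphN mulN1r mulrN.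
rewrite (eq_exp_sum _ e) (exp_sum_cartan _ _ _ (@hseparated_T 2)).
apply: etrans (Rcoef_split _ _ _ _ (bilin_swap pure2_bilin)) _.
by rewrite xeX (linZ (ad_l x)) (linZ (ad_l y)).
Qed.

Lemma psi_inv_nbhs p p1 p2 k l x y : mon p1 k x -> mon p2 l y -> p = p1 \/ p = p2 ->
  tens_nbhs p (psi_inv D (pure2 x y)).
Proof.
move=> mx my pE; rewrite psi_inv_pure2.
have Zc n := Zq_mul (Rqpow_Zq n) (qz_Zq ((- l) * (k + n%:Z))).
apply: (tens_nbhs_Rmx (psi_inv_ab_bilin x y)
  (fun n => psi_inv_term n (mon_wt mx) (mon_wt my))) => n;
  apply: tens_filZ (Zc n) _; have [c Zc' ->] := apd_xFX n;
  rewrite (linZ (ad_l y)) (linZ (pure2_bilin.1 _)); apply: tens_filZ Zc' _;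
  have MF := hmon_span_sub (ad_Fd_hmon_span D n my).
  have ME := hmon_span_sub (ad_eX_hmon_span D n mx).
  by case: pE => ->; [apply: tens_fil_mon_r MF ME | apply: tens_fil_mon_l MF ME].
exact: tens_fil_mon_r MF (hmon_span_sub (ad_eX_half D n (mon_hmon mx))).
Qed.

Lemma psi_inv_continuous : induces_continuous (psi_inv D).
Proof.
apply: (induces_continuousP psi_inv_linear) => p z Iz.
have {}Iz : tens_fil p z by apply: tens_fil_le Iz; lia.
apply: (tens_fil2_bind psi_inv_linear _ _ Iz) => k l x y mx my.
  by apply: psi_inv_nbhs mx my _; left.
by apply: psi_inv_nbhs mx my _; right.
Qed.

(** * Multiplication, unit and counit *)

Let bmul_bilin : bilinear_for (fun x y : Uh => pure1 (x * y)).
Proof.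
split=> [y|x]; first exact: lin_comp pure1_linear (mulUh_bilin.1 y).
exact: lin_comp pure1_linear (mulUh_bilin.2 x).
Qed.

Lemma bmul_linear : linear bmul.
Proof. exact: clift_linear (hcomplete_T 1) (multilin2 bmul_bilin). Qed.

Lemma bmul_pure2 x y : bmul (pure2 x y) = pure1 (x * y).
Proof. exact: clift_pure (hcomplete_T 1) (multilin2 bmul_bilin) [tuple x; y]. Qed.

Lemma bmul_continuous : induces_continuous bmul.
Proof.
apply: (induces_continuousP bmul_linear) => p z Iz.
have {}Iz : tens_fil p z by apply: tens_fil_le Iz; lia.
apply: (tens_fil2_bind bmul_linear _ _ Iz) => k l x y mx my; rewrite bmul_pure2;
  apply/tens_fil_nbhs/tens_fil_pure1/Zspan_in; exists (k + l).
  by apply: monMr mx (mon_hmon my).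
by apply: monMl (mon_hmon mx) my.
Qed.

Let bunit_multi : multilin (M := Uh) idfun (fun _ : 0.-tuple Uh => pure1 1).
Proof. by move=> x []. Qed.

Lemma bunit_linear : linear bunit.
Proof. exact: clift_linear (hcomplete_T 1) bunit_multi. Qed.

Lemma bunit_continuous : induces_continuous bunit.
Proof.
(* In tensor degree 0 the filtration vanishes for p > 0, so p = 0 is the only case with content. *)
apply: (induces_continuousP bunit_linear) => -[|p] z Iz.
  apply: (tens_nbhs_Zspan (S := tens_nbhs 0)) => //.
  apply: (Zspan_bind bunit_linear _ (tens_fil0_Zspan Iz)) => _ ->; apply: Zspan_in.
  rewrite /bunit (clift_pure (hcomplete_T 1) bunit_multi); apply/tens_fil_nbhs/tens_fil_pure1/Zspan_in.
  by exists 0; apply/hmon_mon0/hmon1.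
by rewrite (tens_fil0_eq0 Iz) (lin0 bunit_linear); apply: tens_nbhs_0.
Qed.

Let bcounit_lin1 : linear (fun x => eps D x *: pure [tuple] : T 0).
Proof. by move=> a x y; rewrite eps_linear scalerDl scalerA. Qed.

Lemma bcounit_linear : linear (bcounit D).
Proof. exact: clift_linear (hcomplete_T 0) (multilin1 bcounit_lin1). Qed.

Lemma bcounit_pure1 x : bcounit D (pure1 x) = eps D x *: pure [tuple].
Proof. exact: clift_pure (hcomplete_T 0) (multilin1 bcounit_lin1) [tuple x]. Qed.

Lemma eps_lin : linear (eps D : Uh -> Qh^o).
Proof. by move=> a x y; rewrite eps_linear. Qed.

Lemma epsZ a x : eps D (a *: x) = a * eps D x.
Proof. exact: (linZ eps_lin). Qed.

Lemma eps_X x n : eps D (x ^+ n) = eps D x ^+ n.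
Proof. by elim: n => [|n IHn]; rewrite ?eps_1 // exprS eps_mul IHn -exprS. Qed.

Lemma eps_Kx a : eps D (Kx a) = 1.
Proof.
apply/eqP; rewrite -subr_eq0; apply/eqP/hseparated_Qh => p.
(* Keeping p + 1 terms guarantees the presence of the constant term, the only one not killed by the
   counit. *)
have := hsum_tail hcomplete_Uh (fun n => hpow_dexp (a%:~R / 2%:R) n (xH ^+ n)) p.+1.
rewrite -[hsum _]/(exp_sum _ _) -KxE => -[t _ tE].
exists (h * eps D t); rewrite mulrA -exprSr -epsZ tE.
rewrite (linB eps_lin) (lin_sum eps_lin) big_ord_recl /= big1 => [|i _].
  rewrite addr0 epsZ eps_1 mulr1; congr (_ - _).
  by rewrite /dexp expr0 fact0 divr1 mul1r.
rewrite epsZ eps_X xH_def eps_H exprS mul0r; exact: mulr0.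
Qed.

Lemma eps_e : eps D xe = 0.
Proof. by rewrite xe_def epsZ xE_def eps_E mulr0. Qed.

Lemma eps_hmon k x : hmon k x -> is_Zq (eps D x).
Proof.
elim=> [||||[|n]|{}k l {}x y _ Zx _ Zy].
- by rewrite eps_1; apply: Zq_1.
- by rewrite eps_Kx; apply: Zq_1.
- by rewrite eps_Kx; apply: Zq_1.
- by rewrite eps_e; apply: Zq0.
- by rewrite Fd0 eps_1; apply: Zq_1.
- rewrite Fd_def epsZ eps_mul eps_X xF_def eps_F exprS !mul0r mulr0; exact: Zq0.
- by rewrite eps_mul; apply: Zq_mul.
Qed.

Lemma bcounit_continuous : induces_continuous (bcounit D).
Proof.
apply: (induces_continuousP bcounit_linear) => p z.
apply: (tens_fil1_bind bcounit_linear) => k x mx; rewrite bcounit_pure1; apply: tens_fil_nbhs.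
case: p mx => [|p] mx; first exact/tens_fil0_pure/eps_hmon/mon_hmon/mx.
move: mx => [a [b [ka [kb [_ _ _ ->]]]]].
rewrite (eps_mul D (a * _) b) (eps_mul D a) eps_X eps_e exprS mul0r mulr0 mul0r scale0r.
exact: tens_fil_0.
Qed.

(** * The braided coproduct *)

Definition bcop_ab x1 x2 a b := pure2 (x1 * S b) (ad D a x2).

Lemma bcop_ab_bilin x1 x2 : bilinear_for (bcop_ab x1 x2).
Proof.
exact: bilin_swap (bilin_comp pure2_bilin (lin_comp (mulUh_bilin.2 x1) lS) (ad_l x2)).
Qed.

Let bcop_ab_bilin' a b : bilinear_for (fun x1 x2 => bcop_ab x1 x2 a b).
Proof. exact: bilin_comp pure2_bilin (mulUh_bilin.1 (S b)) (ad_r a). Qed.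

Let bcop_in x1 x2 := sweedler Rmx (bcop_ab x1 x2).

Let bcop_in_bilin : bilinear_for bcop_in.
Proof. exact: bilinear_sweedler (hcomplete_T 2) bcop_ab_bilin bcop_ab_bilin'. Qed.

Let bcop_out X := sweedler X bcop_in.

Let bcop_out_linear : linear bcop_out.
Proof. exact: sweedler_linear (hcomplete_T 2) bcop_in_bilin. Qed.

Let bcop_lin1 : linear (bcop_out \o cop D).
Proof. exact: lin_comp bcop_out_linear (@cop_linear D). Qed.

Lemma bcop_linear : linear (bcop D).
Proof. exact: clift_linear (hcomplete_T 2) (multilin1 bcop_lin1). Qed.

Let bcop_pure1 x : bcop D (pure1 x) = bcop_out (cop D x).
Proof. exact: clift_pure (hcomplete_T 2) (multilin1 bcop_lin1) [tuple x]. Qed.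

(** Only the second leg sees weights: F^n |> x2 has degree l - n, and the sign in S(H) = -H turns
    the resulting power of K into K^(n-l). *)
Lemma bcop_term x1 x2 l n : wt l x2 ->
  Rcoef n *: exp_sum 4%:R^-1 (fun m => bcop_ab x1 x2 (xH ^+ m * xF ^+ n) (xH ^+ m * xE ^+ n)) =
  Rqpow n *: pure2 (x1 * S (xe ^+ n) * Kx (n%:Z - l)) (adF D n x2).
Proof.
move=> wx2; pose B u w := pure2 (x1 * S u * Kx (n%:Z - l)) (ad D w x2).
have bB : bilinear_for B.
  apply: (bilin_comp (f := fun u => x1 * S u * Kx (n%:Z - l)) pure2_bilin _ (ad_l x2)).
  exact: lin_comp (mulUh_bilin.1 _) (lin_comp (mulUh_bilin.2 x1) lS).
pose phi z := pure2 (x1 * S (xE ^+ n) * z) (ad D (xF ^+ n) x2).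
have lphi : linear phi.
  exact: lin_comp (pure2_bilin.1 _) (mulUh_bilin.2 _).
have e m : bcop_ab x1 x2 (xH ^+ m * xF ^+ n) (xH ^+ m * xE ^+ n) =
    phi (fpsC ((2%:R * (n%:Z - l)%:~R) ^+ m) *: xH ^+ m).
  rewrite (linZ lphi) /phi -(linZ (pure2_bilin.1 _)).
  rewrite /bcop_ab (ad_xHX_mul m (wt_ad_xFX D n wx2)) (linZ (pure2_bilin.2 _)).
  rewrite -(linZ (pure2_bilin.1 _)); apply: eq_pure2 => //.
  rewrite apd_mul apd_xHX mulrA -(UhZr _ (x1 * _)) scalerA -fpsCM -exprMn.
  apply: eq_scale => //; congr (fpsC (_ ^+ _)).
  by rewrite -[l - n%:Z]opprB rmorphN mulrN1 mulrN opprK.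
rewrite (eq_exp_sum _ e) -[exp_sum _ _](exp_sum_lin _ _ lphi hcomplete_Uh (@hseparated_T 2)).
rewrite exp_sum_Kx -[phi _]scale1r; apply: etrans (Rcoef_split n 1 (xE ^+ n) (xF ^+ n) bB) _.
apply: eq_scale; first exact: mulr1.
apply: eq_pure2; last exact: linZ (ad_l x2) _ _.
by rewrite xeX.
Qed.

(** Here the powers of K cancel: K^n S(e^n) is a multiple of e^n, and the remaining K^(l-n)
    conjugates e^n. *)
Lemma conj_S_eX l n : exists2 c, is_Zq c &
  Kx l * S (xe ^+ n) * Kx (n%:Z - l) = c *: xe ^+ n.
Proof.
have [c Zc cE] := twS_eX D n; exists (c * qz ((l - n%:Z) * n%:Z)).
  exact: Zq_mul Zc (qz_Zq _).
have -> : Kx l = Kx (l - n%:Z) * Kx n%:Z by rewrite -KxD; congr Kx; lia.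
rewrite -(mulrA (Kx (l - n%:Z))) -/(twS D n%:Z (xe ^+ n)) cE.
rewrite -(UhZr c) -(UhZl c) -[n%:Z - l]opprB (Kx_conj _ (wt_eX n)).
exact: scalerA.
Qed.

(** The twist by [K^l], [l] the degree of the second factor, compensates the power of [K]
  that the Cartan part of the R-matrix contributes to [bcop]. *)
Definition cop_tw p1 p2 : set (T 2) := [set X | exists a b ka l,
  [/\ mon p1 ka a, mon p2 l b & X = pure2 (a * Kx l) b]].

Lemma bcop_out_cop_tw p p1 p2 X : p = p1 \/ p = p2 -> cop_tw p1 p2 X -> tens_nbhs p (bcop_out X).
Proof.
move=> pE [a [b [ka [l [ma mb ->]]]]].
rewrite /bcop_out (sweedler_pure2 (hcomplete_T 2) bcop_in_bilin).
apply: (tens_nbhs_Rmx (bcop_ab_bilin (a * Kx l) b) (fun n => bcop_term (a * Kx l) n (mon_wt mb))) => n;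
  apply: tens_filZ (Rqpow_Zq n) _; have [c Zc cE] := conj_S_eX l n;
  rewrite -!(mulrA a) cE -(UhZr c) (linZ (pure2_bilin.1 _));
  apply: tens_filZ Zc _; have MF := hmon_span_sub (adF_hmon_span D n mb).
  have ME := hmon_span_sub (Zspan_in (monMr ma (hmon_eX n))).
  by case: pE => ->; [apply: tens_fil_mon_l ME MF | apply: tens_fil_mon_r ME MF].
apply: tens_fil_mon_l _ MF; apply: hmon_span_sub (Zspan_in (mon_le (half_le n) _)).
exact: monMl (mon_hmon ma) (mon_eX n).
Qed.

Lemma tmul_cop_tw p1 p2 q1 q2 r1 r2 X Y :
  (forall k l x y, mon p1 k x -> mon q1 l y -> mon r1 (k + l) (x * y)) ->
  (forall k l x y, mon p2 k x -> mon q2 l y -> mon r2 (k + l) (x * y)) ->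
  Zspan (cop_tw p1 p2) X -> Zspan (cop_tw q1 q2) Y -> Zspan (cop_tw r1 r2) (tmul X Y).
Proof.
move=> m1 m2; apply: Zspan_bind2 (@tmul_bilin 2) _ => {}X {}Y.
move=> [a [b [ka [l [ma mb ->]]]]] [a' [b' [ka' [l' [ma' mb' ->]]]]].
rewrite tmul_pure2 (mul4_swap a (Kx l') (Kx_wt l (mon_wt ma'))) -KxD.
rewrite (linZ (pure2_bilin.1 _)); apply: ZspanZ (qz_Zq _) _; apply: Zspan_in.
exists (a * a'), (b * b'), (ka + ka'), (l + l'); split=> //; [exact: m1 | exact: m2].
Qed.

Lemma mon0M p k l x y : mon 0 k x -> mon p l y -> mon p (k + l) (x * y).
Proof. by move=> /mon_hmon; apply: monMl. Qed.

Lemma monM0 p k l x y : mon p k x -> mon 0 l y -> mon p (k + l) (x * y).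
Proof. by move=> mx /mon_hmon; apply: monMr. Qed.

Lemma cop_hmon k x : hmon k x -> Zspan (cop_tw 0 0) (cop D x).
Proof.
have cop_twI a b ka l : hmon ka a -> hmon l b -> Zspan (cop_tw 0 0) (pure2 (a * Kx l) b).
  by move=> ha hb; apply: Zspan_in; exists a, b, ka, l; split=> //; apply: hmon_mon0.
have cop_twI0 a b ka : hmon ka a -> hmon 0 b -> Zspan (cop_tw 0 0) (pure2 a b).
  by move=> ha hb; have := cop_twI _ _ _ _ ha hb; rewrite Kx0 mulr1.
elim=> [||||n|{}k l {}x y _ Zx _ Zy].
- by rewrite cop_1E; apply: cop_twI0 hmon1 hmon1.
- by rewrite cop_Kx; apply: cop_twI0 hmonK hmonK.
- by rewrite cop_Kx; apply: cop_twI0 hmonKV hmonKV.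
- rewrite cop_e; apply: ZspanD; first exact: cop_twI0 hmon_e hmon1.
  by have := cop_twI _ _ _ _ hmon1 hmon_e; rewrite mul1r.
- rewrite cop_Fd; apply: Zspan_sum => i _; set j := (n - i)%N.
  (* F~(j) has degree -j, so the twist has to be K^(-j); the remaining K^(2j) is an even power and
     belongs to the integral form. *)
  have -> : Kx j%:Z = Kx (2 * j%:Z) * Kx (- j%:Z) by rewrite -KxD; congr Kx; lia.
  by rewrite mulrA; apply: cop_twI (hmonM (hmon_F i) (hmon_K j)) (hmon_F j).
- by rewrite cop_mul; apply: tmul_cop_tw Zx Zy => *; apply: mon0M.
Qed.

Lemma cop_eX n : Zspan [set X | exists i j, (i + j)%N = n /\
  X = pure2 (xe ^+ i * Kx j%:Z) (xe ^+ j)] (cop D (xe ^+ n)).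
Proof.
elim: n => [|n IHn].
  by apply: Zspan_in; exists 0%N, 0%N; split=> //; rewrite cop_1E Kx0 mulr1.
rewrite exprS cop_mul; apply: (Zspan_bind ((@tmul_bilin 2).2 _) _ IHn).
move=> _ [i [j [ijn ->]]]; rewrite (tmul_two _ _ (cop_e D)).
apply: ZspanD.
  by apply: Zspan_in; exists i.+1, j; rewrite mulrA -!exprS; split=> //; lia.
rewrite mulrA (Kx_wt 1 (wt_eX i)) -(UhZl _ (xe ^+ i * _)) (linZ (pure2_bilin.1 _)).
apply: ZspanZ (qz_Zq _) _; apply: Zspan_in; exists i, j.+1.
by rewrite -mulrA -KxD -!exprS; split; last congr (pure2 (_ * Kx _) _); lia.
Qed.

(** In a product of [2 p] primitive-like elements [e], one tensor factor receives at
  least [p] of them. *)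
Lemma cop_mon p k x : mon p.*2 k x -> exists X Y,
  [/\ Zspan (cop_tw p 0) X, Zspan (cop_tw 0 p) Y & cop D x = X + Y].
Proof.
move=> [a [b [ka [kb [/cop_hmon Za /cop_hmon Zb _ ->]]]]].
have [X [Y [ZX ZY XY]]] : exists X Y,
    [/\ Zspan (cop_tw p 0) X, Zspan (cop_tw 0 p) Y & cop D (xe ^+ p.*2) = X + Y].
  elim: (cop_eX p.*2) => [|_ [i [j [ij ->]]]|
    c X1 X2 Zc _ [Y1 [Z1 [ZY1 ZZ1 ->]]] _ [Y2 [Z2 [ZY2 ZZ2 ->]]]].
  - by exists 0, 0; rewrite addr0; split=> //; apply: Zspan0.
  - case: (leqP p i) => le_pi.
      exists (pure2 (xe ^+ i * Kx j%:Z) (xe ^+ j)), 0; rewrite addr0.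
      split=> //; last exact: Zspan0.
      apply: Zspan_in; exists (xe ^+ i), (xe ^+ j), i%:Z, j%:Z; split=> //.
        exact: mon_le le_pi (mon_eX i).
      exact: hmon_mon0 (hmon_eX j).
    exists 0, (pure2 (xe ^+ i * Kx j%:Z) (xe ^+ j)); rewrite add0r.
    split=> //; first exact: Zspan0.
    apply: Zspan_in; exists (xe ^+ i), (xe ^+ j), i%:Z, j%:Z; split=> //.
      exact: hmon_mon0 (hmon_eX i).
    by apply: mon_le (mon_eX j); lia.
  - exists (c *: Y1 + Y2), (c *: Z1 + Z2).
    by split; [exact: Zspan_lin | exact: Zspan_lin | rewrite scalerDr addrACA].
exists (tmul (tmul (cop D a) X) (cop D b)), (tmul (tmul (cop D a) Y) (cop D b)); split.
- by apply: tmul_cop_tw (tmul_cop_tw _ _ Za ZX) Zb; try exact: mon0M; exact: monM0.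
- by apply: tmul_cop_tw (tmul_cop_tw _ _ Za ZY) Zb; try exact: mon0M; exact: monM0.
- rewrite (cop_mul D (a * _) b) (cop_mul D a) XY.
  by rewrite (linD ((@tmul_bilin 2).2 _)) (linD ((@tmul_bilin 2).1 _)).
Qed.

Lemma bcop_continuous : induces_continuous (bcop D).
Proof.
apply: (induces_continuousP bcop_linear) => p z.
apply: (tens_fil1_bind bcop_linear) => k x mx; rewrite bcop_pure1.
have [X [Y [ZX ZY ->]]] := cop_mon mx.
rewrite (linD bcop_out_linear); apply: tens_nbhsD.
  by apply: (tens_nbhs_bind bcop_out_linear _ ZX) => ?; apply: bcop_out_cop_tw; left.
by apply: (tens_nbhs_bind bcop_out_linear _ ZY) => ?; apply: bcop_out_cop_tw; right.
Qed.

(** * The braided antipode and its inverse *)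

Lemma hmon_twS k x : hmon k x -> exists c x', [/\ is_Zq c, hmon k x' & twS D k x = c *: x'].
Proof.
elim=> [||||n|{}k l {}x y hx [c [x' [Zc hx' xE]]] hy [d [y' [Zd hy' yE]]]].
- exists 1, 1; rewrite /twS Kx0 apd_1 mulr1 scale1r.
  by split=> //; [apply: Zq_1 | apply: hmon1].
- by exists 1, (Kx (- 2)); rewrite twS_Kx scale1r; split=> //; [apply: Zq_1 | apply: hmonKV].
- exists 1, (Kx 2); rewrite twS_Kx opprK scale1r.
  by split=> //; [apply: Zq_1 | apply: hmonK].
- exists (- 1), xe; rewrite twS_e scaleN1r.
  by split=> //; [apply/ZqN/Zq_1 | apply: hmon_e].
- have [c Zc cE] := twS_Fd D n; exists c, (Fd n * Kx (- (n%:Z *+ 2))); split=> //.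
  have -> : - (n%:Z *+ 2) = - (2 * n%:Z) by lia.
  by apply: hmon_eq (hmonM (hmon_F n) (hmon_KV n)) _; rewrite addr0.
- exists (qz (k * l) * (d * c)), (y' * x'); split.
  + by apply: Zq_mul (qz_Zq _) _; apply: Zq_mul.
  + by apply: hmon_eq (hmonM hy' hx') _; rewrite addrC.
  + rewrite (twSM D (hmon_wt hx) (hmon_wt hy)) xE yE -(UhZl d) -(UhZr c) !scalerA.
    by rewrite mulrA.
Qed.

Lemma UhZZ (a b : Qh) (x y : Uh) : (a *: x) * (b *: y) = (a * b) *: (x * y).
Proof. by rewrite -(UhZl a x) -(UhZr b x y) scalerA. Qed.

Lemma scale3 (c1 c2 d1 d2 d3 : Qh) (x y z : Uh) :
  c1 *: ((d1 *: x) * (c2 *: ((d2 *: y) * (d3 *: z)))) =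
  (c1 * (d1 * (c2 * (d2 * d3)))) *: (x * y * z).
Proof.
have e1 := congr1 (fun t => c2 *: t) (UhZZ d2 d3 y z).
have e2 := congr1 (fun t => c1 *: ((d1 *: x) * t)) (etrans e1 (scalerA _ _ _)).
apply: etrans e2 _; rewrite UhZZ scalerA (mulrA x y z).
reflexivity.
Qed.

Lemma mon_twS p k x : mon p k x -> exists c x', [/\ is_Zq c, mon p k x' & twS D k x = c *: x'].
Proof.
move=> [a [b [ka [kb [ha hb -> ->]]]]].
have [ca [a' [Za ha' aE]]] := hmon_twS ha; have [cb [b' [Zb hb' bE]]] := hmon_twS hb.
have [ce Ze eE] := twS_eX D p.
exists (qz ((ka + p%:Z) * kb) * (cb * (qz (ka * p%:Z) * (ce * ca)))), (b' * xe ^+ p * a').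
split.
- by do ?[exact: qz_Zq | assumption | apply: Zq_mul].
- by exists b', a', kb, ka; split=> //; lia.
- rewrite (twSM D (wtM (hmon_wt ha) (wt_eX p)) (hmon_wt hb)).
  rewrite (twSM D (hmon_wt ha) (wt_eX p)) aE bE eE.
  exact: scale3.
Qed.

Lemma sweedler_pure1 X (B : Uh -> Uh -> Uh) : bilinear_for B ->
  pure1 (sweedler X B) = sweedler X (fun a b => pure1 (B a b)).
Proof.
move=> bB; have bB1 : bilinear_for (fun a b => pure1 (B a b)).
  by split=> [y|x]; [exact: lin_comp pure1_linear (bB.1 y) |
                     exact: lin_comp pure1_linear (bB.2 x)].
symmetry; apply: (sweedlerE (hcomplete_T 1) bB1 (g := fun X => pure1 (sweedler X B))).
  exact: lin_comp pure1_linear (sweedler_linear hcomplete_Uh bB).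
by move=> x y; rewrite (sweedler_pure2 hcomplete_Uh bB).
Qed.

(** Shared by both antipodes: the first leg acts on a weight vector, and the powers of H of the
    second leg, placed in the last slot of [L], sum up to K^l. *)
Lemma pure1_term (L : Uh -> Uh -> Uh -> Uh) (f : Uh -> Uh -> Uh) l n x :
  (forall z, bilinear_for (fun u w => L u w z)) -> (forall u w, linear (L u w)) ->
  (forall m, f (xH ^+ m * xF ^+ n) (xH ^+ m * xE ^+ n) =
     fpsC ((2%:R * l%:~R) ^+ m) *: L (xE ^+ n) (ad D (xF ^+ n) x) (xH ^+ m)) ->
  Rcoef n *: exp_sum 4%:R^-1
    (fun m => pure1 (f (xH ^+ m * xF ^+ n) (xH ^+ m * xE ^+ n))) =
  Rqpow n *: pure1 (L (xe ^+ n) (adF D n x) (Kx l)).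
Proof.
move=> bL lL fE; pose phi z := pure1 (L (xE ^+ n) (ad D (xF ^+ n) x) z).
have lphi : linear phi by exact: lin_comp pure1_linear (lL _ _).
have bB : bilinear_for (fun u w => pure1 (L u w (Kx l))).
  by split=> [y|y]; [exact: lin_comp pure1_linear ((bL _).1 y) |
                     exact: lin_comp pure1_linear ((bL _).2 y)].
have e m : pure1 (f (xH ^+ m * xF ^+ n) (xH ^+ m * xE ^+ n)) =
    phi (fpsC ((2%:R * l%:~R) ^+ m) *: xH ^+ m).
  by rewrite fE (linZ lphi) (linZ pure1_linear).
rewrite (eq_exp_sum _ e) -[exp_sum _ _](exp_sum_lin _ _ lphi hcomplete_Uh (@hseparated_T 1)).
rewrite exp_sum_Kx -[phi _]scale1r.
apply: etrans (Rcoef_split n 1 (xE ^+ n) (ad D (xF ^+ n) x) bB) _.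
apply: eq_scale; first exact: mulr1.
by rewrite xeX.
Qed.

Definition bapd_ab x a b : Uh := b * S (ad D a x).

Lemma bapd_ab_bilin x : bilinear_for (bapd_ab x).
Proof. exact: bilin_swap (bilin_comp mulUh_bilin (@lin_id Uh) (lin_comp lS (ad_l x))). Qed.

Let bapd_lin1 : linear (fun x => pure1 (sweedler Rmx (bapd_ab x))).
Proof.
apply: lin_comp pure1_linear _.
apply: (sweedler_linear_param _ hcomplete_Uh bapd_ab_bilin) => a b.
exact: lin_comp (mulUh_bilin.2 b) (lin_comp lS (ad_r a)).
Qed.

Lemma bapd_linear : linear (bapd D).
Proof. exact: clift_linear (hcomplete_T 1) (multilin1 bapd_lin1). Qed.

Lemma bapd_pure1 x : bapd D (pure1 x) = pure1 (sweedler Rmx (bapd_ab x)).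
Proof. exact: clift_pure (hcomplete_T 1) (multilin1 bapd_lin1) [tuple x]. Qed.

Lemma bapd_nbhs p k x : mon p k x -> tens_nbhs p (bapd D (pure1 x)).
Proof.
move=> mx; rewrite bapd_pure1 (sweedler_pure1 _ (bapd_ab_bilin x)).
pose L (u w z : Uh) := z * u * S w.
have bL z : bilinear_for (fun u w => L u w z).
  exact: (bilin_comp mulUh_bilin (mulUh_bilin.2 z) lS).
have lL u w : linear (L u w).
  exact: lin_comp (mulUh_bilin.1 _) (mulUh_bilin.1 u).
have bf : bilinear_for (fun a b => pure1 (bapd_ab x a b)).
  by split=> [y|y]; [exact: lin_comp pure1_linear ((bapd_ab_bilin x).1 y) |
                     exact: lin_comp pure1_linear ((bapd_ab_bilin x).2 y)].
have tE n : Rcoef n *: exp_sum 4%:R^-1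
      (fun m => pure1 (bapd_ab x (xH ^+ m * xF ^+ n) (xH ^+ m * xE ^+ n))) =
    Rqpow n *: pure1 (L (xe ^+ n) (adF D n x) (Kx (k - n%:Z))).
  apply: pure1_term bL lL _ => m; rewrite /bapd_ab /L.
  rewrite (ad_xHX_mul m (wt_ad_xFX D n (mon_wt mx))) (linZ lS).
  by rewrite -(UhZr _ (xH ^+ m * xE ^+ n)).
have spanL n : Zspan [set z | exists2 y, mon p (k - n%:Z) y & z = xe ^+ n * y]
    (L (xe ^+ n) (adF D n x) (Kx (k - n%:Z))).
  apply: (Zspan_bind ((bL _).2 _) _ (adF_hmon_span D n mx)) => y my.
  have [c [y' [Zc my' yE]]] := mon_twS my.
  (* Moved past e^n, the power K^(k-n) meets S(y) with y of degree k - n, which is exactly the twist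
     that makes S integral. *)
  rewrite /L (Kx_wt _ (wt_eX n)) -(UhZl _ (xe ^+ n * _)) -mulrA -/(twS D _ y) yE.
  rewrite -(UhZr c); apply: ZspanZ (qz_Zq _) _; apply: ZspanZ Zc _.
  by apply: Zspan_in; exists y'.
apply: (tens_nbhs_Rmx bf tE) => n; apply: tens_filZ (Rqpow_Zq n) _; apply/tens_fil_pure1/(Zspan_sub _ (spanL n)).
  move=> _ [y my ->]; apply: Zspan_in; exists (n%:Z + (k - n%:Z)).
  exact: monMl (hmon_eX n) my.
move=> _ [y my ->]; apply: Zspan_in; exists (n%:Z + (k - n%:Z)).
exact: mon_le (half_le n) (monMr (mon_eX n) (mon_hmon my)).
Qed.

Definition bapd_inv_ab x a b : Uh := apd_inv D (ad D a x) * b.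

Lemma bapd_inv_ab_bilin x : bilinear_for (bapd_inv_ab x).
Proof.
exact: bilin_comp mulUh_bilin (lin_comp (@apd_inv_linear D) (ad_l x)) (@lin_id Uh).
Qed.

Let bapd_inv_lin1 : linear (fun x => pure1 (sweedler Rmx (bapd_inv_ab x))).
Proof.
apply: lin_comp pure1_linear _.
apply: (sweedler_linear_param _ hcomplete_Uh bapd_inv_ab_bilin) => a b.
exact: lin_comp (mulUh_bilin.1 b) (lin_comp (@apd_inv_linear D) (ad_r a)).
Qed.

Lemma bapd_inv_linear : linear (bapd_inv D).
Proof. exact: clift_linear (hcomplete_T 1) (multilin1 bapd_inv_lin1). Qed.

Lemma bapd_inv_pure1 x : bapd_inv D (pure1 x) = pure1 (sweedler Rmx (bapd_inv_ab x)).
Proof. exact: clift_pure (hcomplete_T 1) (multilin1 bapd_inv_lin1) [tuple x]. Qed.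

Lemma bapd_inv_nbhs p k x : mon p k x -> tens_nbhs p (bapd_inv D (pure1 x)).
Proof.
move=> mx; rewrite bapd_inv_pure1 (sweedler_pure1 _ (bapd_inv_ab_bilin x)).
pose L (u w z : Uh) := apd_inv D w * (z * u).
have bL z : bilinear_for (fun u w => L u w z).
  exact: bilin_swap (bilin_comp mulUh_bilin (@apd_inv_linear D) (mulUh_bilin.2 z)).
have lL u w : linear (L u w).
  exact: lin_comp (mulUh_bilin.2 _) (mulUh_bilin.1 u).
have bf : bilinear_for (fun a b => pure1 (bapd_inv_ab x a b)).
  by split=> [y|y]; [exact: lin_comp pure1_linear ((bapd_inv_ab_bilin x).1 y) |
                     exact: lin_comp pure1_linear ((bapd_inv_ab_bilin x).2 y)].
have tE n : Rcoef n *: exp_sum 4%:R^-1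
      (fun m => pure1 (bapd_inv_ab x (xH ^+ m * xF ^+ n) (xH ^+ m * xE ^+ n))) =
    Rqpow n *: pure1 (L (xe ^+ n) (adF D n x) (Kx (k - n%:Z))).
  apply: pure1_term bL lL _ => m; rewrite /bapd_inv_ab /L.
  rewrite (ad_xHX_mul m (wt_ad_xFX D n (mon_wt mx))) (linZ (@apd_inv_linear D)).
  by rewrite (UhZl _ (apd_inv D _)).
have spanL n : Zspan [set z | exists2 y, mon p (k - n%:Z) y & z = y * xe ^+ n]
    (L (xe ^+ n) (adF D n x) (Kx (k - n%:Z))).
  apply: (Zspan_bind ((bL _).2 _) _ (adF_hmon_span D n mx)) => y my.
  have [c [y' [Zc my' yE]]] := mon_twS my.
  (* On degree k - n the inverse of S is q^(k-n) S; moving K^(k-n) to the left of S(y) then gives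
     the same twisted antipode. *)
  rewrite /L (apd_inv_wt D (mon_wt my)) -(UhZl _ (S y)) mulrA.
  rewrite (wt_KxV _ (wt_apd D (mon_wt my))) -/(twS D _ y) yE scalerA.
  rewrite -(UhZl _ y'); apply: ZspanZ (qz_Zq _) _; apply: ZspanZ (Zq_mul (qz_Zq _) Zc) _.
  by apply: Zspan_in; exists y'.
apply: (tens_nbhs_Rmx bf tE) => n; apply: tens_filZ (Rqpow_Zq n) _; apply/tens_fil_pure1/(Zspan_sub _ (spanL n)).
  move=> _ [y my ->]; apply: Zspan_in; exists ((k - n%:Z) + n%:Z).
  exact: monMr my (hmon_eX n).
move=> _ [y my ->]; apply: Zspan_in; exists ((k - n%:Z) + n%:Z).
exact: mon_le (half_le n) (monMl (mon_hmon my) (mon_eX n)).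
Qed.

Lemma bapd_continuous : induces_continuous (bapd D).
Proof.
apply: (induces_continuousP bapd_linear) => p z Iz.
have {}Iz : tens_fil p z by apply: tens_fil_le Iz; lia.
by apply: (tens_fil1_bind bapd_linear _ Iz) => k x; apply: bapd_nbhs.
Qed.

Lemma bapd_inv_continuous : induces_continuous (bapd_inv D).
Proof.
apply: (induces_continuousP bapd_inv_linear) => p z Iz.
have {}Iz : tens_fil p z by apply: tens_fil_le Iz; lia.
by apply: (tens_fil1_bind bapd_inv_linear _ Iz) => k x; apply: bapd_inv_nbhs.
Qed.

End Maps.

Theorem theorem3p1 (D : Uh_Hopf) :
  induces_continuous (psi D) /\
  induces_continuous (psi_inv D) /\
  induces_continuous bmul /\
  induces_continuous bunit /\
  induces_continuous (bcop D) /\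
  induces_continuous (bcounit D) /\
  induces_continuous (bapd D) /\
  induces_continuous (bapd_inv D).
Proof.
split; first exact: psi_continuous.
split; first exact: psi_inv_continuous.
split; first exact: bmul_continuous.
split; first exact: bunit_continuous.
split; first exact: bcop_continuous.
split; first exact: bcounit_continuous.
split; first exact: bapd_continuous.
exact: bapd_inv_continuous.
Qed.
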